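(* Let $n\ge 1$, $\omega=e^{2\pi\sqrt{-1}/(n+1)}$, and let $(E,\eta,g,\Phi)$ be a tt*-structure of rank $n+1$ over $\mathbb{C}^*$ with non-vanishing $\Phi$. Suppose there exists an isomorphism of tt*-structures $$\mathcal{T}:(E,\eta,g,\Phi)\stackrel{\sim}{\longrightarrow}(E,\eta,g,\omega\Phi).$$ Then there exist a coordinate $t$ of $\mathbb{C}^*$ and a frame of $E$ such that the tt*-equation with respect to this frame is $$(w_j)_{t\bar t}=e^{w_j-w_{j-1}}-e^{w_{j+1}-w_j},\qquad j=0,\dots,n,$$ where $w_{-1}=w_n$, $w_{n+1}=w_0$, with the condition (for $j=0,\dots,n$) $$w_j+w_{n-j}=0\ \text{ if }\ \mathcal{T}^{n+1}=-\mathrm{Id}_E,\qquad w_j+w_{n+1-j}=0\ \text{ if }\ \mathcal{T}^{n+1}=\mathrm{Id}_E;$$ i.e. $(E,\eta,g,\Phi)$ is a Toda-type tt*-structure, whose associated solution of the tt*-Toda equation (given by $g(e_i,e_j)=e^{w_j}\delta_{ij}$ in this frame) satisfies the stated condition.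
   Context: A tt*-structure $(E,\eta,g,\Phi)$ over $\mathbb{C}^*$ is a holomorphic vector bundle $E\to\mathbb{C}^*$ with holomorphic structure $\bar\partial_E$, a holomorphic nondegenerate symmetric bilinear form $\eta$, a Hermitian metric $g$ and a holomorphic $\mathrm{End}(E)$-valued 1-form $\Phi$ such that: (a) $\Phi$ is self-adjoint with respect to $\eta$; (b) the map $\kappa$ defined by $g(a,b)=\eta(\kappa(a),b)$ is a complex conjugate-linear involution, i.e. $\kappa^2=\mathrm{Id}_E$ and $\kappa(\mu a)=\bar\mu\,\kappa(a)$; (c) for every $\lambda\in S^1$ the connection $\nabla^\lambda=D+\lambda^{-1}\Phi+\lambda\Phi^{\dagger_g}$ is flat, where $D=\partial_E^g+\bar\partial_E$ is the Chern connection of $g$ and $\Phi^{\dagger_g}$ is the $g$-adjoint of $\Phi$. The flatness condition $[\partial_E^g,\bar\partial_E]=-[\Phi,\Phi^{\dagger_g}]=-(\Phi\wedge\Phi^{\dagger_g}+\Phi^{\dagger_g}\wedge\Phi)$ is called the tt*-equation. An isomorphism $T:(E_1,\eta_1,g_1,\Phi_1)\to(E_2,\eta_2,g_2,\Phi_2)$ is a bundle map of holomorphic bundles with $\eta_1(a,b)=\eta_2(Ta,Tb)$, $g_1(a,b)=g_2(Ta,Tb)$, $T((\Phi_1)_X(a))=(\Phi_2)_X(T(a))$ for all sections $a,b$ and tangent vector fields $X$ of $\mathbb{C}^*$. The tt*-Toda equation is $(w_j)_{t\bar t}=e^{w_j-w_{j-1}}-e^{w_{j+1}-w_j}$, $w_j:\mathbb{C}^*\to\mathbb{R}$,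 with the conditions (i) $w_j=w_{j+n+1}$ (periodicity) and (ii) $w_j+w_{l-j-1}=0$ (anti-symmetry) for some $l\in\mathbb{Z}$. $(E,\eta,g,\Phi)$ is a Toda-type tt*-structure if there is a frame $e_0,\dots,e_n$ of $E$ such that, for some $l\in\{0,\dots,n\}$, $\eta(e_i,e_j)=\delta_{i,l-1-j}$ if $0\le i\le l-1$ and $\eta(e_i,e_j)=\delta_{i,n+l-j}$ if $l\le i\le n$; $\Phi(e_j)=e_{j+1}\,dt$ for $0\le j\le n-1$ and $\Phi(e_n)=e_0\,dt$; and $g(e_i,e_j)=e^{w_j}\delta_{ij}$ for a solution $\{w_j\}_{j=0}^n$ of the tt*-Toda equation. Here $t$ is the coordinate of $\mathbb{C}^*$; it is not fixed in advance but may be chosen.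
   Formalization: Non-vanishing Φ is taken to mean that Φ_X is invertible for every X ≠ 0, and the coordinate t and the frame may be multivalued, i.e. are defined on the universal covering of C* (the functions w_j are single-valued on C* ); under the literal reading the claim has counterexamples. *)

(* Defs.v *)
From HB Require Import structures.
From mathcomp Require Import all_boot all_order all_algebra.
From mathcomp Require Import complex.
From mathcomp Require Import all_classical all_reals all_analysis.
Set Implicit Arguments.
Unset Strict Implicit.
Unset Printing Implicit Defensive.
Import Order.TTheory GRing.Theory Num.Theory.
Import numFieldNormedType.Exports.
Local Open Scope classical_set_scope.
Local Open Scope ring_scope.
Local Open Scope complex_scope.

(** The complex numbers are [R[i]] for an arbitrary [R : realType]; their
    topology is that of the alias [R[i]^o]. *)

(** Derivative of [f] at [z] along [v] over the reals; the library derivative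
    on [R[i]^o] would be the complex one. *)
Definition rderivable (R : realType) (v : R[i]) (f : R[i] -> R[i])
    (z : R[i]) : Prop :=
  derivable (fun h : R => complex.Re (f (z + h%:C * v))) 0 1 /\
  derivable (fun h : R => complex.Im (f (z + h%:C * v))) 0 1.

Definition rderive (R : realType) (v : R[i]) (f : R[i] -> R[i])
    (z : R[i]) : R[i] :=
  derive1 (fun h : R => complex.Re (f (z + h%:C * v))) 0 +i*
  derive1 (fun h : R => complex.Im (f (z + h%:C * v))) 0.

(** Meant for open [U]. *)
Fixpoint Ck (R : realType) (k : nat) (U : set R[i]) (f : R[i] -> R[i]) : Prop :=
  (forall z, U z -> {for z, continuous (f : R[i]^o -> R[i]^o)}) /\
  if k is k'.+1 then
    [/\ forall z, U z -> rderivable 1 f z,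
        forall z, U z -> rderivable 'i f z,
        Ck k' U (rderive 1 f) & Ck k' U (rderive 'i f)]
  else True.

Definition smooth_on (R : realType) (U : set R[i]) (f : R[i] -> R[i]) : Prop :=
  forall k, Ck k U f.

(** Wirtinger derivatives. *)
Definition dz (R : realType) (f : R[i] -> R[i]) (z : R[i]) : R[i] :=
  (rderive 1 f z - 'i * rderive 'i f z) / 2%:R.

Definition dzbar (R : realType) (f : R[i] -> R[i]) (z : R[i]) : R[i] :=
  (rderive 1 f z + 'i * rderive 'i f z) / 2%:R.

Definition holomorphic_on (R : realType) (U : set R[i]) (f : R[i] -> R[i]) :
    Prop :=
  smooth_on U f /\ forall z, U z -> dzbar f z = 0.

Definition cexp (R : realType) (z : R[i]) : R[i] :=
  (expR (complex.Re z))%:C * (cos (complex.Im z) +i* sin (complex.Im z)).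

(** Holomorphic vector bundles of rank [r] over the punctured plane: fibres
    together with local frames whose transition functions are holomorphic. The
    fibre and frames over [0] are irrelevant. *)
Record holBundle (R : realType) (r : nat) := HolBundle {
  fiber :> R[i] -> vectType R[i];
  chart : Type;
  dom : chart -> set R[i];
  frame : forall (i : chart) (z : R[i]), r.-tuple (fiber z);
  dom_open : forall i, open (dom i : set R[i]^o);
  dom_neq0 : forall i (z : R[i]), dom i z -> z != 0;
  dom_cover : forall z : R[i], z != 0 -> exists i, dom i z;
  frame_basis : forall i z, dom i z -> basis_of fullv (frame i z);
  frame_holomorphic : forall i j (a b : 'I_r),
    holomorphic_on (dom i `&` dom j)
      (fun z => coord (frame i z) a (frame j z)`_b)
}.

(** [higgs S z X] is the endomorphism [Phi_X] of the fibre at [z], where the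
    tangent vector [X] stands for [X * d/dz]. *)
Record ttData (R : realType) (r : nat) (E : holBundle R r) := TtData {
  eta : forall z, E z -> E z -> R[i];
  metric : forall z, E z -> E z -> R[i];
  higgs : forall z, R[i] -> E z -> E z
}.

Definition scale_higgs (R : realType) (r : nat) (E : holBundle R r) (c : R[i])
    (S : ttData E) : ttData E :=
  TtData (@eta _ _ _ S) (@metric _ _ _ S) (fun z X v => c *: higgs S X v).

Section Local.
Context (R : realType) (r : nat) (E : holBundle R r) (S : ttData E).

Definition eta_mx (i : chart E) (z : R[i]) : 'M[R[i]]_r :=
  \matrix_(a, b) eta S (frame i z)`_a (frame i z)`_b.

Definition gram_mx (i : chart E) (z : R[i]) : 'M[R[i]]_r :=
  \matrix_(a, b) metric S (frame i z)`_a (frame i z)`_b.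

(** [Phi = higgs_mx i z dz] in the frame [i], acting on coordinate columns. *)
Definition higgs_mx (i : chart E) (z : R[i]) : 'M[R[i]]_r :=
  \matrix_(a, b) coord (frame i z) a (higgs S 1 (frame i z)`_b).
End Local.

Definition dz_mx (R : realType) (r : nat) (A : R[i] -> 'M[R[i]]_r) (z : R[i]) :
    'M[R[i]]_r :=
  \matrix_(a, b) dz (fun u => A u a b) z.

Definition dzbar_mx (R : realType) (r : nat) (A : R[i] -> 'M[R[i]]_r)
    (z : R[i]) : 'M[R[i]]_r :=
  \matrix_(a, b) dzbar (fun u => A u a b) z.

(** The [dz /\ dzbar] coefficient of the curvature of [d + A dz + B dzbar]. *)
Definition curvature (R : realType) (r : nat) (A B : R[i] -> 'M[R[i]]_r)
    (z : R[i]) : 'M[R[i]]_r :=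
  dz_mx B z - dzbar_mx A z + (A z *m B z - B z *m A z).

Section Connection.
Context (R : realType) (r : nat) (E : holBundle R r) (S : ttData E).

(** With [metric] conjugate-linear in its first argument, [g(u, v) = u^* G v]
    in coordinates; hence the Chern connection is [d + G^-1 (dG/dz) dz] in a
    holomorphic frame. *)
Definition chern_mx (i : chart E) (z : R[i]) : 'M[R[i]]_r :=
  invmx (gram_mx S i z) *m dz_mx (gram_mx S i) z.

(** The [dzbar] coefficient of the [g]-adjoint of [Phi]: the solution [N] of
    [g(M u, v) = g(u, N v)], where [Phi = M dz]. *)
Definition higgs_adj_mx (i : chart E) (z : R[i]) : 'M[R[i]]_r :=
  invmx (gram_mx S i z) *m (map_mx conjc (higgs_mx S i z))^T *m gram_mx S i z.

Definition tt_flat (lambda : R[i]) : Prop :=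
  forall (i : chart E) z, dom i z ->
    curvature (fun u => chern_mx i u + lambda^-1 *: higgs_mx S i u)
              (fun u => lambda *: higgs_adj_mx i u) z = 0.
End Connection.

Record tt_structure (R : realType) (r : nat) (E : holBundle R r)
    (S : ttData E) : Prop := TtStructure {
  eta_linear : forall z : R[i], z != 0 -> forall (c : R[i]) (a a' b : E z),
    eta S (c *: a + a') b = c * eta S a b + eta S a' b;
  eta_sym : forall z : R[i], z != 0 -> forall a b : E z, eta S a b = eta S b a;
  eta_nondegenerate : forall z : R[i], z != 0 -> forall a : E z,
    (forall b, eta S a b = 0) -> a = 0;
  eta_holomorphic : forall (i : chart E) a b,
    holomorphic_on (dom i) (fun z => eta_mx S i z a b);
  metric_linear : forall z : R[i], z != 0 -> forall (c : R[i]) (a b b' : E z),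
    metric S a (c *: b + b') = c * metric S a b + metric S a b';
  metric_herm : forall z : R[i], z != 0 -> forall a b : E z,
    metric S b a = (metric S a b)^*;
  metric_pos : forall z : R[i], z != 0 -> forall a : E z,
    a != 0 -> 0 < metric S a a;
  metric_smooth : forall (i : chart E) a b,
    smooth_on (dom i) (fun z => gram_mx S i z a b);
  higgs_linear : forall z : R[i], z != 0 -> forall X (c : R[i]) (a b : E z),
    higgs S X (c *: a + b) = c *: higgs S X a + higgs S X b;
  higgs_form : forall z : R[i], z != 0 -> forall (c X Y : R[i]) (a : E z),
    higgs S (c * X + Y) a = c *: higgs S X a + higgs S Y a;
  higgs_holomorphic : forall (i : chart E) a b,
    holomorphic_on (dom i) (fun z => higgs_mx S i z a b);
  higgs_selfadjoint : forall z : R[i], z != 0 -> forall X (a b : E z),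
    eta S (higgs S X a) b = eta S a (higgs S X b);
  real_structure : exists kappa : forall z, E z -> E z,
    forall z : R[i], z != 0 ->
      [/\ forall a b : E z, metric S a b = eta S (kappa z a) b,
          forall a : E z, kappa z (kappa z a) = a &
          forall (c : R[i]) (a b : E z),
            kappa z (c *: a + b) = c^* *: kappa z a + kappa z b];
  connection_flat : forall lambda : R[i], `|lambda| = 1 -> tt_flat S lambda
}.

(** [Phi_X] is injective, i.e. [det Phi_X] does not vanish, for [X] nonzero. *)
Definition higgs_nonvanishing (R : realType) (r : nat) (E : holBundle R r)
    (S : ttData E) : Prop :=
  forall z : R[i], z != 0 -> forall (X : R[i]) (v : E z),
    X != 0 -> v != 0 -> higgs S X v != 0.

(** Bijectivity on fibres follows from the nondegeneracy of [eta]. *)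
Record tt_iso (R : realType) (r : nat) (E1 E2 : holBundle R r)
    (S1 : ttData E1) (S2 : ttData E2) (T : forall z, E1 z -> E2 z) : Prop :=
  TtIso {
  iso_linear : forall z : R[i], z != 0 -> forall (c : R[i]) (a b : E1 z),
    T z (c *: a + b) = c *: T z a + T z b;
  iso_holomorphic : forall (i : chart E1) (j : chart E2) (a b : 'I_r),
    holomorphic_on (dom i `&` dom j)
      (fun z => coord (frame j z) a (T z (frame i z)`_b));
  iso_eta : forall z : R[i], z != 0 -> forall a b : E1 z,
    eta S1 a b = eta S2 (T z a) (T z b);
  iso_metric : forall z : R[i], z != 0 -> forall a b : E1 z,
    metric S1 a b = metric S2 (T z a) (T z b);
  iso_higgs : forall z : R[i], z != 0 -> forall (X : R[i]) (a : E1 z),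
    T z (higgs S1 X a) = higgs S2 X (T z a)
}.

(** A coordinate [t] of the punctured plane, and a frame in which [Phi] has the
    constant form [e_j |-> e_(j+1) dt], are multivalued in general (for instance
    [t = z^(3/2)]). They are therefore functions of a point [s] of the
    universal covering [cexp], with [t] locally biholomorphic. *)
Definition coordinate (R : realType) (t : R[i] -> R[i]) : Prop :=
  holomorphic_on setT t /\ forall s, dz t s != 0.

(** The vector fields [d/dt] and [d/dtbar], written in the variable [s]. *)
Definition d_coord (R : realType) (t f : R[i] -> R[i]) (s : R[i]) : R[i] :=
  dz f s / dz t s.

Definition dbar_coord (R : realType) (t f : R[i] -> R[i]) (s : R[i]) : R[i] :=
  dzbar f s / (dz t s)^*.

(** Although [t] may be multivalued, each [w j] is a function on the punctured
    plane. *)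
Record tt_toda_solution (R : realType) (n : nat) (l : int) (t : R[i] -> R[i])
    (w : int -> R[i] -> R) : Prop := TtTodaSolution {
  toda_smooth : forall j,
    smooth_on [set z : R[i] | z != 0] (fun z => (w j z)%:C);
  toda_eq : forall j s,
    d_coord t (dbar_coord t (fun u => (w j (cexp u))%:C)) s =
    (expR (w j (cexp s) - w (j - 1) (cexp s)) -
     expR (w (j + 1) (cexp s) - w j (cexp s)))%:C;
  toda_periodic : forall j (z : R[i]), z != 0 -> w (j + n.+1%:Z) z = w j z;
  toda_antisym : forall j (z : R[i]), z != 0 -> w j z + w (l - j - 1) z = 0
}.

(** [S] is of Toda type, as witnessed by the coordinate [t], the frame [e] and
    the solution [w]. Since [s |-> cexp s] has derivative [cexp s], the pullback
    of [Phi] maps [X * d/ds] to [higgs S (cexp s * X)]; [ordS] is the cyclic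
    successor, so that [e_n] is mapped to [e_0 dt]. *)
Definition toda_frame (R : realType) (n : nat) (E : holBundle R n.+1)
    (S : ttData E) (t : R[i] -> R[i]) (e : 'I_n.+1 -> forall s, E (cexp s))
    (w : int -> R[i] -> R) : Prop :=
  [/\ coordinate t,
      forall s, basis_of fullv [tuple e j s | j < n.+1],
      forall (i : chart E) a j, holomorphic_on [set s | dom i (cexp s)]
        (fun s => coord (frame i (cexp s)) a (e j s)) &
      exists l : 'I_n.+1,
      [/\ forall (i j : 'I_n.+1) s, eta S (e i s) (e j s) =
            (if (i < l)%N then i + j + 1 == l else i + j == n + l)%N%:R,
          forall (j : 'I_n.+1) s X,
            higgs S (cexp s * X) (e j s) = (dz t s * X) *: e (ordS j) s,
          forall (i j : 'I_n.+1) s, metric S (e i s) (e j s) =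
            (if i == j then expR (w (val i)%:Z (cexp s)) else 0)%:C &
          tt_toda_solution n (val l)%:Z t w]].

Definition omega (R : realType) (n : nat) : R[i] :=
  cexp (0 +i* (2%:R * pi / n.+1%:R)).

(* Main.v *)
Require Import Defs.
From HB Require Import structures.
From mathcomp Require Import all_boot all_order all_algebra.
From mathcomp Require Import complex.
From mathcomp Require Import all_classical all_reals all_analysis.
From mathcomp Require Import ring lra zify.
Set Implicit Arguments.
Unset Strict Implicit.
Unset Printing Implicit Defensive.
Import Order.TTheory GRing.Theory Num.Theory.
Import numFieldNormedType.Exports.
Local Open Scope classical_set_scope.
Local Open Scope ring_scope.
Local Open Scope complex_scope.

(** The relation [T Phi = omega Phi T] shows that [Phi] permutes cyclically the
    eigenspaces of [T], which are therefore lines, orthogonal for [g] because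
    [T] is unitary. It follows that [Phi^(n+1)] is a scalar and that [T^(n+1)]
    is a constant sign. Pull back to the universal covering [z = cexp s], where
    [M = Phi_(z d/dz)] is the value of [Phi] on [d/ds]: there [M^(n+1)] has a
    holomorphic root [h], and a primitive [t] of [h] is the coordinate. For an
    eigenvalue [lambda] of [T] with [lambda^2 omega^k = 1], the conditions
    [T e = lambda e] and [eta (e, M^k e) = h^k] determine [e] up to a sign,
    which a monodromy argument fixes globally, and the frame is
    [e_j = h^-j M^j e]. The norms [g (e_j, e_j)] depend neither on the sign nor
    on the chosen root [h], so they are functions of [z]. The anti-symmetry is
    the involutivity of [kappa], and the Toda equation is the part of the
    flatness that is even in [lambda], written in this frame. *)

(** * Calculus in two real variables *)

Section RealCalculus.
Context {R : realType}.
Implicit Types (f df : R -> R) (u ux uy uxy uyx : R -> R -> R) (a b c d e : R).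

Lemma is_deriveP f a d : is_derive a 1 f d <->
  forall e, 0 < e -> \forall h \near (0 : R),
    `|f (a + h) - f a - d * h| <= e * `|h|.
Proof.
split=> [[fa fd] e e0|fd].
  have : h^-1 *: ((f \o shift a) (h *: 1) - f a) @[h --> 0^'] --> d.
    by rewrite -fd; exact: fa.
  move=> /cvgrPdist_le/(_ e e0); rewrite near_withinE.
  apply: filterS => h H; have [->|h0] := eqVneq h 0.
    by rewrite addr0 subrr mulr0 subrr normr0 mulr0.
  have := H h0; rewrite /= /GRing.scale /= mulr1 addrC.
  rewrite -(ler_pM2r (x := `|h|)) ?normr_gt0// -normrM mulrDl mulNr.
  by rewrite mulrAC mulVf// mul1r addrC distrC (addrC h).
have cd : h^-1 *: ((f \o shift a) (h *: 1) - f a) @[h --> 0^'] --> d.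
  apply/cvgrPdist_le => e e0; rewrite near_withinE.
  have := fd e e0; apply: filterS => h H h0.
  rewrite /= /GRing.scale /= mulr1 addrC.
  rewrite -(ler_pM2r (x := `|h|)) ?normr_gt0// -normrM mulrDl mulNr.
  by rewrite mulrAC mulVf// mul1r addrC distrC (addrC h).
by split; [apply/cvg_ex; exists d | exact: cvg_lim cd].
Qed.

Lemma near0P (P : R -> Prop) :
  (\forall h \near (0 : R), P h) <-> exists2 d, 0 < d & forall h, `|h| < d -> P h.
Proof.
split=> [/nbhs_ballP[d /= d0 H]|[d d0 H]].
  by exists d => // h hd; apply: H; rewrite /ball /= sub0r normrN.
by apply/nbhs_ballP; exists d => //= h; rewrite /ball /= sub0r normrN => /H.
Qed.

Lemma is_derive_cvg0 f a d : is_derive a 1 f d ->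
  forall e, 0 < e -> \forall h \near (0 : R), `|f (a + h) - f a| < e.
Proof.
move=> /is_deriveP fd e e0; have /near0P[r r0 H] := fd 1 ltr01.
apply/near0P; exists (Num.min r (e / (1 + `|d|))) => [|h].
  by rewrite lt_min r0/= divr_gt0// ltr_wpDr.
rewrite lt_min => /andP[/H {}H]; rewrite ltr_pdivlMr ?ltr_wpDr// => he.
rewrite (le_lt_trans _ he)// mulrDr mulr1 -[X in `|X|](subrK (d * h)).
rewrite (le_trans (ler_normD _ _))// lerD//; first by rewrite -(mul1r `|h|).
by rewrite normrM mulrC.
Qed.

Definition btw a b c := Num.min a b <= c <= Num.max a b.

Lemma btw_dist a b c : btw a b c -> `|c - a| <= `|b - a|.
Proof.
rewrite /btw minElt maxElt; case: ltP => ab /andP[p q].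
  by rewrite !ger0_norm ?lerB// subr_ge0// (le_trans p).
by rewrite !ler0_norm ?lerN2 ?lerB// subr_le0// (le_trans p).
Qed.

Lemma btwC a b c : btw a b c = btw b a c.
Proof. by rewrite /btw minC maxC. Qed.

Lemma MVT_btw f df a b :
  (forall c, btw a b c -> is_derive c 1 f (df c)) ->
  exists2 c, btw a b c & f b - f a = df c * (b - a).
Proof.
wlog ab : a b / a <= b => [hw fd|fd].
  have [ab|/ltW ba] := leP a b; first exact: hw.
  have [|c c1 c2] := hw _ _ ba; first by move=> c; rewrite btwC; exact: fd.
  by exists c; [rewrite btwC|rewrite -opprB c2 -mulrN opprB].
have seg c : c \in `[a, b] -> btw a b c by rewrite in_itv /btw min_l// max_r.
have [||c ci E] := @MVT_segment _ f df _ _ ab.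
- by move=> c ci; apply/fd/seg; exact: subset_itv_oo_cc ci.
- by apply: derivable_within_continuous => c ci; apply/ex_derive/fd/seg.
- by exists c => //; exact: seg.
Qed.

Lemma MVT_between f df a b :
  (forall c, `|c - a| <= `|b - a| -> is_derive c 1 f (df c)) ->
  exists2 c, `|c - a| <= `|b - a| & f b - f a = df c * (b - a).
Proof.
move=> fd; have [|c /btw_dist cab E] := @MVT_btw f df a b.
  by move=> c /btw_dist; exact: fd.
by exists c.
Qed.

Definition cont2 u a b := forall e, 0 < e -> exists2 d : R, 0 < d &
  forall x y : R, `|x - a| < d -> `|y - b| < d -> `|u x y - u a b| < e.

Definition near2 (P : R -> R -> Prop) a b := exists2 d : R, 0 < d &
  forall x y : R, `|x - a| < d -> `|y - b| < d -> P x y.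

Lemma near2I (P Q : R -> R -> Prop) a b : near2 P a b -> near2 Q a b ->
  near2 (fun x y => P x y /\ Q x y) a b.
Proof.
move=> [d d0 H] [d' d'0 H']; exists (Num.min d d'); first by rewrite lt_min d0.
by move=> x y; rewrite !lt_min => /andP[? ?] /andP[? ?]; split; [exact: H|exact: H'].
Qed.

Lemma is_derive_comp2 u ux (uy0 : R) (x y : R -> R) (dx dy : R) :
  near2 (fun a b => is_derive a 1 (u^~ b) (ux a b)) (x 0) (y 0) ->
  cont2 ux (x 0) (y 0) ->
  is_derive (y 0) 1 (u (x 0)) uy0 ->
  is_derive (0 : R) 1 x dx -> is_derive (0 : R) 1 y dy ->
  is_derive (0 : R) 1 (fun h => u (x h) (y h)) (dx * ux (x 0) (y 0) + dy * uy0).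
Proof.
move=> [r r0 Hux] cux duy ddx ddy.
have d2 : is_derive (0 : R) 1 (u (x 0) \o y) (uy0 * dy) by exact: is_derive1_comp.
suff d1 : is_derive (0 : R) 1 (fun h => u (x h) (y h) - u (x 0) (y h)) (dx * ux (x 0) (y 0)).
  have := is_deriveD d1 d2; rewrite (mulrC uy0).
  by congr is_derive; apply/funext => h /=; rewrite fctE /= subrK.
apply/is_deriveP => e e0; set A := ux _ _.
pose e1 := Num.min 1 (e / 2 / (1 + `|dx|)); pose e2 := e / 2 / (1 + `|A|).
have e10 : 0 < e1 by rewrite lt_min ltr01/= !divr_gt0// ltr_wpDr.
have e20 : 0 < e2 by rewrite !divr_gt0// ltr_wpDr.
have [r' r'0 Hc] := cux _ e10.
pose r2 := Num.min r r'.
have r20 : 0 < r2 by rewrite lt_min r0.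
have := is_derive_cvg0 ddx r20; have := is_derive_cvg0 ddy r20.
move: ddx => /is_deriveP/(_ _ e20).
apply: filterS3 => h; rewrite add0r => hx hyr hxr.
have [|c cx ->] := @MVT_between (u^~ (y h)) (ux^~ (y h)) (x 0) (x h) _.
  move=> c cx; apply: Hux; first by apply: (le_lt_trans cx (lt_le_trans hxr _)); rewrite ge_min lexx.
  by apply: lt_le_trans hyr _; rewrite ge_min lexx.
rewrite subrr subr0.
have hA : `|ux c (y h) - A| < e1.
  apply: Hc; first by apply: (le_lt_trans cx (lt_le_trans hxr _)); rewrite ge_min lexx orbT.
  by apply: lt_le_trans hyr _; rewrite ge_min lexx orbT.
set B := ux c (y h) in hA *; set X := x h - x 0.
rewrite -/X in hx *.
have -> : B * X - dx * A * h = (B - A) * (X - dx * h) + (B - A) * (dx * h) + A * (X - dx * h) by ring.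
have He : e * `|h| = e2 * `|h| + e / 2 * `|h| + `|A| * (e2 * `|h|).
  have : e2 * (1 + `|A|) = e / 2 by rewrite /e2 divfK// gt_eqF// ltr_wpDr.
  by move=> E; rewrite [e in LHS]splitr -{1}E; ring.
have hA1 : `|B - A| <= 1 by rewrite ltW// (lt_le_trans hA)// ge_min lexx.
have hA2 : `|B - A| * `|dx| <= e / 2.
  rewrite (@le_trans _ _ (e / 2 / (1 + `|dx|) * (1 + `|dx|)))//.
    rewrite ler_pM// ?lerDr// ltW// (lt_le_trans hA)// ge_min lexx orbT//.
  by rewrite divfK// gt_eqF// ltr_wpDr.
rewrite He (le_trans (ler_normD _ _))// lerD ?(le_trans (ler_normD _ _))// ?lerD// !normrM.
- by rewrite -[leRHS]mul1r ler_pM.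
- by rewrite mulrA ler_wpM2r.
- by rewrite ler_wpM2l.
Qed.

Lemma mixed_difference u ux uxy a b (h : R) : 0 < h ->
  (forall x y : R, `|x - a| <= h -> `|y - b| <= h ->
     is_derive x 1 (u^~ y) (ux x y) /\ is_derive y 1 (ux x) (uxy x y)) ->
  exists x y : R, [/\ `|x - a| <= h, `|y - b| <= h &
    u (a + h) (b + h) - u (a + h) b - u a (b + h) + u a b = uxy x y * h * h].
Proof.
move=> h0 H.
have nh : `|b + h - b| = h by rewrite addrC addKr gtr0_norm.
have nha : `|a + h - a| = h by rewrite addrC addKr gtr0_norm.
have [|x xa E] := @MVT_between (fun x => u x (b + h) - u x b)
  (fun x => ux x (b + h) - ux x b) a (a + h).
  move=> x; rewrite nha => xa; apply: is_deriveB.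
    by have [] := H x (b + h) xa; rewrite ?nh.
  by have [] := H x b xa; rewrite // subrr normr0 ltW.
rewrite nha in xa.
have [|y yb E'] := @MVT_between (ux x) (uxy x) b (b + h).
  by move=> y; rewrite nh => yb; have [] := H x y xa yb.
rewrite nh in yb; exists x, y; split=> //.
move: E; rewrite E' !(addrC a) !(addrC b) !addrK => <-; ring.
Qed.

Lemma schwarz u ux uy uxy uyx a b :
  near2 (fun x y => is_derive x 1 (u^~ y) (ux x y)) a b ->
  near2 (fun x y => is_derive y 1 (u x) (uy x y)) a b ->
  near2 (fun x y => is_derive y 1 (ux x) (uxy x y)) a b ->
  near2 (fun x y => is_derive x 1 (uy^~ y) (uyx x y)) a b ->
  cont2 uxy a b -> cont2 uyx a b -> uxy a b = uyx a b.
Proof.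
move=> H1 H2 H3 H4 c1 c2; apply/eqP; rewrite -subr_eq0 -normr_le0.
apply/ler_addgt0Pl => e e0; rewrite addr0.
have e20 : 0 < e / 2 by rewrite divr_gt0.
have [d d0 H] := near2I (near2I (near2I H1 H2) (near2I H3 H4))
  (near2I (c1 _ e20) (c2 _ e20)).
have h0 : 0 < d / 2 by rewrite divr_gt0.
have hd (x : R) : x <= d / 2 -> x < d by lra.
have [|x [y [xa yb E]]] := @mixed_difference u ux uxy a b (d / 2) h0.
  by move=> x y /hd xa /hd yb; have [[[? ?] [? ?]] _] := H _ _ xa yb.
have [|y' [x' [yb' xa' E']]] := @mixed_difference (fun y x => u x y)
    (fun y x => uy x y) (fun y x => uyx x y) b a (d / 2) h0.
  by move=> y' x' /hd yb' /hd xa'; have [[[? ?] [? ?]] _] := H _ _ xa' yb'.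
have EE : uxy x y = uyx x' y'.
  have hn0 : d / 2 != 0 by rewrite gt_eqF.
  apply: (mulIf hn0); apply: (mulIf hn0).
  by rewrite -E -E'; ring.
have [_ [k1 _]] := H _ _ (hd _ xa) (hd _ yb).
have [_ [_ k2]] := H _ _ (hd _ xa') (hd _ yb').
rewrite -(subrK (uxy x y) (uxy a b)) -addrA {2}EE (le_trans (ler_normD _ _))//.
rewrite [e]splitr lerD// ltW// distrC//.
Qed.

Lemma antiderivative (A : set R) f a : open A -> is_interval A -> A a ->
  (forall x, A x -> {for x, continuous f}) ->
  exists2 F : R -> R, F a = 0 & forall x, A x -> is_derive x 1 F (f x).
Proof.
move=> oA iA Aa cf.
have lower (x : R) : A x -> exists2 c, A c & c < Num.min x a.
  move=> Ax; have Am : A (Num.min x a) by rewrite /Num.min; case: ifP.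
  have /nbhs_ballP[r /= r0 /(_ (Num.min x a - r / 2))] := open_nbhs_nbhs (conj oA Am).
  rewrite /ball /= opprB addrC subrK => H; exists (Num.min x a - r / 2).
    by apply: H; rewrite gtr0_norm ?divr_gt0//; lra.
  by rewrite ltrBlDr ltrDl divr_gt0.
have upper (x : R) : A x -> exists2 c, A c & x < c.
  move=> Ax; have /nbhs_ballP[r /= r0 /(_ (x + r / 2))] := open_nbhs_nbhs (conj oA Ax).
  rewrite /ball /= opprD addNKr normrN => H; exists (x + r / 2).
    by apply: H; rewrite gtr0_norm ?divr_gt0//; lra.
  by rewrite ltrDl divr_gt0.
pose I c (x : R) := \int[lebesgue_measure]_(t in `[c, x]) f t.
have dI c x : A c -> A x -> c < x -> is_derive x 1 (I c) (f x).
  move=> Ac Ax cx; have [u Au xu] := upper x Ax.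
  have [||d1 d2] := @continuous_FTC1_closed _ f c x u xu _ cx.
  - apply: continuous_compact_integrable; first exact: segment_compact.
    apply: continuous_in_subspaceT => y /set_mem /= yu; apply: cf.
    by apply: (iA c u) => //; move: yu; rewrite in_itv.
  - exact: cf.
  by split; [exact: d1|rewrite -derive1E; exact: d2].
pose G c x := I c x - I c a.
have dG c x : A c -> A x -> c < x -> is_derive x 1 (G c) (f x).
  move=> Ac Ax cx; rewrite -[f x]subr0; apply: is_deriveB.
  exact: dI.
have GG c c' x : A c -> A c' -> A x -> c < Num.min x a -> c' < Num.min x a -> G c x = G c' x.
  move=> Ac Ac' Ax; rewrite !lt_min => /andP[cx ca] /andP[cx' ca'].
  have [|y _] := @MVT_btw (fun x => G c x - G c' x) (fun x => f x - f x) a x.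
    move=> y /andP[y1 y2]; rewrite minC in y1.
    have Ay : A y.
      have [xa|/ltW ax] := leP x a.
        by apply: (iA x a) => //; rewrite (min_l xa) in y1; rewrite (max_l xa) in y2; rewrite y1.
      by apply: (iA a x) => //; rewrite (min_r ax) in y1; rewrite (max_r ax) in y2; rewrite y1.
    by apply: is_deriveB; apply: dG => //; apply: lt_le_trans y1; rewrite lt_min ?cx ?cx'.
  by rewrite subrr mul0r /G !subrr subr0 => /eqP; rewrite subr_eq0 => /eqP.
have [g gP] : {g : R -> R & forall x, A x -> A (g x) /\ g x < Num.min x a}.
  have [g gP] := @choice _ _ (fun x c => A x -> A c /\ c < Num.min x a) (fun x =>
    match pselect (A x) with
    | left Ax => let: ex_intro2 c c1 c2 := lower x Ax in ex_intro _ c (fun=> conj c1 c2)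
    | right nAx => ex_intro _ x (fun Ax => False_ind _ (nAx Ax)) end).
  by exists g.
exists (fun x => G (g x) x) => [|x Ax]; first by rewrite /G subrr.
have [c Ac cx] := lower x Ax; move: (cx); rewrite lt_min => /andP[cx1 cx2].
apply: near_eq_is_derive (dG c x Ac Ax cx1).
near=> y.
have Ay : A y by near: y; exact: open_nbhs_nbhs.
have cy : c < y by near: y; apply: open_nbhs_nbhs; split; [exact: open_gt|].
have [? ?] := gP y Ay; apply: GG => //; by rewrite lt_min cy.
Unshelve. all: by end_near. Qed.

Lemma tube u a (r : R) b y : 0 < r ->
  (forall t, btw b y t -> cont2 u a t) ->
  forall e, 0 < e -> exists2 d, 0 < d & forall x t, `|x - a| < d -> btw b y t -> `|u x t - u a t| < e.
Proof.
move=> r0 cu e e0.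
have K : compact `[Num.min b y, Num.max b y] by exact: segment_compact.
have H t : `[Num.min b y, Num.max b y]%classic t -> \forall t' \near t & d \near (0 : R),
    forall x, `|x - a| < `|d| -> `|u x t' - u a t'| < e.
  rewrite /= in_itv/= => tb.
  have [d d0 H] := cu t tb (e / 2) (divr_gt0 e0 (ltr0Sn _ _)).
  exists (ball t d, ball 0 d) => /=.
    by split; apply/nbhs_ballP; exists d.
  move=> [t' d'] /= [tt' dd'] x xa.
  rewrite /ball /= distrC in tt'; rewrite /ball /= sub0r normrN in dd'.
  have h1 := H x t' (lt_trans xa dd') tt'.
  have h2 := H a t'; rewrite subrr normr0 in h2.
  rewrite -(subrK (u a t) (u x t')) -addrA (le_lt_trans (ler_normD _ _))//.
  by rewrite [e]splitr ltrD// distrC h2.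
have Hn := (compact_near_coveringP _).1 K R (nbhs (0 : R))
  (fun d t => forall x, `|x - a| < `|d| -> `|u x t - u a t| < e) _ H.
have [d d0 Hd] := (near0P _).1 (Hn _).
exists (d / 2); first by rewrite divr_gt0.
move=> x t xa tb; apply: (Hd (d / 2)) => //.
- by rewrite gtr0_norm ?divr_gt0//; lra.
- by rewrite [X in _ < X]gtr0_norm ?divr_gt0.
Qed.

Lemma cont2_x u a b : cont2 u a b -> {for a, continuous (u^~ b)}.
Proof.
move=> cu; apply/cvgrPdist_lt => e e0; have [d d0 H] := cu e e0.
apply/nbhs_ballP; exists d => //= x; rewrite /ball /= distrC => xa.
by rewrite distrC H// subrr normr0.
Qed.

Lemma cont2_y u a b : cont2 u a b -> {for b, continuous (u a)}.
Proof.
move=> cu; apply/cvgrPdist_lt => e e0; have [d d0 H] := cu e e0.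
apply/nbhs_ballP; exists d => //= x; rewrite /ball /= distrC => xa.
by rewrite distrC H// subrr normr0.
Qed.

Lemma btw_interval (A : set R) a b c : is_interval A -> A a -> A b -> btw a b c -> A c.
Proof.
move=> iA Aa Ab; rewrite /btw minElt maxElt; case: ltP => _ H.
  exact: (iA a b).
exact: (iA b a).
Qed.

Lemma poincare (A B : set R) (P Q S : R -> R -> R) a b :
  open A -> is_interval A -> A a -> open B -> is_interval B -> B b ->
  (forall x y, A x -> B y -> [/\ cont2 P x y, cont2 Q x y & cont2 S x y]) ->
  (forall x y, A x -> B y ->
    is_derive y 1 (P x) (S x y) /\ is_derive x 1 (Q^~ y) (S x y)) ->
  exists W : R -> R -> R, forall x y, A x -> B y ->
    is_derive x 1 (W^~ y) (P x y) /\ is_derive y 1 (W x) (Q x y).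
Proof.
move=> oA iA Aa oB iB Bb cont der.
have [H _ dH] : exists2 H : R -> R, H a = 0 & forall x, A x -> is_derive x 1 H (P x b).
  by apply: antiderivative => // x Ax; apply: cont2_x; have [] := cont x b Ax Bb.
have [V VP] : {V : R -> R -> R & forall x, A x ->
    V x b = 0 /\ forall y, B y -> is_derive y 1 (V x) (Q x y)}.
  apply: (@choice _ _ (fun x V => A x -> V b = 0 /\ forall y, B y -> is_derive y 1 V (Q x y))) => x.
  have [Ax|nAx] := pselect (A x); last by exists (fun=> 0).
  have [|V V1 V2] := @antiderivative B (Q x) b oB iB Bb; last by exists V.
  by move=> y By; apply: cont2_y; have [] := cont x y Ax By.
exists (fun x y => H x + V x y) => x y Ax By; split; last first.
  by rewrite -[Q x y]add0r; apply: is_deriveD; apply: (VP x Ax).2.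
rewrite -[P x y](subrKC (P x b)); apply: is_deriveD; first exact: dH.
apply/is_deriveP => e e0.
have /nbhs_ballP[r /= r0 HA] := open_nbhs_nbhs (conj oA Ax).
pose e1 := e / (1 + `|y - b|).
have e10 : 0 < e1 by rewrite divr_gt0// ltr_wpDr.
have [d d0 Hd] : exists2 d, 0 < d & forall x' t, `|x' - x| < d -> btw b y t -> `|S x' t - S x t| < e1.
  by apply: (tube r0) => // t bt; have [] := cont x t Ax (btw_interval iB Bb By bt).
apply/near0P; exists (Num.min r d); first by rewrite lt_min r0.
move=> h; rewrite lt_min => /andP[hr hd].
have Axh x' : `|x' - x| <= `|x + h - x| -> A x'.
  rewrite (addrC x h) addrK => k; apply: HA; rewrite /ball /= distrC; exact: le_lt_trans hr.
have Ah : A (x + h) by apply: Axh.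
have [|t bt] := @MVT_btw (fun t => V (x + h) t - V x t - (P x t - P x b) * h)
    (fun t => Q (x + h) t - Q x t - S x t * h) b y.
  move=> t bt; have Bt := btw_interval iB Bb By bt.
  apply: is_deriveB.
    by apply: is_deriveB; [apply: (VP _ Ah).2|apply: (VP _ Ax).2].
  have dS : is_derive t 1 (fun t => P x t - P x b) (S x t).
    rewrite -[S x t]subr0; apply: is_deriveB; exact: (der x t Ax Bt).1.
  have := is_deriveM dS (is_derive_cst h t 1); rewrite scaler0 add0r.
  by rewrite /cst /GRing.scale /= [X in is_derive _ _ _ X]mulrC.
rewrite (VP _ Ah).1 (VP _ Ax).1 !subrr mul0r !subr0 => ->.
have Bt := btw_interval iB Bb By bt.
have [|x' xx'] := @MVT_between (Q^~ t) (S^~ t) x (x + h).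
  by move=> x' /Axh Ax'; have [] := der x' t Ax' Bt.
rewrite (addrC x h) addrK => ->.
rewrite (addrC x h) addrK in xx'.
have k := ltW (Hd x' t (le_lt_trans xx' hd) bt).
rewrite -mulrBl !normrM mulrAC ler_wpM2r//.
have : e1 * (1 + `|y - b|) = e by rewrite /e1 divfK// gt_eqF// ltr_wpDr.
move=> <-; rewrite ler_pM// lerDr//.
Qed.

End RealCalculus.

(** * Functions of class C^k and Wirtinger derivatives *)

Section ComplexCalculus.
Context {R : realType}.
Local Notation C := R[i].
Implicit Types (f g phi : C -> C) (z w v d : C) (U V : set C) (k : nat).

Lemma nbhsC_near2 z (P : C -> Prop) :
  (\forall w \near (z : C^o), P w) <->
  near2 (fun x y => P (x +i* y)) (complex.Re z) (complex.Im z).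
Proof.
split=> [/nbhs_ballP[e /= e0 H]|[d d0 H]].
  have [e' e'E] : exists e' : R, e = e'%:C.
    by exists (complex.Re e); rewrite RRe_real// realE ltW.
  move: e0 H; rewrite e'E ltcR => e0 H.
  exists (e' / 2); first by rewrite divr_gt0.
  move=> x y hx hy; apply: H; rewrite /ball /= normc_def ltcR.
  rewrite (@le_lt_trans _ _ (`|x - complex.Re z| + `|y - complex.Im z|))//; last first.
    by rewrite [e']splitr ltrD.
  case: z hx hy => a b /= _ _.
  have n0 : 0 <= `|x - a| + `|y - b| by rewrite addr_ge0.
  rewrite -[leRHS](ger0_norm n0) -sqrtr_sqr ler_sqrt ?sqr_ge0//.
  rewrite -(sqrrN (a - x)) -(sqrrN (b - y)) !opprB.
  move: (x - a) (y - b) => p q.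
  have hp : `|p| ^+ 2 = p ^+ 2 by rewrite real_normK ?num_real.
  have hq : `|q| ^+ 2 = q ^+ 2 by rewrite real_normK ?num_real.
  have := mulr_ge0 (normr_ge0 p) (normr_ge0 q); nra.
apply/nbhs_ballP; exists d%:C; first by rewrite /= ltcR.
move=> w; rewrite /ball /= => zw.
have wE : w = complex.Re w +i* complex.Im w by case: w zw.
rewrite wE; apply: H; rewrite distrC -ltcR; apply: le_lt_trans zw.
  have -> : complex.Re z - complex.Re w = complex.Re (z - w) by case: z w wE => [a b] [a' b'].
  exact: normc_ge_Re.
have -> : complex.Im z - complex.Im w = complex.Im (z - w) by case: z w wE => [a b] [a' b'].
rewrite -normrN -ReiNIm (le_trans (normc_ge_Re _))// normrM.
by rewrite (_ : `|'i| = 1) ?mulr1// normc_def /= expr0n expr1n add0r sqrtr1.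
Qed.

Lemma continuousC_cont2 f z :
  {for z, continuous (f : C^o -> C^o)} <->
  cont2 (fun x y => complex.Re (f (x +i* y))) (complex.Re z) (complex.Im z) /\
  cont2 (fun x y => complex.Im (f (x +i* y))) (complex.Re z) (complex.Im z).
Proof.
split=> [cf|[c1 c2]].
  have H e : 0 < e -> near2 (fun x y =>
      `|complex.Re (f (x +i* y)) - complex.Re (f z)| < e /\
      `|complex.Im (f (x +i* y)) - complex.Im (f z)| < e) (complex.Re z) (complex.Im z).
    move=> e0; apply/(nbhsC_near2 _ (fun w => `|complex.Re (f w) - complex.Re (f z)| < e /\
      `|complex.Im (f w) - complex.Im (f z)| < e)).
    apply: (cf [set w | `|complex.Re w - complex.Re (f z)| < e /\
      `|complex.Im w - complex.Im (f z)| < e]).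
    by apply/nbhsC_near2; exists e.
  have zE : z = complex.Re z +i* complex.Im z by case: (z).
  by split=> e e0; have [d d0 K] := H e e0; exists d => // x y hx hy;
    have [] := K x y hx hy; rewrite zE.
move=> P /nbhsC_near2[e e0 H].
apply/nbhsC_near2; have [d d0 K] := near2I (c1 e e0) (c2 e e0).
exists d => // x y hx hy; have [] := K x y hx hy.
have zE : z = complex.Re z +i* complex.Im z by case: (z).
rewrite -zE => h1 h2; have := H _ _ h1 h2.
by rewrite /preimage /=; case: (f _).
Qed.

Definition is_rd v f z d : Prop :=
  is_derive (0 : R) 1 (fun h : R => complex.Re (f (z + h%:C * v))) (complex.Re d) /\
  is_derive (0 : R) 1 (fun h : R => complex.Im (f (z + h%:C * v))) (complex.Im d).

Lemma is_rdP v f z d : is_rd v f z d -> rderivable v f z /\ rderive v f z = d.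
Proof.
move=> [[d1 e1] [d2 e2]]; split; first by split.
by rewrite /rderive !derive1E e1 e2; case: d e1 e2 {d1 d2}.
Qed.

Lemma rderivableP v f z : rderivable v f z -> is_rd v f z (rderive v f z).
Proof.
move=> [d1 d2]; split; split; rewrite /rderive /= ?derive1E//.
Qed.

Lemma is_rd_val v f z d : is_rd v f z d -> rderive v f z = d.
Proof. by move=> /is_rdP[]. Qed.

Lemma is_derive_shift (f : R -> R) (a d : R) :
  is_derive (0 : R) 1 (fun h => f (a + h)) d <-> is_derive a 1 f d.
Proof.
by split=> /is_deriveP H; apply/is_deriveP => e /H; apply: filterS => h;
  rewrite add0r addr0.
Qed.

Lemma is_rd1 f z d : is_rd 1 f z d <->
  is_derive (complex.Re z) 1 (fun x => complex.Re (f (x +i* complex.Im z))) (complex.Re d) /\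
  is_derive (complex.Re z) 1 (fun x => complex.Im (f (x +i* complex.Im z))) (complex.Im d).
Proof.
have E (h : R) : z + h%:C * 1 = (complex.Re z + h) +i* complex.Im z.
  by rewrite mulr1; case: z => a b; apply/eqP; rewrite eq_complex /= addr0 !eqxx.
have E1 : (fun h : R => complex.Re (f (z + h%:C * 1))) =
  (fun h : R => complex.Re (f ((complex.Re z + h) +i* complex.Im z))).
  by apply/funext => h; rewrite E.
have E2 : (fun h : R => complex.Im (f (z + h%:C * 1))) =
  (fun h : R => complex.Im (f ((complex.Re z + h) +i* complex.Im z))).
  by apply/funext => h; rewrite E.
rewrite /is_rd E1 E2; split=> -[d1 d2]; split.
- exact/(is_derive_shift (fun x => complex.Re (f (x +i* complex.Im z)))).
- exact/(is_derive_shift (fun x => complex.Im (f (x +i* complex.Im z)))).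
- exact/(is_derive_shift (fun x => complex.Re (f (x +i* complex.Im z)))).
- exact/(is_derive_shift (fun x => complex.Im (f (x +i* complex.Im z)))).
Qed.

Lemma is_rdi f z d : is_rd 'i f z d <->
  is_derive (complex.Im z) 1 (fun y => complex.Re (f (complex.Re z +i* y))) (complex.Re d) /\
  is_derive (complex.Im z) 1 (fun y => complex.Im (f (complex.Re z +i* y))) (complex.Im d).
Proof.
have E (h : R) : z + h%:C * 'i = complex.Re z +i* (complex.Im z + h).
  by case: z => a b; apply/eqP; rewrite eq_complex /=; apply/andP; split; apply/eqP; ring.
have E1 : (fun h : R => complex.Re (f (z + h%:C * 'i))) =
  (fun h : R => complex.Re (f (complex.Re z +i* (complex.Im z + h)))).
  by apply/funext => h; rewrite E.
have E2 : (fun h : R => complex.Im (f (z + h%:C * 'i))) =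
  (fun h : R => complex.Im (f (complex.Re z +i* (complex.Im z + h)))).
  by apply/funext => h; rewrite E.
rewrite /is_rd E1 E2; split=> -[d1 d2]; split.
- exact/(is_derive_shift (fun y => complex.Re (f (complex.Re z +i* y)))).
- exact/(is_derive_shift (fun y => complex.Im (f (complex.Re z +i* y)))).
- exact/(is_derive_shift (fun y => complex.Re (f (complex.Re z +i* y)))).
- exact/(is_derive_shift (fun y => complex.Im (f (complex.Re z +i* y)))).
Qed.

Lemma near_line (P : C -> Prop) z v : (\forall w \near (z : C^o), P w) ->
  \forall h \near (0 : R), P (z + h%:C * v).
Proof.
move=> /nbhsC_near2[d d0 H]; apply/near0P.
pose m := 1 + `|complex.Re v| + `|complex.Im v|.
have m0 : 0 < m by rewrite /m -addrA ltr_wpDr// addr_ge0.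
exists (d / m); first by rewrite divr_gt0.
move=> h; rewrite ltr_pdivlMr// => hd.
have -> : z + h%:C * v = (complex.Re z + h * complex.Re v) +i* (complex.Im z + h * complex.Im v).
  by case: z v {m m0 hd H} => a b [a' b']; apply/eqP; rewrite eq_complex /= !mul0r subr0 addr0 !eqxx.
by apply: H; rewrite addrC addKr normrM; apply: le_lt_trans hd; apply: ler_wpM2l => //;
   rewrite /m; have := normr_ge0 (complex.Re v); have := normr_ge0 (complex.Im v); lra.
Qed.

Lemma is_rd_near v f g z d : (\forall w \near (z : C^o), f w = g w) ->
  is_rd v f z d -> is_rd v g z d.
Proof.
move=> /(near_line v) fg [d1 d2].
by split; [apply: near_eq_is_derive d1|apply: near_eq_is_derive d2];
  apply: filterS fg => h /= ->.
Qed.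

Lemma is_rd_cst v c z : is_rd v (fun=> c) z 0.
Proof. by split; exact: is_derive_cst. Qed.

Lemma is_rdD v f g z df dg : is_rd v f z df -> is_rd v g z dg ->
  is_rd v (fun w => f w + g w) z (df + dg).
Proof.
have ReD (x y : C) : complex.Re (x + y) = complex.Re x + complex.Re y by case: x y => ? ? [].
have ImD (x y : C) : complex.Im (x + y) = complex.Im x + complex.Im y by case: x y => ? ? [].
move=> [f1 f2] [g1 g2]; split; rewrite (ReD, ImD).
  by under eq_fun do rewrite ReD; exact: is_deriveD.
by under eq_fun do rewrite ImD; exact: is_deriveD.
Qed.

Lemma is_rdM v f g z df dg : is_rd v f z df -> is_rd v g z dg ->
  is_rd v (fun w => f w * g w) z (df * g z + f z * dg).
Proof.
have ReM (x y : C) : complex.Re (x * y) = complex.Re x * complex.Re y - complex.Im x * complex.Im y by case: x y => ? ? [].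
have ImM (x y : C) : complex.Im (x * y) = complex.Re x * complex.Im y + complex.Im x * complex.Re y by case: x y => ? ? [].
move=> [f1 f2] [g1 g2]; split.
  under eq_fun do rewrite ReM.
  apply: is_derive_eq (is_deriveB (is_deriveM f1 g1) (is_deriveM f2 g2)) _.
  rewrite !mul0r !addr0 /GRing.scale /=.
  by case: (f z) (g z) df dg {f1 f2 g1 g2} => [a b] [a' b'] [c d] [c' d'] /=; ring.
under eq_fun do rewrite ImM.
apply: is_derive_eq (is_deriveD (is_deriveM f1 g2) (is_deriveM f2 g1)) _.
rewrite !mul0r !addr0 /GRing.scale /=.
by case: (f z) (g z) df dg {f1 f2 g1 g2} => [a b] [a' b'] [c d] [c' d'] /=; ring.
Qed.

Lemma is_rd_conj v f z d : is_rd v f z d -> is_rd v (fun w => (f w)^*) z d^*.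
Proof.
have ReJ (x : C) : complex.Re x^* = complex.Re x by case: x.
have ImJ (x : C) : complex.Im x^* = - complex.Im x by case: x.
move=> [f1 f2]; split; rewrite ?ReJ ?ImJ.
  by under eq_fun do rewrite ReJ.
by under eq_fun do rewrite ImJ; exact: is_deriveN.
Qed.

Lemma is_rd_id v z : is_rd v id z v.
Proof.
split; apply/is_deriveP => e e0; apply/near0P; exists 1 => // h _.
  case: z v => [a b] [a' b'] /=; rewrite add0r !mul0r !subr0 !addr0.
  by rewrite (_ : _ - _ - _ = 0) ?normr0 ?mulr_ge0// ?ltW//; ring.
case: z v => [a b] [a' b'] /=; rewrite add0r !mul0r !addr0.
by rewrite (_ : _ - _ - _ = 0) ?normr0 ?mulr_ge0// ?ltW//; ring.
Qed.

Lemma is_rd_comp v f phi z d :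
  (\forall w \near (phi z : C^o), rderivable 1 f w) -> rderivable 'i f (phi z) ->
  {for phi z, continuous (rderive 1 f : C^o -> C^o)} ->
  is_rd v phi z d ->
  is_rd v (f \o phi) z
    ((complex.Re d)%:C * rderive 1 f (phi z) + (complex.Im d)%:C * rderive 'i f (phi z)).
Proof.
move=> /nbhsC_near2[r r0 d1] /rderivableP/is_rdi[di1 di2] /continuousC_cont2[c1 c2] [p1 p2].
have z0 : z + 0%:C * v = z by rewrite mul0r addr0.
have E (x : C) : (complex.Re x +i* complex.Im x) = x by case: x.
split.
  have := @is_derive_comp2 R (fun x y => complex.Re (f (x +i* y)))
    (fun x y => complex.Re (rderive 1 f (x +i* y))) (complex.Re (rderive 'i f (phi z))) _ _ _ _ _ _ _ p1 p2.
  rewrite !z0 !E /= => H.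
  have {}H := H _ c1 di1.
  under eq_fun do rewrite /comp -[phi _]E.
  case: (rderive 1 f (phi z)) (rderive 'i f (phi z)) H => [a b] [a' b'] /=.
  rewrite !mul0r !subr0; apply.
  by exists r => // x y hx hy; have /rderivableP/is_rd1[] := d1 x y hx hy.
have := @is_derive_comp2 R (fun x y => complex.Im (f (x +i* y)))
  (fun x y => complex.Im (rderive 1 f (x +i* y))) (complex.Im (rderive 'i f (phi z))) _ _ _ _ _ _ _ p1 p2.
rewrite !z0 !E /= => H.
have {}H := H _ c2 di2.
under eq_fun do rewrite /comp -[phi _]E.
case: (rderive 1 f (phi z)) (rderive 'i f (phi z)) H => [a b] [a' b'] /=.
rewrite !mul0r !addr0; apply.
by exists r => // x y hx hy; have /rderivableP/is_rd1[] := d1 x y hx hy.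
Qed.


Lemma Ck0 k U f : Ck k U f -> forall z, U z -> {for z, continuous (f : C^o -> C^o)}.
Proof. by case: k => [|k] []. Qed.

Lemma Ck_le k U f : Ck k.+1 U f -> Ck k U f.
Proof.
elim: k f => [|k IH] f; first by move=> [].
move=> [cf [d1 d2 c1 c2]]; split; first exact: cf.
by split; [exact: d1|exact: d2|exact: (IH _ c1)|exact: (IH _ c2)].
Qed.

Lemma CkS k U f : Ck k.+1 U f <->
  (forall z, U z -> {for z, continuous (f : C^o -> C^o)}) /\
  forall v, v = 1 \/ v = 'i -> (forall z, U z -> rderivable v f z) /\ Ck k U (rderive v f).
Proof.
split=> [[cf [d1 di c1 ci]]|[cf H]].
  by split; [exact: cf|move=> v [->|->]; split].
have [h1 h2] := H 1 (or_introl erefl); have [h3 h4] := H 'i (or_intror erefl).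
by split; [exact: cf|split].
Qed.

Lemma rderive_near v f g z : (\forall w \near (z : C^o), f w = g w) ->
  rderive v f z = rderive v g z.
Proof.
move=> /(near_line v) fg; rewrite /rderive !derive1E; congr (_ +i* _);
  apply: near_eq_derive; by apply: filterS fg => h /= ->.
Qed.

Lemma open_near U z (P : C -> Prop) : open (U : set C^o) -> U z ->
  (forall w, U w -> P w) -> \forall w \near (z : C^o), P w.
Proof. by move=> oU Uz H; apply: filterS H _; exact: open_nbhs_nbhs. Qed.

Lemma continuousC_near f g z : (\forall w \near (z : C^o), f w = g w) ->
  {for z, continuous (f : C^o -> C^o)} -> {for z, continuous (g : C^o -> C^o)}.
Proof.
move=> fg cf P; rewrite -(nbhs_singleton fg) => /cf H.
by apply: filterS2 fg H => w; rewrite /preimage /= => ->.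
Qed.

Lemma Ck_ext k U f g : open (U : set C^o) -> (forall z, U z -> f z = g z) ->
  Ck k U f -> Ck k U g.
Proof.
move=> oU; elim: k f g => [|k IH] f g fg.
  move=> [cf _]; split=> [z Uz|]; last by [].
  exact: (continuousC_near (open_near oU Uz fg) (cf z Uz)).
move=> /CkS[cf H]; apply/CkS; split=> [z Uz|v hv].
  exact: (continuousC_near (open_near oU Uz fg) (cf z Uz)).
have [d1 c1] := H v hv; split=> [z Uz|].
  by have [] := is_rdP (is_rd_near (open_near oU Uz fg) (rderivableP (d1 z Uz))).
by apply: IH c1 => z Uz; apply: rderive_near; apply: open_near oU Uz fg.
Qed.

Lemma Ck_sub k U V f : V `<=` U -> Ck k U f -> Ck k V f.
Proof.
move=> VU; elim: k f => [|k IH] f; first by move=> [cf _]; split=> [z /VU|//]; exact: cf.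
move=> /CkS[cf H]; apply/CkS; split=> [z /VU|v /H[d1 c1]]; first exact: cf.
by split=> [z /VU /d1//|]; exact: IH.
Qed.

Lemma Ck_is_rd k U f : Ck k.+1 U f -> forall v, v = 1 \/ v = 'i ->
  forall z, U z -> is_rd v f z (rderive v f z).
Proof. by move=> /CkS[_ H] v /H[H1 _] z /H1 /rderivableP. Qed.

Lemma Ck_is_rdW k U f (df : C -> C -> C) : open (U : set C^o) ->
  (forall z, U z -> {for z, continuous (f : C^o -> C^o)}) ->
  (forall v, v = 1 \/ v = 'i -> (forall z, U z -> is_rd v f z (df v z)) /\ Ck k U (df v)) ->
  Ck k.+1 U f.
Proof.
move=> oU cf H; apply/CkS; split=> // v /H[H1 H2]; split=> [z Uz|].
  by have [] := is_rdP (H1 z Uz).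
by apply: Ck_ext H2 => // z Uz; rewrite (is_rd_val (H1 z Uz)).
Qed.

Lemma Ck_cst k U (c : C) : open (U : set C^o) -> Ck k U (fun=> c).
Proof.
move=> oU; elim: k c => [|k IH] c; first by split=> [z _|//]; exact: cst_continuous.
apply: (Ck_is_rdW (df := fun _ _ => 0)) => // [z _|v _]; first exact: cst_continuous.
by split=> // z _; exact: is_rd_cst.
Qed.

Lemma Ck_id k U : open (U : set C^o) -> Ck k U id.
Proof.
move=> oU; case: k => [|k]; first by split=> [z _|//]; exact: cvg_id.
apply: (Ck_is_rdW (df := fun v _ => v)) => // [z _|v _]; first exact: cvg_id.
split=> [z _|]; [exact: is_rd_id|exact: Ck_cst].
Qed.

Lemma CkD k U f g : open (U : set C^o) -> Ck k U f -> Ck k U g -> Ck k U (fun z => f z + g z).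
Proof.
move=> oU; elim: k f g => [|k IH] f g cf cg.
  by split=> [z Uz|//]; apply: continuousD; [exact: Ck0 cf _ Uz|exact: Ck0 cg _ Uz].
apply: (Ck_is_rdW (df := fun v z => rderive v f z + rderive v g z)) => // [z Uz|v hv].
  by apply: continuousD; [exact: Ck0 cf _ Uz|exact: Ck0 cg _ Uz].
split=> [z Uz|]; first by apply: is_rdD; [exact: Ck_is_rd cf _ hv _ Uz|exact: Ck_is_rd cg _ hv _ Uz].
by move: cf cg => /CkS[_ /(_ v hv)[_ c1]] /CkS[_ /(_ v hv)[_ c2]]; exact: IH.
Qed.

Lemma CkM k U f g : open (U : set C^o) -> Ck k U f -> Ck k U g -> Ck k U (fun z => f z * g z).
Proof.
move=> oU; elim: k f g => [|k IH] f g cf cg.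
  by split=> [z Uz|//]; apply: continuousM; [exact: Ck0 cf _ Uz|exact: Ck0 cg _ Uz].
apply: (Ck_is_rdW (df := fun v z => rderive v f z * g z + f z * rderive v g z)) => // [z Uz|v hv].
  by apply: continuousM; [exact: Ck0 cf _ Uz|exact: Ck0 cg _ Uz].
split=> [z Uz|]; first by apply: is_rdM; [exact: Ck_is_rd cf _ hv _ Uz|exact: Ck_is_rd cg _ hv _ Uz].
have cf' := Ck_le cf; have cg' := Ck_le cg.
move: cf cg => /CkS[_ /(_ v hv)[_ c1]] /CkS[_ /(_ v hv)[_ c2]].
by apply: CkD => //; exact: IH.
Qed.

Lemma continuous_conjc z : {for z, continuous (conjc : C^o -> C^o)}.
Proof.
apply/continuousC_cont2; split=> e e0; exists e => //= x y hx hy.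
by rewrite -opprD normrN.
Qed.

Lemma Ck_conj k U f : open (U : set C^o) -> Ck k U f -> Ck k U (fun z => (f z)^*).
Proof.
move=> oU; elim: k f => [|k IH] f cf.
  by split=> [z Uz|//]; apply: (@continuous_comp C^o C^o C^o f conjc); [exact: Ck0 cf _ Uz|exact: continuous_conjc].
apply: (Ck_is_rdW (df := fun v z => (rderive v f z)^*)) => // [z Uz|v hv].
  by apply: (@continuous_comp C^o C^o C^o f conjc); [exact: Ck0 cf _ Uz|exact: continuous_conjc].
split=> [z Uz|]; first by apply: is_rd_conj; exact: Ck_is_rd cf _ hv _ Uz.
by move: cf => /CkS[_ /(_ v hv)[_ c1]]; exact: IH.
Qed.

Lemma Ck_Re k U f : open (U : set C^o) -> Ck k U f -> Ck k U (fun z => (complex.Re (f z))%:C).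
Proof.
move=> oU cf; apply: (@Ck_ext _ _ (fun z => (f z + (f z)^*) * 2^-1)) => //.
  by move=> z _; rewrite ReJ_add.
apply: CkM => //; last exact: Ck_cst.
by apply: CkD => //; exact: Ck_conj.
Qed.

Lemma Ck_Im k U f : open (U : set C^o) -> Ck k U f -> Ck k U (fun z => (complex.Im (f z))%:C).
Proof.
move=> oU cf; apply: (@Ck_ext _ _ (fun z => ((f z)^* + (-1) * f z) * (2^-1 * 'i))) => //.
  by move=> z _; rewrite ImJ_sub mulN1r mulrA.
apply: CkM => //; last exact: Ck_cst.
by apply: CkD => //; [exact: Ck_conj|apply: CkM => //; exact: Ck_cst].
Qed.

Lemma is_rd_comp_Ck k V f phi v z d : open (V : set C^o) -> Ck k.+1 V f -> V (phi z) ->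
  is_rd v phi z d ->
  is_rd v (f \o phi) z
    ((complex.Re d)%:C * rderive 1 f (phi z) + (complex.Im d)%:C * rderive 'i f (phi z)).
Proof.
move=> oV [_ [d1 di c1 _]] Vz; apply: is_rd_comp.
- exact: open_near oV Vz d1.
- exact: di.
- exact: Ck0 c1 _ Vz.
Qed.

Lemma Ck_comp k U V f phi : open (U : set C^o) -> open (V : set C^o) ->
  (forall z, U z -> V (phi z)) -> Ck k V f -> Ck k U phi -> Ck k U (f \o phi).
Proof.
move=> oU oV UV; elim: k f => [|k IH] f cf cphi.
  by split=> [z Uz|//]; apply: (@continuous_comp C^o C^o C^o phi f); [exact: Ck0 cphi _ Uz|apply: Ck0 cf _ (UV z Uz)].
apply: (Ck_is_rdW (df := fun v z => (complex.Re (rderive v phi z))%:C * (rderive 1 f \o phi) z +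
    (complex.Im (rderive v phi z))%:C * (rderive 'i f \o phi) z)) => // [z Uz|v hv].
  by apply: (@continuous_comp C^o C^o C^o phi f); [exact: Ck0 cphi _ Uz|apply: Ck0 cf _ (UV z Uz)].
split=> [z Uz|].
  by apply: is_rd_comp_Ck cf (UV z Uz) _ => //; exact: Ck_is_rd cphi _ hv _ Uz.
have cphi' := Ck_le cphi.
move: cf cphi => [_ [_ _ c1 ci]] /CkS[_ /(_ v hv)[_ cp]].
by apply: CkD => //; apply: CkM => //; [exact: Ck_Re|exact: IH|exact: Ck_Im|exact: IH].
Qed.

End ComplexCalculus.

Section Wirtinger.
Context {R : realType}.
Local Notation C := R[i].
Implicit Types (f g phi : C -> C) (z w v d a b : C) (U V : set C) (k : nat).

Local Notation ii := (Complex 0 1 : C).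

Lemma imaginaryE : Num.imaginary = ii. Proof. by []. Qed.

(** [a] and [b] are the Wirtinger derivatives of [f] at [z]. *)
Definition isW f z a b := forall v, v = 1 \/ v = ii -> is_rd v f z (v * a + conjc v * b).

Lemma conj_i : conjc ii = - ii.
Proof. by apply/eqP; rewrite eq_complex /= oppr0 !eqxx. Qed.

Lemma conj_one : conjc (1 : C) = 1.
Proof. exact: conjc1. Qed.

Lemma sqr_iC : ii * ii = -1.
Proof. by rewrite -expr2 sqr_i. Qed.

Lemma isW_val f z a b : isW f z a b -> dz f z = a /\ dzbar f z = b.
Proof.
move=> H; have /is_rd_val := H 1 (or_introl erefl); have /is_rd_val := H ii (or_intror erefl).
rewrite /dz /dzbar !imaginaryE conj_i conj_one => -> ->.
have two : (2%:R : C) != 0 by rewrite pnatr_eq0.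
split; apply/(mulIf two); rewrite divfK//.
  transitivity (a + b - (ii * ii) * a + (ii * ii) * b); first by ring.
  by rewrite sqr_iC; ring.
transitivity (a + b + (ii * ii) * a - (ii * ii) * b); first by ring.
by rewrite sqr_iC; ring.
Qed.

Lemma rderivable_isW f z : rderivable 1 f z -> rderivable ii f z ->
  isW f z (dz f z) (dzbar f z).
Proof.
move=> d1 di v hv; have two : (2%:R : C) != 0 by rewrite pnatr_eq0.
rewrite /dz /dzbar !imaginaryE; case: hv => ->.
  rewrite conj_one [X in is_rd _ _ _ X](_ : _ = rderive 1 f z); first exact: rderivableP.
  by field.
rewrite conj_i [X in is_rd _ _ _ X](_ : _ = rderive ii f z); first exact: rderivableP.
transitivity (- (ii * ii) * rderive ii f z); first by field.
by rewrite sqr_iC opprK mul1r.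
Qed.

Lemma Ck_isW k U f z : Ck k.+1 U f -> U z -> isW f z (dz f z) (dzbar f z).
Proof. by move=> [_ [d1 di _ _]] Uz; apply: rderivable_isW; [exact: d1|exact: di]. Qed.

Lemma isW_eq f z a b a' b' : isW f z a b -> a = a' -> b = b' -> isW f z a' b'.
Proof. by move=> H <- <-. Qed.

Lemma isW_near f g z a b : (\forall w \near (z : C^o), f w = g w) ->
  isW f z a b -> isW g z a b.
Proof. by move=> fg H v /H; exact: is_rd_near. Qed.

Lemma isW_cst c z : isW (fun=> c) z 0 0.
Proof. by move=> v _; rewrite !mulr0 addr0; exact: is_rd_cst. Qed.

Lemma isW_id z : isW id z 1 0.
Proof. by move=> v _; rewrite mulr0 addr0 mulr1; exact: is_rd_id. Qed.

Lemma isW_D f g z a b a' b' : isW f z a b -> isW g z a' b' ->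
  isW (fun w => f w + g w) z (a + a') (b + b').
Proof.
move=> Hf Hg v hv; have := is_rdD (Hf v hv) (Hg v hv).
by congr is_rd; ring.
Qed.

Lemma isW_M f g z a b a' b' : isW f z a b -> isW g z a' b' ->
  isW (fun w => f w * g w) z (a * g z + f z * a') (b * g z + f z * b').
Proof.
move=> Hf Hg v hv; have := is_rdM (Hf v hv) (Hg v hv).
by congr is_rd; ring.
Qed.

Lemma isW_conj f z a b : isW f z a b -> isW (fun w => conjc (f w)) z (conjc b) (conjc a).
Proof.
move=> Hf v hv; have := is_rd_conj (Hf v hv).
by rewrite rmorphD !rmorphM/= conjcK addrC.
Qed.

Lemma conjcE z : conjc z = (complex.Re z)%:C - ii * (complex.Im z)%:C.
Proof.
by case: z => p q; apply/eqP; rewrite eq_complex /=; apply/andP; split; apply/eqP; ring.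
Qed.

Lemma isW_comp k V f phi z a b : open (V : set C^o) -> Ck k.+1 V f -> V (phi z) ->
  isW phi z a b ->
  isW (f \o phi) z (a * dz f (phi z) + conjc b * dzbar f (phi z))
                   (b * dz f (phi z) + conjc a * dzbar f (phi z)).
Proof.
move=> oV cf Vz Hp v hv; have := is_rd_comp_Ck oV cf Vz (Hp v hv).
have Hf := Ck_isW cf Vz.
rewrite (is_rd_val (Hf 1 (or_introl erefl))) (is_rd_val (Hf ii (or_intror erefl))).
congr is_rd; rewrite conj_one conj_i.
set d := v * a + conjc v * b; set A := dz _ _; set B := dzbar _ _.
transitivity (d * A + conjc d * B).
  have dE : d = (complex.Re d)%:C + ii * (complex.Im d)%:C by exact: complexE.
  have dE' : conjc d = (complex.Re d)%:C - ii * (complex.Im d)%:C.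
    exact: conjcE.
  by rewrite dE' [X in _ = X * A + _]dE; ring.
by rewrite /d rmorphD !rmorphM /= conjcK; ring.
Qed.

Lemma continuous_inv z : z != 0 -> {for z, continuous ((fun w => w^-1) : C^o -> C^o)}.
Proof. by move=> z0; apply: (@inv_continuous C). Qed.

Lemma open_neq0 : open ([set z | z != 0] : set C^o).
Proof.
rewrite openE => z /= z0; rewrite /interior.
have n0 : 0 < `|z| by rewrite normr_gt0.
apply/nbhs_ballP; exists `|z| => // w; rewrite /ball /= => zw; apply/eqP => w0.
by move: zw; rewrite w0 subr0 ltxx.
Qed.

Lemma is_rd_inv v z : z != 0 -> is_rd v (fun w => w^-1) z (- v * z^-1 * z^-1).
Proof.
move=> z0.
have inv_near : \forall w \near (z : C^o), w != 0.
  by apply: (open_near (U := [set w | w != 0])); [exact: open_neq0|exact: z0|].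
have HR : is_derive (0 : R) 1 (fun h : R => complex.Re (z + h%:C * v)) (complex.Re v).
  by have [] := is_rd_id v z.
have HI : is_derive (0 : R) 1 (fun h : R => complex.Im (z + h%:C * v)) (complex.Im v).
  by have [] := is_rd_id v z.
have z0' : z + 0%:C * v = z by rewrite mul0r addr0.
pose N := fun h : R => complex.Re (z + h%:C * v) * complex.Re (z + h%:C * v) +
  complex.Im (z + h%:C * v) * complex.Im (z + h%:C * v).
have NE w : complex.Re w * complex.Re w + complex.Im w * complex.Im w =
    complex.Re w ^+ 2 + complex.Im w ^+ 2 by [].
have N0 : N 0 != 0.
  rewrite /N z0' NE -(inj_eq (@complexI R)) add_Re2_Im2 expf_eq0 /= normr_eq0//.
have dN := is_deriveD (is_deriveM HR HR) (is_deriveM HI HI).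
have dNV := @is_deriveV R N 0 _ 1 N0 dN.
have ReV w : complex.Re (w^-1) = complex.Re w * (complex.Re w * complex.Re w + complex.Im w * complex.Im w)^-1 by case: w.
have ImV w : complex.Im (w^-1) = - complex.Im w * (complex.Re w * complex.Re w + complex.Im w * complex.Im w)^-1 by case: w => a b; rewrite /= mulNr.
split.
  under eq_fun do rewrite ReV.
  apply: is_derive_eq (is_deriveM HR dNV) _.
  move: N0; rewrite /N !z0' /GRing.scale /=.
  case: z v {z0 inv_near HR HI z0' N dN dNV NE ReV ImV} => a b [c d] /=.
  by move=> N0; field. 
under eq_fun do rewrite ImV.
apply: is_derive_eq (is_deriveM (is_deriveN HI) dNV) _.
move: N0; rewrite /N !z0' /GRing.scale /=.
case: z v {z0 inv_near HR HI z0' N dN dNV NE ReV ImV} => a b [c d] /=.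
have -> : (- (fun h : R => b + (h * d + 0 * c))) 0 = - b.
  by rewrite opprfctE /= !mul0r !addr0.
by move=> N0; field. 
Qed.

Lemma Ck_inv k : Ck k [set z | z != 0] (fun w => w^-1).
Proof.
elim: k => [|k IH]; first by split=> [z z0|//]; exact: continuous_inv.
apply: (Ck_is_rdW (df := fun v z => - v * z^-1 * z^-1)) => [|z z0|v _].
- exact: open_neq0.
- exact: continuous_inv.
split=> [z z0|]; first exact: is_rd_inv.
apply: CkM; [exact: open_neq0| |exact: IH].
by apply: CkM; [exact: open_neq0|apply: Ck_cst; exact: open_neq0|exact: IH].
Qed.

Definition re_lift (g : R -> R) z : C := (g (complex.Re z))%:C.

Lemma continuous_lift (g : R -> R) z : {for complex.Re z, continuous g} ->
  {for z, continuous (re_lift g : C^o -> C^o)}.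
Proof.
move=> /cvgrPdist_lt cg; apply/continuousC_cont2; split=> e e0; last first.
  by exists 1 => // x y _ _; rewrite /= subrr normr0.
have /nbhs_ballP[d /= d0 H] := cg e e0; exists d => // x y hx _.
by rewrite /= distrC; apply: H; rewrite /ball /= distrC.
Qed.

Lemma is_rd_lift (g : R -> R) dg v z : is_derive (complex.Re z) 1 g dg ->
  is_rd v (re_lift g) z (complex.Re v * dg)%:C.
Proof.
move=> Hg; split; rewrite /re_lift /=; last exact: is_derive_cst.
have [HR _] := is_rd_id v z.
have -> : (fun h : R => g (complex.Re (z + h%:C * v))) = g \o (fun h : R => complex.Re (z + h%:C * v)) by [].
rewrite mulrC; apply: is_derive1_comp => //.
by rewrite mul0r addr0.
Qed.

Lemma Ck_lift_step k U (g dg : R -> R) : open (U : set C^o) ->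
  (forall z, U z -> is_derive (complex.Re z) 1 g (dg (complex.Re z))) ->
  Ck k U (re_lift dg) -> Ck k.+1 U (re_lift g).
Proof.
move=> oU Hg cg.
apply: (Ck_is_rdW (df := fun v z => (complex.Re v)%:C * re_lift dg z)) => [//|z Uz|v _].
  apply: continuous_lift; apply/differentiable_continuous/derivable1_diffP.
  by have [] := Hg z Uz.
split=> [z Uz|]; last by apply: CkM => //; exact: Ck_cst.
by rewrite /re_lift -rmorphM; apply: is_rd_lift; exact: Hg.
Qed.

Lemma Ck_lift0 U (g dg : R -> R) :
  (forall z, U z -> is_derive (complex.Re z) 1 g (dg (complex.Re z))) ->
  Ck 0 U (re_lift g).
Proof.
move=> Hg; split=> [z Uz|//]; apply: continuous_lift.
by apply/differentiable_continuous/derivable1_diffP; have [] := Hg z Uz.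
Qed.

Lemma Ck_lift_expR k : Ck k setT (re_lift expR).
Proof.
elim: k => [|k IH]; first by apply: (@Ck_lift0 _ _ expR) => z _; exact: is_derive_expR.
by apply: Ck_lift_step IH; exact: openT.
Qed.

Lemma Ck_lift_trig k : Ck k setT (re_lift cos) /\ Ck k setT (re_lift sin).
Proof.
elim: k => [|k [IHc IHs]].
  by split; [apply: (@Ck_lift0 _ _ (fun x => - sin x)) => z _; exact: is_derive_cos|
    apply: (@Ck_lift0 _ _ cos) => z _; exact: is_derive_sin].
split; last by apply: Ck_lift_step IHc; exact: openT.
apply: (@Ck_lift_step _ _ _ (fun x => - sin x)); first exact: openT.
apply: (@Ck_ext _ _ _ (fun z => (-1) * re_lift sin z)); [exact: openT| |].
  by move=> z _; rewrite /re_lift rmorphN mulN1r.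
by apply: CkM => //; [exact: openT|apply: Ck_cst; exact: openT].
Qed.

Lemma open_Re_gt0 : open ([set z | 0 < complex.Re z] : set C^o).
Proof.
rewrite openE => z z0; rewrite /interior; apply/nbhsC_near2; exists (complex.Re z) => //.
by move=> x y hx _ /=; move: hx; rewrite ltr_distl subrr => /andP[].
Qed.

Lemma Ck_lift_ln k : Ck k [set z | 0 < complex.Re z] (re_lift (@ln R)).
Proof.
case: k => [|k]; first by apply: (@Ck_lift0 _ _ (fun x => x^-1)) => z z0; exact: is_derive1_ln.
have Hd z : 0 < complex.Re z -> is_derive (complex.Re z) 1 (@ln R) (complex.Re z)^-1.
  exact: is_derive1_ln.
apply: (@Ck_lift_step _ _ _ (fun x => x^-1) _ Hd); first exact: open_Re_gt0.
apply: (@Ck_ext _ _ _ ((fun w => w^-1) \o (fun w => (complex.Re w)%:C))); [exact: open_Re_gt0| |].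
  by move=> z z0; rewrite /re_lift /= fmorphV.
apply: (@Ck_comp _ _ _ [set z | z != 0]); [exact: open_Re_gt0|exact: open_neq0| | |].
- by move=> z /= z0; rewrite -(rmorph0 (real_complex R)) (inj_eq (@complexI R)) gt_eqF.
- exact: Ck_inv.
- by apply: Ck_Re; [exact: open_Re_gt0|apply: Ck_id; exact: open_Re_gt0].
Qed.

Lemma Ck_cexp k U : open (U : set C^o) -> Ck k U (@cexp R).
Proof.
move=> oU; apply: (@Ck_sub _ _ setT) => //.
apply: (@Ck_ext _ _ _ (fun z => re_lift expR z * ((re_lift cos \o (fun z => (complex.Im z)%:C)) z +
   ii * (re_lift sin \o (fun z => (complex.Im z)%:C)) z))); first exact: openT.
  move=> z _; rewrite /re_lift /cexp /=; congr (_ * _).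
  by apply/eqP; rewrite eq_complex /=; apply/andP; split; apply/eqP; ring.
have [cc cs] := Ck_lift_trig k.
have cI : Ck k setT (fun z : C => (complex.Im z)%:C).
  by apply: Ck_Im; [exact: openT|apply: Ck_id; exact: openT].
apply: CkM; [exact: openT|exact: Ck_lift_expR|].
apply: CkD; [exact: openT|by apply: Ck_comp cc cI; [exact: openT|exact: openT|]|].
apply: CkM; [exact: openT|by apply: Ck_cst; exact: openT|].
by apply: Ck_comp cs cI; [exact: openT|exact: openT|].
Qed.

Lemma isW_inv z : z != 0 -> isW (fun w => w^-1) z (- z^-1 * z^-1) 0.
Proof.
move=> z0 v _; have := is_rd_inv v z0; congr is_rd; ring.
Qed.

Lemma isW_cexp z : isW (@cexp R) z (cexp z) 0.
Proof.
move=> v _; rewrite mulr0 addr0.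
have [HR HI] := is_rd_id v z.
have z0' : z + 0%:C * v = z by rewrite mul0r addr0.
have e1 : is_derive (0 : R) 1 (expR \o (fun h : R => complex.Re (z + h%:C * v)))
    (expR (complex.Re z) * complex.Re v).
  by apply: is_derive1_comp; rewrite z0'; exact: is_derive_expR.
have e2 : is_derive (0 : R) 1 (cos \o (fun h : R => complex.Im (z + h%:C * v)))
    (- sin (complex.Im z) * complex.Im v).
  by apply: is_derive1_comp; rewrite z0'; exact: is_derive_cos.
have e3 : is_derive (0 : R) 1 (sin \o (fun h : R => complex.Im (z + h%:C * v)))
    (cos (complex.Im z) * complex.Im v).
  by apply: is_derive1_comp; rewrite z0'; exact: is_derive_sin.
have ReE w : complex.Re (cexp w) = expR (complex.Re w) * cos (complex.Im w) by rewrite /cexp /= mul0r subr0.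
have ImE w : complex.Im (cexp w) = expR (complex.Re w) * sin (complex.Im w) by rewrite /cexp /= mul0r addr0.
split.
  under eq_fun do rewrite ReE.
  apply: is_derive_eq (is_deriveM e1 e2) _.
  rewrite /= !z0' /GRing.scale /=.
  rewrite /cexp; case: z v {HR HI z0' e1 e2 e3} => a b [c d] /=; ring.
under eq_fun do rewrite ImE.
apply: is_derive_eq (is_deriveM e1 e3) _.
rewrite /= !z0' /GRing.scale /=.
rewrite /cexp; case: z v {HR HI z0' e1 e2 e3} => a b [c d] /=; ring.
Qed.

End Wirtinger.

Section Smooth.
Context {R : realType}.
Local Notation C := R[i].
Local Notation ii := (Complex 0 1 : C).
Implicit Types (f g phi : C -> C) (z w v d a b : C) (U V : set C) (k : nat).

Lemma smooth_cst U c : open (U : set C^o) -> smooth_on U (fun=> c).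
Proof. by move=> oU k; exact: Ck_cst. Qed.

Lemma smooth_id U : open (U : set C^o) -> smooth_on U id.
Proof. by move=> oU k; exact: Ck_id. Qed.

Lemma smoothD U f g : open (U : set C^o) -> smooth_on U f -> smooth_on U g ->
  smooth_on U (fun z => f z + g z).
Proof. by move=> oU sf sg k; apply: CkD oU (sf k) (sg k). Qed.

Lemma smoothM U f g : open (U : set C^o) -> smooth_on U f -> smooth_on U g ->
  smooth_on U (fun z => f z * g z).
Proof. by move=> oU sf sg k; apply: CkM oU (sf k) (sg k). Qed.

Lemma smooth_conj U f : open (U : set C^o) -> smooth_on U f -> smooth_on U (fun z => conjc (f z)).
Proof. by move=> oU sf k; apply: Ck_conj oU (sf k). Qed.

Lemma smooth_ext U f g : open (U : set C^o) -> (forall z, U z -> f z = g z) ->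
  smooth_on U f -> smooth_on U g.
Proof. by move=> oU fg sf k; apply: Ck_ext oU fg (sf k). Qed.

Lemma smooth_sub U V f : V `<=` U -> smooth_on U f -> smooth_on V f.
Proof. by move=> VU sf k; apply: Ck_sub VU (sf k). Qed.

Lemma smooth_comp U V f phi : open (U : set C^o) -> open (V : set C^o) ->
  (forall z, U z -> V (phi z)) -> smooth_on V f -> smooth_on U phi -> smooth_on U (f \o phi).
Proof. by move=> oU oV UV sf sp k; apply: Ck_comp oU oV UV (sf k) (sp k). Qed.

Lemma smooth_local U f : open (U : set C^o) ->
  (forall z, U z -> exists V, [/\ open (V : set C^o), V z & smooth_on V f]) -> smooth_on U f.
Proof.
move=> oU H k; elim: k f H => [|k IH] f H.
  by split=> [z /H[V [oV Vz sf]]|//]; exact: Ck0 (sf 0%N) z Vz.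
apply/CkS; split=> [z /H[V [oV Vz sf]]|v hv]; first exact: Ck0 (sf 0%N) z Vz.
split=> [z /H[V [oV Vz sf]]|].
  by have /CkS[_ /(_ v hv)[H1 _]] := sf 1%N; exact: H1.
apply: IH => z /H[V [oV Vz sf]]; exists V; split=> // k'.
by have /CkS[_ /(_ v hv)[]] := sf k'.+1.
Qed.

Lemma smooth_inv U f : open (U : set C^o) -> (forall z, U z -> f z != 0) ->
  smooth_on U f -> smooth_on U (fun z => (f z)^-1).
Proof.
move=> oU f0 sf; apply: (smooth_comp (f := fun w => w^-1) oU open_neq0) => //.
exact: Ck_inv.
Qed.

Lemma smooth_rderive U f v : v = 1 \/ v = ii -> smooth_on U f -> smooth_on U (rderive v f).
Proof. by move=> hv sf k; have /CkS[_ /(_ v hv)[]] := sf k.+1. Qed.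

Lemma smooth_isW U f z : smooth_on U f -> U z -> isW f z (dz f z) (dzbar f z).
Proof. by move=> sf; exact: (Ck_isW (sf 1%N)). Qed.

Lemma smooth_dz U f : open (U : set C^o) -> smooth_on U f -> smooth_on U (dz f).
Proof.
move=> oU sf.
apply: (@smooth_ext _ (fun z => (rderive 1 f z + (- ii) * rderive ii f z) * 2^-1)) => //.
  by move=> z _; rewrite mulNr.
have c1 := smooth_rderive (or_introl erefl) sf.
have ci := smooth_rderive (or_intror erefl) sf.
apply: smoothM => //; last exact: smooth_cst.
by apply: smoothD => //; apply: smoothM => //; exact: smooth_cst.
Qed.

Lemma smooth_dzbar U f : open (U : set C^o) -> smooth_on U f -> smooth_on U (dzbar f).
Proof.
move=> oU sf.
apply: (@smooth_ext _ (fun z => (rderive 1 f z + ii * rderive ii f z) * 2^-1)) => //.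
have c1 := smooth_rderive (or_introl erefl) sf.
have ci := smooth_rderive (or_intror erefl) sf.
apply: smoothM => //; last exact: smooth_cst.
by apply: smoothD => //; apply: smoothM => //; exact: smooth_cst.
Qed.

Lemma near_rd1 U f df z : open (U : set C^o) -> U z ->
  (forall w, U w -> is_rd 1 f w (df w)) ->
  near2 (fun x y => is_derive x 1 (fun x => complex.Re (f (x +i* y))) (complex.Re (df (x +i* y))))
    (complex.Re z) (complex.Im z) /\
  near2 (fun x y => is_derive x 1 (fun x => complex.Im (f (x +i* y))) (complex.Im (df (x +i* y))))
    (complex.Re z) (complex.Im z).
Proof.
move=> oU Uz H; have /nbhsC_near2[d d0 K] := open_near oU Uz H.
by split; exists d => // x y hx hy; have /is_rd1[] := K x y hx hy.
Qed.

Lemma near_rdi U f df z : open (U : set C^o) -> U z ->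
  (forall w, U w -> is_rd ii f w (df w)) ->
  near2 (fun x y => is_derive y 1 (fun y => complex.Re (f (x +i* y))) (complex.Re (df (x +i* y))))
    (complex.Re z) (complex.Im z) /\
  near2 (fun x y => is_derive y 1 (fun y => complex.Im (f (x +i* y))) (complex.Im (df (x +i* y))))
    (complex.Re z) (complex.Im z).
Proof.
move=> oU Uz H; have /nbhsC_near2[d d0 K] := open_near oU Uz H.
by split; exists d => // x y hx hy; have /is_rdi[] := K x y hx hy.
Qed.

Lemma schwarzC U f f1 fi fi1 f1i z : open (U : set C^o) -> U z ->
  (forall w, U w -> is_rd 1 f w (f1 w)) -> (forall w, U w -> is_rd ii f w (fi w)) ->
  (forall w, U w -> is_rd ii f1 w (f1i w)) -> (forall w, U w -> is_rd 1 fi w (fi1 w)) ->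
  {for z, continuous (f1i : C^o -> C^o)} -> {for z, continuous (fi1 : C^o -> C^o)} ->
  fi1 z = f1i z.
Proof.
move=> oU Uz /(near_rd1 oU Uz)[a1 a2] /(near_rdi oU Uz)[b1 b2] /(near_rdi oU Uz)[c1 c2]
  /(near_rd1 oU Uz)[d1 d2] /continuousC_cont2[e1 e2] /continuousC_cont2[g1 g2].
have zE : complex.Re z +i* complex.Im z = z by case: (z).
have := schwarz a1 b1 c1 d1 e1 g1; have := schwarz a2 b2 c2 d2 e2 g2.
rewrite zE => h2 h1; apply/eqP; rewrite eq_complex; apply/andP.
by split; apply/eqP; symmetry.
Qed.

Lemma rderiveC U f z : open (U : set C^o) -> smooth_on U f -> U z ->
  rderive 1 (rderive ii f) z = rderive ii (rderive 1 f) z.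
Proof.
move=> oU sf Uz.
have s1 := smooth_rderive (or_introl erefl) sf.
have si := smooth_rderive (or_intror erefl) sf.
apply: (schwarzC (f := f) oU Uz (Ck_is_rd (sf 1%N) (or_introl erefl))
  (Ck_is_rd (sf 1%N) (or_intror erefl)) (Ck_is_rd (s1 1%N) (or_intror erefl))
  (Ck_is_rd (si 1%N) (or_introl erefl))).
- exact: Ck0 (smooth_rderive (or_intror erefl) s1 0%N) _ Uz.
- exact: Ck0 (smooth_rderive (or_introl erefl) si 0%N) _ Uz.
Qed.

Lemma dz_dzbarC U f z : open (U : set C^o) -> smooth_on U f -> U z ->
  dz (dzbar f) z = dzbar (dz f) z.
Proof.
move=> oU sf Uz.
have s1 := smooth_rderive (or_introl erefl) sf.
have si := smooth_rderive (or_intror erefl) sf.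
have dbE : dzbar f = (fun z => (rderive 1 f z + ii * rderive ii f z) * 2%:R^-1) by [].
have dE : dz f = (fun z => (rderive 1 f z + (- ii) * rderive ii f z) * 2%:R^-1).
  by apply/funext => w; rewrite /dz mulNr.
have Eb v : v = 1 \/ v = ii -> rderive v (dzbar f) z = (rderive v (rderive 1 f) z + ii * rderive v (rderive ii f) z) / 2%:R.
  move=> hv; have H1 := Ck_is_rd (s1 1%N) hv Uz; have Hi := Ck_is_rd (si 1%N) hv Uz.
  have Hb := is_rdM (is_rdD H1 (is_rdM (is_rd_cst v ii z) Hi)) (is_rd_cst v 2%:R^-1 z).
  by rewrite dbE (is_rd_val Hb) mul0r add0r mulr0 addr0.
have E v : v = 1 \/ v = ii -> rderive v (dz f) z = (rderive v (rderive 1 f) z - ii * rderive v (rderive ii f) z) / 2%:R.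
  move=> hv; have H1 := Ck_is_rd (s1 1%N) hv Uz; have Hi := Ck_is_rd (si 1%N) hv Uz.
  have Hb := is_rdM (is_rdD H1 (is_rdM (is_rd_cst v (- ii) z) Hi)) (is_rd_cst v 2%:R^-1 z).
  by rewrite dE (is_rd_val Hb) mul0r add0r mulr0 addr0 mulNr.
transitivity ((rderive 1 (dzbar f) z - ii * rderive ii (dzbar f) z) / 2%:R); first by [].
transitivity ((rderive 1 (dz f) z + ii * rderive ii (dz f) z) / 2%:R); last by [].
rewrite (Eb _ (or_introl erefl)) (Eb _ (or_intror erefl)) (E _ (or_introl erefl)) (E _ (or_intror erefl)).
rewrite (rderiveC oU sf Uz).
have alg (A B D I : C) : ((A + I * B) / 2%:R - I * ((B + I * D) / 2%:R)) / 2%:R =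
    ((A - I * B) / 2%:R + I * ((B - I * D) / 2%:R)) / 2%:R by ring.
exact: (alg _ _ _ ii).
Qed.


Lemma holo_isW U f z : holomorphic_on U f -> U z -> isW f z (dz f z) 0.
Proof. by move=> [sf hf] Uz; have := smooth_isW sf Uz; rewrite hf. Qed.

Lemma holo_intro U f (df : C -> C) : smooth_on U f -> (forall z, U z -> isW f z (df z) 0) ->
  holomorphic_on U f.
Proof. by move=> sf H; split=> // z /H /isW_val[]. Qed.

Lemma holo_cst U c : open (U : set C^o) -> holomorphic_on U (fun=> c).
Proof.
move=> oU; apply: (holo_intro (df := fun=> 0)); first exact: smooth_cst.
by move=> z _; exact: isW_cst.
Qed.

Lemma holo_id U : open (U : set C^o) -> holomorphic_on U id.
Proof.
move=> oU; apply: (holo_intro (df := fun=> 1)); first exact: smooth_id.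
by move=> z _; exact: isW_id.
Qed.

Lemma holoD U f g : open (U : set C^o) -> holomorphic_on U f -> holomorphic_on U g ->
  holomorphic_on U (fun z => f z + g z).
Proof.
move=> oU hf hg; apply: (holo_intro (df := fun z => dz f z + dz g z)).
  by apply: smoothD => //; [case: hf|case: hg].
move=> z Uz; apply: isW_eq (isW_D (holo_isW hf Uz) (holo_isW hg Uz)) _ _ => //.
by rewrite addr0.
Qed.

Lemma holoM U f g : open (U : set C^o) -> holomorphic_on U f -> holomorphic_on U g ->
  holomorphic_on U (fun z => f z * g z).
Proof.
move=> oU hf hg; apply: (holo_intro (df := fun z => dz f z * g z + f z * dz g z)).
  by apply: smoothM => //; [case: hf|case: hg].
move=> z Uz; apply: isW_eq (isW_M (holo_isW hf Uz) (holo_isW hg Uz)) _ _ => //.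
by rewrite mul0r mulr0 addr0.
Qed.

Lemma holo_ext U f g : open (U : set C^o) -> (forall z, U z -> f z = g z) ->
  holomorphic_on U f -> holomorphic_on U g.
Proof.
move=> oU fg hf; apply: (holo_intro (df := dz f)).
  by apply: smooth_ext fg _ => //; case: hf.
by move=> z Uz; apply: isW_near (holo_isW hf Uz); exact: open_near fg.
Qed.

Lemma holo_sub U V f : V `<=` U -> holomorphic_on U f -> holomorphic_on V f.
Proof. by move=> VU [sf hf]; split=> [|z /VU /hf//]; exact: smooth_sub sf. Qed.

Lemma holo_local U f : open (U : set C^o) ->
  (forall z, U z -> exists V, [/\ open (V : set C^o), V z & holomorphic_on V f]) ->
  holomorphic_on U f.
Proof.
move=> oU H; split; last by move=> z /H[V [_ Vz [_]]]; exact.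
by apply: smooth_local => // z /H[V [oV Vz [sf _]]]; exists V.
Qed.

Lemma holo_comp U V f phi : open (U : set C^o) -> open (V : set C^o) ->
  (forall z, U z -> V (phi z)) -> holomorphic_on V f -> holomorphic_on U phi ->
  holomorphic_on U (f \o phi).
Proof.
move=> oU oV UV hf hp; apply: (holo_intro (df := fun z => dz phi z * dz f (phi z))).
  by apply: (smooth_comp oU oV UV); [case: hf|case: hp].
move=> z Uz; apply: isW_eq (isW_comp oV (hf.1 1%N) (UV z Uz) (holo_isW hp Uz)) _ _.
  by rewrite conjc0 mul0r addr0.
by rewrite mul0r add0r hf.2 ?mulr0//; exact: UV.
Qed.

Lemma holo_inv U f : open (U : set C^o) -> (forall z, U z -> f z != 0) ->
  holomorphic_on U f -> holomorphic_on U (fun z => (f z)^-1).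
Proof.
move=> oU f0 hf; apply: (holo_comp (f := fun w => w^-1) oU open_neq0) => //.
apply: (holo_intro (df := fun z => - z^-1 * z^-1)); first exact: Ck_inv.
by move=> z z0; exact: isW_inv.
Qed.

Lemma holo_cexp U : open (U : set C^o) -> holomorphic_on U (@cexp R).
Proof.
move=> oU; apply: (holo_intro (df := @cexp R)); first by move=> k; exact: Ck_cexp.
by move=> z _; exact: isW_cexp.
Qed.

Lemma holo_dz U f : open (U : set C^o) -> holomorphic_on U f -> holomorphic_on U (dz f).
Proof.
move=> oU [sf hf]; split=> [|z Uz]; first exact: smooth_dz.
rewrite -(dz_dzbarC oU sf Uz).
have : isW (dzbar f) z 0 0.
  apply: (isW_near (f := fun=> 0)) (isW_cst _ _).
  by apply: open_near oU Uz _ => w /hf.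
by move=> /isW_val[].
Qed.

Lemma smooth_sum (I : Type) (r : seq I) (P : pred I) U (F : I -> C -> C) : open (U : set C^o) ->
  (forall i, smooth_on U (F i)) -> smooth_on U (fun z => \sum_(i <- r | P i) F i z).
Proof.
move=> oU H; elim: r => [|i r IH].
  by apply: (smooth_ext (f := fun=> 0)) => // [z _|]; [rewrite big_nil|exact: smooth_cst].
case Pi : (P i); last first.
  by apply: smooth_ext IH => // z _; rewrite big_cons Pi.
apply: (smooth_ext (f := fun z => F i z + \sum_(j <- r | P j) F j z)) => //.
  by move=> z _; rewrite big_cons Pi.
exact: smoothD.
Qed.

Lemma smooth_prod (I : Type) (r : seq I) (P : pred I) U (F : I -> C -> C) : open (U : set C^o) ->
  (forall i, smooth_on U (F i)) -> smooth_on U (fun z => \prod_(i <- r | P i) F i z).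
Proof.
move=> oU H; elim: r => [|i r IH].
  by apply: (smooth_ext (f := fun=> 1)) => // [z _|]; [rewrite big_nil|exact: smooth_cst].
case Pi : (P i); last first.
  by apply: smooth_ext IH => // z _; rewrite big_cons Pi.
apply: (smooth_ext (f := fun z => F i z * \prod_(j <- r | P j) F j z)) => //.
  by move=> z _; rewrite big_cons Pi.
exact: smoothM.
Qed.

Lemma holo_sum (I : Type) (r : seq I) (P : pred I) U (F : I -> C -> C) : open (U : set C^o) ->
  (forall i, holomorphic_on U (F i)) -> holomorphic_on U (fun z => \sum_(i <- r | P i) F i z).
Proof.
move=> oU H; elim: r => [|i r IH].
  by apply: (holo_ext (f := fun=> 0)) => // [z _|]; [rewrite big_nil|exact: holo_cst].
case Pi : (P i); last first.
  by apply: holo_ext IH => // z _; rewrite big_cons Pi.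
apply: (holo_ext (f := fun z => F i z + \sum_(j <- r | P j) F j z)) => //.
  by move=> z _; rewrite big_cons Pi.
exact: holoD.
Qed.

Lemma holo_exp U f k : open (U : set C^o) -> holomorphic_on U f -> holomorphic_on U (fun z => f z ^+ k).
Proof.
move=> oU hf; elim: k => [|k IH]; first by apply: (holo_ext (f := fun=> 1)) => //; exact: holo_cst.
by apply: (holo_ext (f := fun z => f z * f z ^+ k)) => // [z _|]; [rewrite exprS|exact: holoM].
Qed.

Lemma cexpD a b : cexp (a + b) = cexp a * cexp b.
Proof.
case: a b => [a1 a2] [b1 b2]; rewrite /cexp /= expRD cosD sinD.
by apply/eqP; rewrite eq_complex /=; apply/andP; split; apply/eqP; ring.
Qed.

Lemma cexp0 : cexp (0 : C) = 1.
Proof. by rewrite /cexp /= expR0 cos0 sin0 mul1r. Qed.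

Lemma cexp_neq0 a : cexp a != 0.
Proof.
apply/eqP => H; have := cexpD a (- a); rewrite H mul0r subrr cexp0.
by move/eqP; rewrite oner_eq0.
Qed.

Lemma cexpN a : cexp (- a) = (cexp a)^-1.
Proof.
by apply: (mulfI (cexp_neq0 a)); rewrite -cexpD subrr cexp0 mulfV// cexp_neq0.
Qed.

Lemma cexpMn a k : cexp (a *+ k) = cexp a ^+ k.
Proof. by elim: k => [|k IH]; rewrite ?mulr0n ?cexp0// mulrS cexpD IH exprS. Qed.

Lemma cexp_surj a : a != 0 -> exists b, cexp b = a.
Proof.
move=> a0; pose r := Num.sqrt (complex.Re a ^+ 2 + complex.Im a ^+ 2).
have r0 : 0 < r.
  by rewrite -ltcR -normc_def normr_gt0.
pose x := complex.Re a / r; pose y := complex.Im a / r.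
have xy : x ^+ 2 + y ^+ 2 = 1.
  rewrite /x /y !exprMn -mulrDl exprVn sqr_sqrtr ?addr_ge0 ?sqr_ge0// mulfV//.
  by apply: contraTneq r0 => E; rewrite /r E sqrtr0 ltxx.
have [t [ct st]] : exists t, cos t = x /\ sin t = y.
  have x1 : -1 <= x <= 1 by apply/andP; split; have := sqr_ge0 y; nra.
  have sx : Num.sqrt (1 - x ^+ 2) = `|y| by rewrite -xy addrC addKr sqrtr_sqr.
  have [y0|/ltW y0] := leP 0 y.
    by exists (acos x); rewrite acosK ?in_itv// sin_acos// sx ger0_norm.
  exists (- acos x); rewrite cosN sinN acosK ?in_itv// sin_acos// sx ler0_norm//.
  by rewrite opprK.
exists (ln r +i* t); rewrite /cexp /= lnK ?posrE// ct st.
by rewrite /x /y; case: (a) => p q; apply/eqP; rewrite eq_complex /=;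
  apply/andP; split; apply/eqP; field; rewrite gt_eqF.
Qed.

End Smooth.

(** * Primitives, logarithms and monodromy on the plane *)

Section Primitive.
Context {R : realType}.
Local Notation C := R[i].
Local Notation ii := (Complex 0 1 : C).
Implicit Types (f g : C -> C) (z w : C).

Definition rect (A B : set R) : set C := [set z | A (complex.Re z) /\ B (complex.Im z)].

Lemma open_rect (A B : set R) : open A -> open B -> open (rect A B : set C^o).
Proof.
move=> oA oB; rewrite openE => z [/= Az Bz]; rewrite /interior; apply/nbhsC_near2.
have /nbhs_ballP[r /= r0 HA] := open_nbhs_nbhs (conj oA Az).
have /nbhs_ballP[s /= s0 HB] := open_nbhs_nbhs (conj oB Bz).
exists (Num.min r s); first by rewrite lt_min r0.
move=> x y; rewrite !lt_min => /andP[hx _] /andP[_ hy]; split => /=.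
  by apply: HA; rewrite /ball /= distrC.
by apply: HB; rewrite /ball /= distrC.
Qed.

Lemma near2_cont (u ux : R -> R -> R) (a b : R) :
  near2 (fun x y => is_derive x 1 (u^~ y) (ux x y)) a b -> cont2 ux a b ->
  {for b, continuous (u a)} -> cont2 u a b.
Proof.
move=> [d d0 H] cux /cvgrPdist_lt cu e e0.
have [d1 d10 H1] := cux 1 ltr01.
have /nbhs_ballP[d2 /= d20 H2] := cu (e / 2) (divr_gt0 e0 (ltr0Sn _ _)).
pose m := 1 + `|ux a b|; have m0 : 0 < m by rewrite ltr_wpDr.
exists (Num.min (Num.min d d1) (Num.min d2 (e / 2 / m))).
  by rewrite !lt_min d0 d10 d20/= !divr_gt0.
move=> x y; rewrite !lt_min => /andP[/andP[x1 x2] /andP[x3 x4]] /andP[/andP[y1 y2] /andP[y3 y4]].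
have [|c cx E] := @MVT_between R (u^~ y) (ux^~ y) a x.
  by move=> c cx; apply: H => //; exact: le_lt_trans cx x1.
rewrite -(subrK (u a y) (u x y)) -addrA (le_lt_trans (ler_normD _ _))// [ltRHS]splitr.
apply: ltrD; last by rewrite distrC; apply: H2; rewrite /ball /= distrC.
rewrite E normrM (@le_lt_trans _ _ (m * `|x - a|))//; last by rewrite mulrC -ltr_pdivlMr.
rewrite ler_wpM2r// /m -(subrK (ux a b) (ux c y)) (le_trans (ler_normD _ _))// lerD2r ltW//.
by apply: H1 => //; exact: le_lt_trans cx x2.
Qed.

Lemma primitive (A B : set R) f c : open A -> is_interval A -> open B -> is_interval B ->
  rect A B c -> holomorphic_on (rect A B) f ->
  exists2 F, holomorphic_on (rect A B) F & forall z, rect A B z -> dz F z = f z.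
Proof.
move=> oA iA oB iB [Ac Bc] hf; have oU := open_rect oA oB.
pose P x y : R := complex.Re (f (x +i* y)); pose Q x y : R := complex.Im (f (x +i* y)).
pose S x y : R := complex.Re (dz f (x +i* y)); pose T x y : R := complex.Im (dz f (x +i* y)).
have cont x y : A x -> B y -> [/\ cont2 P x y, cont2 Q x y, cont2 S x y & cont2 T x y].
  move=> Ax By; have Uz : rect A B (x +i* y) by [].
  have /continuousC_cont2[] := Ck0 (hf.1 0%N) Uz.
  by have /continuousC_cont2[] := Ck0 ((holo_dz oU hf).1 0%N) Uz.
have der1 x y : A x -> B y -> is_derive x 1 (P^~ y) (S x y) /\ is_derive x 1 (Q^~ y) (T x y).
  move=> Ax By; have Uz : rect A B (x +i* y) by [].
  have := holo_isW hf Uz (or_introl erefl); rewrite mulr0 addr0 mul1r.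
  by move=> /is_rd1.
have deri x y : A x -> B y -> is_derive y 1 (P x) (- T x y) /\ is_derive y 1 (Q x) (S x y).
  move=> Ax By; have Uz : rect A B (x +i* y) by [].
  have := holo_isW hf Uz (or_intror erefl); rewrite mulr0 addr0.
  move=> /is_rdi[]; rewrite /P /Q /S /T.
  by case: (dz f _) => p q; rewrite /= !mul0r !mul1r sub0r add0r.
have contN (g : R -> R -> R) x y : cont2 g x y -> cont2 (fun x y => - g x y) x y.
  move=> cg e /cg[d d0 H]; exists d => // x' y' hx hy.
  by rewrite -opprD normrN; exact: H.
have [W1 HW1] := @poincare R A B P (fun x y => - Q x y) (fun x y => - T x y) _ _ oA iA Ac oB iB Bc
  (fun x y Ax By => let: And4 c1 c2 c3 c4 := cont x y Ax By in And3 c1 (contN _ _ _ c2) (contN _ _ _ c4))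
  (fun x y Ax By => conj (deri x y Ax By).1 (is_deriveN (der1 x y Ax By).2)).
have [W2 HW2] := @poincare R A B Q P S _ _ oA iA Ac oB iB Bc
  (fun x y Ax By => let: And4 c1 c2 c3 c4 := cont x y Ax By in And3 c2 c1 c3)
  (fun x y Ax By => conj (deri x y Ax By).2 (der1 x y Ax By).1).
pose F z := W1 (complex.Re z) (complex.Im z) +i* W2 (complex.Re z) (complex.Im z).
have rd1 z : rect A B z -> is_rd 1 F z (f z).
  move=> [Az Bz]; apply/is_rd1; have zE : complex.Re z +i* complex.Im z = z by case: (z).
  have [d1 _] := HW1 _ _ Az Bz; have [d2 _] := HW2 _ _ Az Bz.
  by move: d1 d2; rewrite /P /Q zE.
have rdi z : rect A B z -> is_rd ii F z (ii * f z).
  move=> [Az Bz]; apply/is_rdi; have zE : complex.Re z +i* complex.Im z = z by case: (z).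
  have [_ d1] := HW1 _ _ Az Bz; have [_ d2] := HW2 _ _ Az Bz.
  by move: d1 d2; rewrite /P /Q zE; case: (f z) => p q; rewrite /= !mul0r !mul1r sub0r add0r.
have WF z : rect A B z -> isW F z (f z) 0.
  move=> Uz v [->|->]; rewrite mulr0 addr0 ?mul1r; [exact: rd1|exact: rdi].
have contF z : rect A B z -> {for z, continuous (F : C^o -> C^o)}.
  move=> [Az Bz]; have [cP cQ _ _] := cont _ _ Az Bz; apply/continuousC_cont2.
  have Uz : rect A B z by [].
  have nr (p : R -> R -> Prop) : (forall x y, A x -> B y -> p x y) -> near2 p (complex.Re z) (complex.Im z).
    move=> H; have /nbhsC_near2 := open_near (P := fun w => p (complex.Re w) (complex.Im w)) oU Uz (fun w hw => H _ _ hw.1 hw.2).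
    by [].
  split.
    apply: (near2_cont (ux := P)) => //; first by apply: nr => x y Ax By; exact: (HW1 x y Ax By).1.
    apply/differentiable_continuous/derivable1_diffP.
    by have [] := (HW1 _ _ Az Bz).2.
  apply: (near2_cont (ux := Q)) => //; first by apply: nr => x y Ax By; exact: (HW2 x y Ax By).1.
  apply/differentiable_continuous/derivable1_diffP.
  by have [] := (HW2 _ _ Az Bz).2.
exists F; last by move=> z /WF /isW_val[].
apply: (holo_intro (df := f)) => // k; case: k => [|k]; first by split.
apply: (Ck_is_rdW (df := fun v z => v * f z)) => // v hv; split=> [z Uz|].
  by have := WF z Uz v hv; rewrite mulr0 addr0.
by apply: CkM => //; [exact: Ck_cst|exact: hf.1].
Qed.

Lemma rect_cst (A B : set R) f : is_interval A -> is_interval B ->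
  (forall z, rect A B z -> isW f z 0 0) ->
  forall z w, rect A B z -> rect A B w -> f z = f w.
Proof.
move=> iA iB H z w [Az Bz] [Aw Bw].
have zE (u : C) : complex.Re u +i* complex.Im u = u by case: u.
have d1 x y : A x -> B y -> is_rd 1 f (x +i* y) 0.
  by move=> Ax By; have := H (x +i* y) (conj Ax By) _ (or_introl erefl); rewrite !mulr0 addr0.
have di x y : A x -> B y -> is_rd ii f (x +i* y) 0.
  by move=> Ax By; have := H (x +i* y) (conj Ax By) _ (or_intror erefl); rewrite !mulr0 addr0.
have e1 x x' y : A x -> A x' -> B y -> f (x +i* y) = f (x' +i* y).
  move=> Ax Ax' By; have bt c : btw x x' c -> A c by exact: btw_interval.
  apply/eqP; rewrite eq_complex; apply/andP; split; apply/eqP/esym/eqP; rewrite -subr_eq0.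
    have [|c _ ->] := @MVT_btw R (fun x => complex.Re (f (x +i* y))) (fun=> 0) x x'; last by rewrite mul0r.
    by move=> c /bt Ac; have /is_rd1[] := d1 c y Ac By.
  have [|c _ ->] := @MVT_btw R (fun x => complex.Im (f (x +i* y))) (fun=> 0) x x'; last by rewrite mul0r.
  by move=> c /bt Ac; have /is_rd1[] := d1 c y Ac By.
have e2 x y y' : A x -> B y -> B y' -> f (x +i* y) = f (x +i* y').
  move=> Ax By By'; have bt c : btw y y' c -> B c by exact: btw_interval.
  apply/eqP; rewrite eq_complex; apply/andP; split; apply/eqP/esym/eqP; rewrite -subr_eq0.
    have [|c _ ->] := @MVT_btw R (fun y => complex.Re (f (x +i* y))) (fun=> 0) y y'; last by rewrite mul0r.
    by move=> c /bt Bc; have /is_rdi[] := di x c Ax Bc.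
  have [|c _ ->] := @MVT_btw R (fun y => complex.Im (f (x +i* y))) (fun=> 0) y y'; last by rewrite mul0r.
  by move=> c /bt Bc; have /is_rdi[] := di x c Ax Bc.
by rewrite -(zE z) -(zE w) (e1 _ (complex.Re w)) ?(e2 _ _ (complex.Im w)).
Qed.

Lemma holo_log (A B : set R) f c : open A -> is_interval A -> open B -> is_interval B ->
  rect A B c -> holomorphic_on (rect A B) f -> (forall z, rect A B z -> f z != 0) ->
  exists2 L, holomorphic_on (rect A B) L & forall z, rect A B z -> cexp (L z) = f z.
Proof.
move=> oA iA oB iB Uc hf f0; have oU := open_rect oA oB.
have hg : holomorphic_on (rect A B) (fun z => dz f z * (f z)^-1).
  exact: holoM oU (holo_dz oU hf) (holo_inv oU f0 hf).
have [F hF dF] := primitive oA iA oB iB Uc hg.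
have hFN : holomorphic_on (rect A B) (fun z => (-1) * F z) by exact: holoM oU (holo_cst _ oU) hF.
have hE : holomorphic_on (rect A B) (@cexp R \o (fun z => (-1) * F z)).
  by apply: holo_comp (holo_cexp openT) hFN => //; exact: openT.
have W0 z : rect A B z -> isW (fun z => f z * (@cexp R \o (fun z => (-1) * F z)) z) z 0 0.
  move=> Uz; have WN := isW_M (isW_cst (-1) z) (holo_isW hF Uz).
  have WE := isW_comp openT ((holo_cexp openT).1 1%N) (I : setT _) WN.
  have [e1 e2] := isW_val (isW_cexp (-1 * F z)).
  apply: isW_eq (isW_M (holo_isW hf Uz) WE) _ _; rewrite /= e1 e2 dF// ?conjc0.
    by have := f0 z Uz; move: (f z) (dz f z) (cexp _) => p q r p0; field.
  by rewrite !(mulr0, mul0r, addr0).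
have cE := rect_cst iA iB W0 Uc.
have [b bE] := cexp_surj (mulf_neq0 (f0 c Uc) (cexp_neq0 (-1 * F c))).
exists (fun z => F z + b).
  exact: holoD oU hF (holo_cst _ oU).
move=> z Uz; rewrite cexpD bE; have := cE z Uz; rewrite /= => ->.
by rewrite mulrC mulN1r cexpN -mulrA mulVf ?mulr1 ?cexp_neq0.
Qed.

End Primitive.

Section Monodromy.
Context {R : realType}.
Local Notation C := R[i].
Implicit Types (z w s : C) (a b c d m x y : R) (e : C -> bool).

Lemma interval_induction (G : R -> R -> Prop) a b : a <= b ->
  (forall t, a <= t <= b -> exists2 d, 0 < d &
    forall u v, t - d < u -> u <= t -> t <= v -> v < t + d -> a <= u -> v <= b -> G u v) ->
  (forall u m v, u <= m -> m <= v -> G u m -> G m v -> G u v) -> G a b.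
Proof.
move=> ab loc glue; pose S := [set t | a <= t <= b /\ G a t].
have Sa : S a.
  split; first by rewrite lexx.
  have [|d d0 H] := loc a; first by rewrite lexx.
  by apply: H; rewrite ?lexx ?gtrBl ?ltrDl.
have Sb : has_sup S by split; [exists a|exists b => t [/andP[]]].
have supa : a <= sup S by apply: ub_le_sup => //; case: Sb.
have supb : sup S <= b by apply: ge_sup; [exists a|move=> t [/andP[]]].
have [|d d0 H] := loc (sup S); first by rewrite supa.
have [t [/andP[ta tb] Gt] dt] := sup_adherent d0 Sb.
have ts : t <= sup S by apply: ub_le_sup; [case: Sb|split; [rewrite ta|]].
have key v : sup S <= v -> v < sup S + d -> v <= b -> G a v.
  move=> sv vd vb; apply: (glue a t v) => //; first exact: le_trans sv.
  have Gts : G t (sup S) by apply: H => //; rewrite ltrDl.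
  apply: (glue t (sup S) v) => //.
  by apply: H => //; rewrite gtrBl.
have [lt|ge] := ltP (sup S) b; last first.
  by have -> : b = sup S by [apply/le_anti/andP]; apply: key => //; rewrite ltrDl.
pose v := Num.min b (sup S + d / 2).
have sv : sup S < v by rewrite lt_min lt ltrDl divr_gt0.
have vb : v <= b by rewrite ge_min lexx.
have Gv : G a v.
  apply: key => //; first exact: ltW.
  by rewrite gt_min ltrD2l; apply/orP; right; lra.
have : v <= sup S by apply: ub_le_sup; [case: Sb|split => //; rewrite vb (le_trans supa)// ltW].
by rewrite leNgt sv.
Qed.

Lemma locally_constant_line (g : R -> bool) a b :
  (forall t, btw a b t -> \forall u \near t, g u = g t) -> g a = g b.
Proof.
move=> H; have [|c _] := @MVT_btw R (fun t => (g t)%:R) (fun=> 0) a b.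
  move=> c cab; apply: near_eq_is_derive (is_derive_cst ((g c)%:R : R) c 1).
  by apply: filterS (H c cab) => u /= ->.
by rewrite mul0r => /eqP; rewrite subr_eq0; case: (g a) (g b) => [] [] //=;
  rewrite ?oner_eq0 // eq_sym oner_eq0.
Qed.

Definition loc_cst e s := \forall w \near (s : C^o), e w = e s.

Definition box a b c d : set C :=
  [set s | (a <= complex.Re s <= b) && (c <= complex.Im s <= d)].

Lemma btw_itv a b x y c : a <= x <= b -> a <= y <= b -> btw x y c -> a <= c <= b.
Proof.
move=> /andP[x1 x2] /andP[y1 y2] /andP[c1 c2]; apply/andP; split.
  by apply: le_trans c1; rewrite le_min x1.
by apply: le_trans c2 _; rewrite ge_max x2.
Qed.

Lemma box_connected a b c d e : (forall s, box a b c d s -> loc_cst e s) ->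
  forall s w, box a b c d s -> box a b c d w -> e s = e w.
Proof.
move=> H s w /andP[s1 s2] /andP[w1 w2].
have sE (u : C) : u = complex.Re u +i* complex.Im u by case: u.
transitivity (e (complex.Re w +i* complex.Im s)).
  rewrite {1}(sE s).
  apply: (@locally_constant_line (fun x => e (x +i* complex.Im s))) => x hx.
  have /nbhsC_near2[r r0 K] : loc_cst e (x +i* complex.Im s).
    by apply: H; rewrite /box /= s2 (btw_itv s1 w1 hx).
  apply/nbhs_ballP; exists r => // u; rewrite /ball /= distrC => hu.
  by apply: K => //=; rewrite subrr normr0.
rewrite {2}(sE w).
apply: (@locally_constant_line (fun y => e (complex.Re w +i* y))) => y hy.
have /nbhsC_near2[r r0 K] : loc_cst e (complex.Re w +i* y).
  by apply: H; rewrite /box /= w1 (btw_itv s2 w2 hy).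
apply/nbhs_ballP; exists r => // u; rewrite /ball /= distrC => hu.
by apply: K => //=; rewrite subrr normr0.
Qed.

Lemma loc_cst_cst e : (forall s, loc_cst e s) -> forall s w, e s = e w.
Proof.
move=> H s w.
pose M := `|complex.Re s| + `|complex.Re w| + `|complex.Im s| + `|complex.Im w|.
have B (x y z t : R) : -(`|x| + `|y| + `|z| + `|t|) <= x <= (`|x| + `|y| + `|z| + `|t|).
  by rewrite -ler_norml -!addrA lerDl !addr_ge0.
apply: (@box_connected (- M) M (- M) M) => // ; rewrite /box /=; apply/andP; split.
- exact: B.
- by have := B (complex.Im s) (complex.Re s) (complex.Re w) (complex.Im w); rewrite /M; lra.
- by have := B (complex.Re w) (complex.Re s) (complex.Im s) (complex.Im w); rewrite /M; lra.
- by have := B (complex.Im w) (complex.Re s) (complex.Re w) (complex.Im s); rewrite /M; lra.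
Qed.

Section Sign.
(** [P s e] is meant as: a pointwise choice of objects defined up to a sign,
    once corrected by the signs [e], is holomorphic near [s]. *)
Variable P : C -> (C -> bool) -> Prop.
Hypothesis P_local : forall s, exists e, \forall w \near (s : C^o), P w e.
Hypothesis P_sign : forall s e e' (b : bool),
  (\forall w \near (s : C^o), e' w = b (+) e w) -> P s e -> P s e'.
Hypothesis P_unique : forall s e e', P s e -> P s e' ->
  exists b : bool, \forall w \near (s : C^o), e' w = b (+) e w.

Lemma P_diff s e e' : P s e -> P s e' -> loc_cst (fun w => e' w (+) e w) s.
Proof.
move=> pe pe'; have [b H] := P_unique pe pe'; have Hs := nbhs_singleton H.
by apply: filterS H => w ->; rewrite Hs -!addbA !addbb.
Qed.

Definition glued (Q : set C) := exists e, forall s, Q s -> P s e.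

Lemma glued_glue (rho : C -> R) m (Q : set C) :
  (forall s, rho s < m -> \forall w \near (s : C^o), rho w < m) ->
  (forall s, m < rho s -> \forall w \near (s : C^o), m < rho w) ->
  (forall e, (forall s, Q s -> rho s = m -> loc_cst e s) ->
     forall s w, Q s -> rho s = m -> Q w -> rho w = m -> e s = e w) ->
  glued (Q `&` [set s | rho s <= m]) -> glued (Q `&` [set s | m <= rho s]) -> glued Q.
Proof.
move=> lt_near gt_near conn [e1 H1] [e2 H2].
have H1' s : Q s -> rho s = m -> P s e1 by move=> Qs rs; apply: H1; split=> //=; rewrite rs.
have H2' s : Q s -> rho s = m -> P s e2 by move=> Qs rs; apply: H2; split=> //=; rewrite rs.
have [b0 Hb0] : exists b0 : bool, forall s, Q s -> rho s = m -> e2 s (+) e1 s = b0.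
  have [[s0 [Qs0 rs0]]|nex] := pselect (exists s, Q s /\ rho s = m).
    exists (e2 s0 (+) e1 s0) => s Qs rs.
    apply: (conn (fun w => e2 w (+) e1 w)) => // w Qw rw.
    by apply: P_diff; [exact: H1'|exact: H2'].
  by exists false => s Qs rs; case: nex; exists s.
exists (fun w => if rho w < m then e1 w else b0 (+) e2 w) => s Qs.
have [lt|gt|eq] := ltgtP (rho s) m.
- apply: (P_sign (b := false) (e := e1)); last by apply: H1; split=> //; exact: ltW.
  by apply: filterS (lt_near s lt) => w /= ->.
- apply: (P_sign (b := b0) (e := e2)); last by apply: H2; split=> //; exact: ltW.
  by apply: filterS (gt_near s gt) => w /= mw; rewrite ltNge (ltW mw).
- apply: (P_sign (b := false) (e := e1)); last exact: H1'.
  have := P_diff (H1' s Qs eq) (H2' s Qs eq); rewrite /loc_cst (Hb0 s Qs eq).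
  apply: filterS => w E; case: ifP => // _; rewrite -E.
  by rewrite addbC addbA addbb.
Qed.

Lemma glued_sub (Q Q' : set C) : Q `<=` Q' -> glued Q' -> glued Q.
Proof. by move=> QQ [e H]; exists e => s /QQ /H. Qed.

Lemma glued_box_Re a m b c d : a <= m -> m <= b ->
  glued (box a m c d) -> glued (box m b c d) -> glued (box a b c d).
Proof.
move=> am mb g1 g2; apply: (@glued_glue (@complex.Re R) m).
- move=> s sm; apply/nbhsC_near2; exists (m - complex.Re s); first by rewrite subr_gt0.
  by move=> x y hx _ /=; move: hx; rewrite ltr_distl => /andP[_]; lra.
- move=> s sm; apply/nbhsC_near2; exists (complex.Re s - m); first by rewrite subr_gt0.
  by move=> x y hx _ /=; move: hx; rewrite ltr_distl => /andP[+ _]; lra.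
- move=> e H s w /andP[s1 s2] sm /andP[w1 w2] wm.
  apply: (@box_connected m m c d); rewrite /box /= ?sm ?wm ?lexx ?s2 ?w2//.
  move=> u /andP[/andP[u1 u2] u3]; have um : complex.Re u = m by apply/le_anti/andP.
  by apply: H => //; rewrite /box /= um am mb u3.
- by apply: glued_sub g1 => s [/andP[/andP[h1 h2] h3] h4]; rewrite /box /= h1 h4 h3.
- by apply: glued_sub g2 => s [/andP[/andP[h1 h2] h3] h4]; rewrite /box /= h2 h4 h3.
Qed.

Lemma glued_box_Im a b c m d : c <= m -> m <= d ->
  glued (box a b c m) -> glued (box a b m d) -> glued (box a b c d).
Proof.
move=> cm md g1 g2; apply: (@glued_glue (@complex.Im R) m).
- move=> s sm; apply/nbhsC_near2; exists (m - complex.Im s); first by rewrite subr_gt0.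
  by move=> x y _ hx /=; move: hx; rewrite ltr_distl => /andP[_]; lra.
- move=> s sm; apply/nbhsC_near2; exists (complex.Im s - m); first by rewrite subr_gt0.
  by move=> x y _ hx /=; move: hx; rewrite ltr_distl => /andP[+ _]; lra.
- move=> e H s w /andP[s1 s2] sm /andP[w1 w2] wm.
  apply: (@box_connected a b m m); rewrite /box /= ?sm ?wm ?lexx ?s1 ?w1//.
  move=> u /andP[u3 /andP[u1 u2]]; have um : complex.Im u = m by apply/le_anti/andP.
  by apply: H => //; rewrite /box /= um cm md u3.
- by apply: glued_sub g1 => s [/andP[h3 /andP[h1 h2]] h4]; rewrite /box /= h1 h4 h3.
- by apply: glued_sub g2 => s [/andP[h3 /andP[h1 h2]] h4]; rewrite /box /= h2 h4 h3.
Qed.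

Lemma glued_box a b c d : a <= b -> c <= d -> glued (box a b c d).
Proof.
move=> ab cd.
have strip x : exists2 r, 0 < r & glued (box (x - r) (x + r) c d).
  apply: (@interval_induction (fun p q => exists2 r, 0 < r & glued (box (x - r) (x + r) p q))) => //.
    move=> y _; have [e /nbhsC_near2[r r0 H]] := P_local (x +i* y).
    exists r => // u v ur uy yv vr _ _; exists (r / 2); first by rewrite divr_gt0.
    exists e => -[p q] /andP[/= /andP[p1 p2] /andP[q1 q2]]; apply: H => /=.
      by rewrite ltr_distl; apply/andP; split; lra.
    by rewrite ltr_distl; apply/andP; split; lra.
  move=> u m v um mv [r r0 g] [r' r'0 g']; exists (Num.min r r'); first by rewrite lt_min r0.
  have h1 : Num.min r r' <= r by rewrite ge_min lexx.
  have h2 : Num.min r r' <= r' by rewrite ge_min lexx orbT.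
  apply: (glued_box_Im um mv).
    apply: glued_sub g => s /andP[/andP[s1 s2] s3]; rewrite /box /= s3 andbT.
    by apply/andP; split; lra.
  apply: glued_sub g' => s /andP[/andP[s1 s2] s3]; rewrite /box /= s3 andbT.
  by apply/andP; split; lra.
apply: (@interval_induction (fun u v => glued (box u v c d))) => //.
  move=> x _; have [r r0 g] := strip x; exists r => // u v ur ux xv vr _ _.
  apply: glued_sub g => s /andP[/andP[s1 s2] s3]; rewrite /box /= s3 andbT.
  by apply/andP; split; lra.
by move=> u m v um mv; exact: glued_box_Re.
Qed.

Lemma sign_monodromy : exists e, forall s, P s e.
Proof.
pose Q (N : nat) := box (- N%:R) N%:R (- N%:R) N%:R.
have QS N M s : (N <= M)%N -> Q N s -> Q M s.
  rewrite -(@ler_nat R) /Q /box /= => NM /andP[/andP[h1 h2] /andP[h3 h4]].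
  by apply/andP; split; apply/andP; split; lra.
have ex N : exists e, (forall s, Q N s -> P s e) /\ e 0 = false.
  have NN : (- N%:R : R) <= N%:R by rewrite (@le_trans _ _ 0) ?oppr_le0 ?ler0n.
  have [e He] := glued_box NN NN.
  exists (fun w => e 0 (+) e w); split; last by rewrite addbb.
  move=> s /He; apply: P_sign; exact: filterE.
have [E HE] := choice ex.
have EE N M s : (N <= M)%N -> Q N s -> E N s = E M s.
  move=> NM Qs; have H : forall w, Q N w -> loc_cst (fun w => E M w (+) E N w) w.
    move=> w Qw; apply: P_diff; first exact: (HE N).1.
    exact: ((HE M).1 w (QS _ _ _ NM Qw)).
  have Q0 : Q N 0 by rewrite /Q /box /= oppr_le0 ler0n.
  have := box_connected H Qs Q0; rewrite (HE N).2 (HE M).2.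
  by case: (E M s) (E N s) => [] [].
pose K s := (Num.truncn (`|complex.Re s| + `|complex.Im s|)).+1.
have QK s N : (K s <= N)%N -> Q N s.
  move=> KN; apply: QS KN _.
  have : `|complex.Re s| + `|complex.Im s| < (K s)%:R by rewrite /K truncnS_gt.
  move=> H; have h1 := normr_ge0 (complex.Re s); have h2 := normr_ge0 (complex.Im s).
  rewrite /Q /box /= -!ler_norml; apply/andP; split; lra.
exists (fun w => E (K w) w) => s.
apply: (P_sign (b := false) (e := E (K s).+1)); last first.
  by apply: (HE _).1; apply: QK.
apply/nbhsC_near2; exists 1 => // x y hx hy /=.
have Qw : Q (K s).+1 (x +i* y).
  have /andP[] := QK s (K s) (leqnn _); rewrite /Q /box /= -!ler_norml => k1 k2.
  have e1 : `|x| < `|complex.Re s| + 1.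
    rewrite -(subrK (complex.Re s) x) (le_lt_trans (ler_normD _ _))// addrC; lra.
  have e2 : `|y| < `|complex.Im s| + 1.
    rewrite -(subrK (complex.Im s) y) (le_lt_trans (ler_normD _ _))// addrC; lra.
  by rewrite -natr1; apply/andP; split; lra.
rewrite /= (EE (K (x +i* y)) (maxn (K (x +i* y)) (K s).+1)) ?leq_maxl//; last exact: QK.
by rewrite (EE (K s).+1 (maxn (K (x +i* y)) (K s).+1)) ?leq_maxr.
Qed.

End Sign.
End Monodromy.

Section GlobalLog.
Context {R : realType}.
Local Notation C := R[i].
Implicit Types (f g : C -> C) (z w : C).

Lemma rectT : rect setT setT = [set: C].
Proof. by apply/seteqP; split=> // z. Qed.

Lemma is_intervalT : is_interval [set: R]. Proof. by []. Qed.

Lemma primitiveT f : holomorphic_on setT f ->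
  exists2 F, holomorphic_on setT F & forall z, dz F z = f z.
Proof.
move=> hf; have := @primitive R setT setT f 0 openT is_intervalT openT is_intervalT.
by rewrite rectT => /(_ I hf)[F hF dF]; exists F => // z; exact: dF.
Qed.

Lemma holo_rootT n f : holomorphic_on setT f -> (forall z, f z != 0) ->
  exists h, [/\ holomorphic_on setT h, forall z, h z != 0 & forall z, h z ^+ n.+1 = f z].
Proof.
move=> hf f0; have := @holo_log R setT setT f 0 openT is_intervalT openT is_intervalT.
rewrite rectT => /(_ I hf (fun z _ => f0 z))[L hL EL].
exists (@cexp R \o (fun z => n.+1%:R^-1 * L z)); split.
- apply: (holo_comp openT openT) (holo_cexp openT) _ => //.
  exact: (holoM openT (holo_cst _ openT) hL).
- by move=> z; exact: cexp_neq0.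
- move=> z; rewrite /= -cexpMn -mulrnAl -[_^-1 *+ _]mulr_natr mulVf ?mul1r ?pnatr_eq0//.
  exact: EL.
Qed.

Lemma holo_log_local (U : set C) f c : open (U : set C^o) -> U c ->
  holomorphic_on U f -> f c != 0 ->
  exists (V : set C) (L : C -> C), [/\ open (V : set C^o), V c, V `<=` U,
    holomorphic_on V L & forall z, V z -> cexp (L z) = f z].
Proof.
move=> oU Uc hf fc.
have : \forall w \near (c : C^o), U w /\ f w != 0.
  have cf := Ck0 (hf.1 0%N) Uc.
  have h1 : \forall w \near (c : C^o), U w by exact: open_near oU Uc _.
  have h2 : \forall w \near (c : C^o), f w != 0.
    by apply: (cf [set w | w != 0]); apply: (open_near (@open_neq0 R) fc).
  by apply: filterS2 h1 h2.
move=> /nbhsC_near2[d d0 H].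
pose A := [set x : R | `|x - complex.Re c| < d]; pose B := [set x : R | `|x - complex.Im c| < d].
have oI (a : R) : open [set x : R | `|x - a| < d].
  rewrite (_ : [set _ | _] = ball a d); first exact: ball_open.
  by apply/seteqP; split=> x; rewrite /ball /= distrC.
have iI (a : R) : is_interval [set x : R | `|x - a| < d].
  move=> x y /= hx hy z /andP[xz zy]; move: hx hy; rewrite !ltr_distl.
  move=> /andP[h1 h2] /andP[h3 h4]; apply/andP; split; lra.
have sub : rect A B `<=` [set w | U w /\ f w != 0].
  by move=> [x y] [/= hx hy]; exact: H.
have Rc : rect A B c by split; [rewrite /A|rewrite /B]; rewrite /= subrr normr0.
have [L hL EL] := holo_log (oI _) (iI _) (oI _) (iI _) Rc (holo_sub (fun z h => (sub z h).1) hf) (fun z h => (sub z h).2).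
exists (rect A B), L; split=> //.
- exact: open_rect (oI _) (oI _).
- by move=> z /sub[].
Qed.

End GlobalLog.

(** * Linear algebra in one fibre *)

Section LinearMaps.
Variables (K : fieldType) (V : vectType K) (f : V -> V).
Hypothesis flin : forall c a b, f (c *: a + b) = c *: f a + f b.

Lemma lin_fun0 : f 0 = 0.
Proof.
have := flin 1 0 0; rewrite !scale1r addr0 => /eqP.
by rewrite -subr_eq0 opprD addrA subrr sub0r oppr_eq0 => /eqP.
Qed.

Lemma lin_funZ c a : f (c *: a) = c *: f a.
Proof. by have := flin c a 0; rewrite !addr0 lin_fun0 addr0. Qed.

Lemma lin_fun_sum (I : Type) (r : seq I) (P : pred I) (F : I -> V) (k : I -> K) :
  f (\sum_(i <- r | P i) k i *: F i) = \sum_(i <- r | P i) k i *: f (F i).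
Proof.
elim: r => [|i r IH]; first by rewrite !big_nil lin_fun0.
by rewrite !big_cons; case: ifP => // _; rewrite flin IH.
Qed.

Lemma iter_lin j c a b : iter j f (c *: a + b) = c *: iter j f a + iter j f b.
Proof. by elim: j => //= j ->; rewrite flin. Qed.

End LinearMaps.

Section Forms.
Context {R : realType}.
Local Notation C := R[i].
Variables (V : vectType C) (et g : V -> V -> C).
Hypothesis etlin : forall c a a' b, et (c *: a + a') b = c * et a b + et a' b.
Hypothesis etC : forall a b, et a b = et b a.
Hypothesis glin : forall c a b b', g a (c *: b + b') = c * g a b + g a b'.
Hypothesis gC : forall a b, g b a = conjc (g a b).

Lemma g0r a : g a 0 = 0.
Proof.
have := glin 1 a 0 0; rewrite scale1r addr0 mul1r => /eqP.
by rewrite -subr_eq0 opprD addrA subrr sub0r oppr_eq0 => /eqP.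
Qed.

Lemma gZr c a b : g a (c *: b) = c * g a b.
Proof. by have := glin c a b 0; rewrite !addr0 g0r addr0. Qed.

Lemma gZl c a b : g (c *: a) b = conjc c * g a b.
Proof. by rewrite gC gZr rmorphM /= -gC. Qed.

Lemma et0l a : et 0 a = 0.
Proof.
have := etlin 1 0 0 a; rewrite scale1r addr0 mul1r => /eqP.
by rewrite -subr_eq0 opprD addrA subrr sub0r oppr_eq0 => /eqP.
Qed.

Lemma etZl c a b : et (c *: a) b = c * et a b.
Proof. by have := etlin c a 0 b; rewrite !addr0 et0l addr0. Qed.

Lemma etZr c a b : et a (c *: b) = c * et a b.
Proof. by rewrite etC etZl etC. Qed.

Lemma g_sumr (I : Type) (r : seq I) (P : pred I) (F : I -> V) (k : I -> C) a :
  g a (\sum_(i <- r | P i) k i *: F i) = \sum_(i <- r | P i) k i * g a (F i).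
Proof.
elim: r => [|i r IH]; first by rewrite !big_nil g0r.
by rewrite !big_cons; case: ifP => // _; rewrite glin IH.
Qed.

Lemma et_suml (I : Type) (r : seq I) (P : pred I) (F : I -> V) (k : I -> C) a :
  et (\sum_(i <- r | P i) k i *: F i) a = \sum_(i <- r | P i) k i * et (F i) a.
Proof.
elim: r => [|i r IH]; first by rewrite !big_nil et0l.
by rewrite !big_cons; case: ifP => // _; rewrite etlin IH.
Qed.

End Forms.

(** [om] stands for [omega], and [M] for [Phi_X] with a nonzero tangent vector [X]. *)
Record fibre_spec (R : realType) (n : nat) (om : R[i]) (V : vectType R[i])
    (T M : V -> V) (et g : V -> V -> R[i]) : Prop := FibreSpec {
  fs_prim : n.+1.-primitive_root om;
  fs_dim : \dim {:V} = n.+1;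
  fs_Tlin : forall c a b, T (c *: a + b) = c *: T a + T b;
  fs_Mlin : forall c a b, M (c *: a + b) = c *: M a + M b;
  fs_etlin : forall c a a' b, et (c *: a + a') b = c * et a b + et a' b;
  fs_etC : forall a b, et a b = et b a;
  fs_et_nd : forall a, (forall b, et a b = 0) -> a = 0;
  fs_glin : forall c a b b', g a (c *: b + b') = c * g a b + g a b';
  fs_gC : forall a b, g b a = conjc (g a b);
  fs_gpos : forall a, a != 0 -> 0 < g a a;
  fs_Minj : forall v, v != 0 -> M v != 0;
  fs_TM : forall a, T (M a) = om *: M (T a);
  fs_etT : forall a b, et a b = et (T a) (T b);
  fs_gT : forall a b, g a b = g (T a) (T b);
  fs_etM : forall a b, et (M a) b = et a (M b)
}.

Section Fibre.
Context {R : realType}.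
Local Notation C := R[i].
Variables (n : nat) (om : C) (V : vectType C) (T M : V -> V) (et g : V -> V -> C).
Local Notation N := n.+1.
Hypothesis spec : fibre_spec n om T M et g.
Let om_prim := fs_prim spec.
Let dimV := fs_dim spec.
Let Tlin := fs_Tlin spec.
Let Mlin := fs_Mlin spec.
Let etlin := fs_etlin spec.
Let etC := fs_etC spec.
Let et_nd := fs_et_nd spec.
Let glin := fs_glin spec.
Let gC := fs_gC spec.
Let gpos := fs_gpos spec.
Let Minj := fs_Minj spec.
Let TM := fs_TM spec.
Let etT := fs_etT spec.
Let gT := fs_gT spec.
Let etM := fs_etM spec.
Let g0r := g0r glin.
Let gZr := gZr glin.
Let gZl := gZl glin gC.
Let et0l := et0l etlin.
Let etZl := etZl etlin.
Let etZr := etZr etlin etC.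

Lemma iterM_neq0 j v : v != 0 -> iter j M v != 0.
Proof. by move=> v0; elim: j => //= j; exact: Minj. Qed.

Lemma T_iterM j v mu : T v = mu *: v -> T (iter j M v) = (om ^+ j * mu) *: iter j M v.
Proof.
move=> Tv; elim: j => [|j IH] /=; first by rewrite expr0 mul1r.
by rewrite TM IH (lin_funZ Mlin) scalerA exprS mulrA.
Qed.

Lemma etM_iter i j a b : et (iter i M a) (iter j M b) = et a (iter (i + j) M b).
Proof.
by elim: i j => [|i IH] j //=; rewrite etM -iterS IH addnS.
Qed.

Lemma g_eigen a b al be : T a = al *: a -> T b = be *: b -> a != 0 -> al != be -> g a b = 0.
Proof.
move=> Ta Tb a0 ab; have := gT a a; rewrite Ta gZl gZr mulrA => /eqP.
have ga : g a a != 0 by rewrite gt_eqF// gpos.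
rewrite -{1}[g a a]mul1r (inj_eq (mulIf ga)) => /eqP al1.
have := gT a b; rewrite Ta Tb gZl gZr mulrA => /eqP.
rewrite -subr_eq0 -{1}[g a b]mul1r -mulrBl mulf_eq0 => /orP[|/eqP//].
rewrite {1}al1 -mulrBr mulf_eq0 => /orP[|].
  by move=> /eqP H; move: al1; rewrite H mul0r => /eqP; rewrite oner_eq0.
by rewrite subr_eq0 (negPf ab).
Qed.

Lemma et_eigen a b al be : T a = al *: a -> T b = be *: b -> al * be != 1 -> et a b = 0.
Proof.
move=> Ta Tb ab; have := etT a b; rewrite Ta Tb etZl etZr mulrA => /eqP.
rewrite -subr_eq0 -{1}[et a b]mul1r -mulrBl mulf_eq0 => /orP[|/eqP//].
by rewrite subr_eq0 eq_sym (negPf ab).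
Qed.

Section Eigenvector.
Variables (v : V) (mu : C).
Hypotheses (v0 : v != 0) (Tv : T v = mu *: v).

Lemma mu_neq0 : mu != 0.
Proof.
apply/eqP => m0; have := gT v v; rewrite Tv m0 scale0r g0r => /eqP.
by rewrite gt_eqF ?gpos.
Qed.

Lemma om_inj i j : (i < N)%N -> (j < N)%N -> i != j -> om ^+ i * mu != om ^+ j * mu.
Proof.
move=> iN jN; apply: contra => /eqP/(mulIf mu_neq0)/eqP.
by rewrite (eq_prim_root_expr om_prim) !modn_small.
Qed.

Lemma g_iter_neq i j : (i < N)%N -> (j < N)%N -> i != j -> g (iter i M v) (iter j M v) = 0.
Proof.
move=> iN jN ij; apply: (g_eigen (T_iterM i Tv) (T_iterM j Tv)); first exact: iterM_neq0.
exact: om_inj.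
Qed.

Lemma nth_map_enum (F : 'I_N -> V) (i : 'I_N) : [seq F j | j <- enum 'I_N]`_i = F i.
Proof. by rewrite (nth_map i) ?size_enum_ord// nth_ord_enum. Qed.

Lemma iter_basis (c : nat -> C) : (forall j, c j != 0) ->
  basis_of fullv [tuple c j *: iter j M v | j < N].
Proof.
move=> c0; rewrite basisEfree subvf size_tuple dimV leqnn andbT /= andbT.
apply/(@freeP C V N [tuple c j *: iter j M v | j < N]) => k Hk i.
have := congr1 (g (iter i M v)) Hk; rewrite g0r (g_sumr glin) (bigD1 i)//= big1 ?addr0.
  rewrite nth_map_enum gZr => /eqP; rewrite !mulf_eq0 (negPf (c0 i)) /=.
  by rewrite [g _ _ == 0]gt_eqF ?gpos ?iterM_neq0// orbF => /eqP.
move=> j ji; rewrite nth_map_enum gZr g_iter_neq ?mulr0//.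
by rewrite eq_sym.
Qed.

Lemma iter_expand x : exists c : 'I_N -> C, x = \sum_(j < N) c j *: iter j M v.
Proof.
have B := iter_basis (c := fun=> 1) (fun=> oner_neq0 _).
exists (fun j => coord [tuple 1 *: iter j M v | j < N] j x).
rewrite {1}(coord_basis B (memvf x)); apply: eq_bigr => j _.
by rewrite -tnth_nth tnth_mktuple scale1r.
Qed.

Lemma eigenspace_line j x : (j < N)%N -> T x = (om ^+ j * mu) *: x ->
  exists c, x = c *: iter j M v.
Proof.
move=> jN Tx; have [c xE] := iter_expand x.
exists (c (Ordinal jN)); rewrite {1}xE (bigD1 (Ordinal jN))//= big1 ?addr0// => i ij.
have : g (iter i M v) x = 0.
  have ij' : (i : nat) != j by [].
  apply: (g_eigen (T_iterM i Tv) Tx); first exact: iterM_neq0.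
  exact: om_inj.
rewrite xE (g_sumr glin) (bigD1 i)//= big1 ?addr0; last first.
  by move=> k ki; rewrite g_iter_neq ?mulr0// eq_sym.
move=> /eqP; rewrite mulf_eq0 [g _ _ == 0]gt_eqF ?gpos ?iterM_neq0// orbF => /eqP ->.
by rewrite scale0r.
Qed.

Lemma om_expN : om ^+ N = 1.
Proof. exact: prim_expr_order. Qed.

Lemma iterN_T x : iter N T x = mu ^+ N *: x.
Proof.
have [c ->] := iter_expand x.
rewrite (lin_fun_sum (iter_lin Tlin N)) scaler_sumr; apply: eq_bigr => j _.
rewrite scalerA mulrC -scalerA; congr (_ *: _).
have H k : iter k T (iter j M v) = (om ^+ j * mu) ^+ k *: iter j M v.
  elim: k => [|k IH]; first by rewrite expr0 scale1r.
  by rewrite iterS IH (lin_funZ Tlin) (T_iterM j Tv) scalerA exprS mulrC.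
by rewrite H exprMn exprAC om_expN expr1n mul1r.
Qed.

Lemma mu_sign : mu ^+ N = 1 \/ mu ^+ N = -1.
Proof.
have [b bE] : exists b, et v b != 0.
  apply/not_existsP => H; move/eqP: v0; apply; apply: et_nd => b.
  by apply/eqP/negPn/negP; exact: H.
have [j /eqP jE] : exists j : 'I_N, et v (iter j M v) != 0.
  apply/not_existsP => H; move/eqP: bE; apply; have [c ->] := iter_expand b.
  rewrite etC (et_suml etlin) big1// => j _; rewrite etC.
  by have /negP/negPn/eqP -> := H j; rewrite mulr0.
have : mu * (om ^+ j * mu) == 1.
  by apply/negPn/negP => K; apply: jE; exact: et_eigen Tv (T_iterM j Tv) K.
move=> /eqP/(congr1 (fun x => x ^+ N)); rewrite expr1n !exprMn exprAC om_expN expr1n mul1r.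
move=> /eqP; rewrite -expr2 -subr_eq0 subr_sqr_1 mulf_eq0 subr_eq0 addr_eq0.
by move=> /orP[/eqP|/eqP]; [left|right].
Qed.

Lemma iterN_M : exists2 p, p != 0 & forall x, iter N M x = p *: x.
Proof.
have TN : T (iter N M v) = mu *: iter N M v.
  by rewrite (T_iterM N Tv) om_expN mul1r.
have [|p pE] := @eigenspace_line 0 (iter N M v) (ltn0Sn _).
  by rewrite TN expr0 mul1r.
exists p.
  by apply: contraNneq (iterM_neq0 N v0) => p0; rewrite pE p0 scale0r.
move=> x; have [c ->] := iter_expand x.
rewrite (lin_fun_sum (iter_lin Mlin N)) scaler_sumr; apply: eq_bigr => j _.
rewrite scalerA mulrC -scalerA; congr (_ *: _).
by rewrite -iterD addnC iterD pE /= (lin_funZ (iter_lin Mlin j)).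
Qed.

End Eigenvector.

Lemma eigen_exists : exists v mu, v != 0 /\ T v = mu *: v.
Proof.
have [b bB] : exists b : N.-tuple V, basis_of fullv b.
  by move: (vbasis {:V}) (vbasisP {:V}); rewrite dimV => b bB; exists b.
pose A : 'M[C]_N := \matrix_(i < N, j < N) coord b j (T b`_i).
have Texp x : T x = \sum_(j < N) coord b j (T x) *: b`_j.
  exact: coord_basis bB (memvf (T x)).
have [a /eigenvalueP[u uA u0]] : exists a, eigenvalue A a.
  have : size (char_poly A) != 1 by rewrite size_char_poly.
  by move=> /closed_rootP[a ra]; exists a; rewrite eigenvalue_root_char.
exists (\sum_(i < N) u 0 i *: b`_i), a; split.
  apply/negP => /eqP s0; move/negP: u0; apply; apply/eqP/rowP => i; rewrite mxE.
  have /freeP := basis_free bB; move=> /(_ (fun j => u 0 j)) H.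
  by rewrite (H s0 i).
rewrite (lin_fun_sum Tlin) scaler_sumr.
under eq_bigr => i _ do rewrite Texp scaler_sumr.
rewrite exchange_big /=; apply: eq_bigr => j _.
have := congr1 (fun m : 'rV_N => m 0 j) uA; rewrite !mxE => E.
rewrite scalerA -E scaler_suml; apply: eq_bigr => i _.
by rewrite scalerA !mxE.
Qed.

Lemma sign_exists : exists sg : bool, forall x, iter N T x = (-1) ^+ sg *: x.
Proof.
have [v [mu [v0 Tv]]] := eigen_exists.
have [E|E] := mu_sign v0 Tv; [exists false|exists true] => x.
  by rewrite (iterN_T v0 Tv) E.
by rewrite (iterN_T v0 Tv) E expr1.
Qed.

Lemma scalar_exists : exists2 p, p != 0 & forall x, iter N M x = p *: x.
Proof. by have [v [mu [v0 Tv]]] := eigen_exists; exact: iterN_M v0 Tv. Qed.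

Lemma eigen_lambda la : (forall x, iter N T x = la ^+ N *: x) ->
  exists2 x, x != 0 & T x = la *: x.
Proof.
move=> TN; have [v [mu [v0 Tv]]] := eigen_exists.
have mu0 := mu_neq0 v0 Tv.
have laN : la ^+ N = mu ^+ N.
  have := iterN_T v0 Tv v; rewrite TN => /eqP.
  by rewrite -subr_eq0 -scalerBl scaler_eq0 (negPf v0) orbF subr_eq0 => /eqP.
have [j E] : exists j : 'I_N, la / mu = om ^+ j.
  have /(prim_rootP om_prim)[j ->] : (la / mu) ^+ N = 1.
    by rewrite expr_div_n laN divff// expf_neq0.
  by exists j.
exists (iter j M v); first exact: iterM_neq0.
by rewrite (T_iterM j Tv) -E divfK.
Qed.

Section Adapted.
Variables (la : C) (k : nat).
Hypotheses (kN : (k < N)%N) (lak : la * la * om ^+ k = 1).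

(** Such an [x] is unique up to a sign when [h] is given. *)
Definition adapted (x : V) (h : C) :=
  [/\ T x = la *: x, forall y, iter N M y = h ^+ N *: y & et x (iter k M x) = h ^+ k].

Definition aframe (x : V) (h : C) (j : nat) : V := (h ^+ j)^-1 *: iter j M x.

Lemma pairing_eq0 x j : T x = la *: x -> (j %% N != k)%N -> et x (iter j M x) = 0.
Proof.
move=> Tx jk; apply: (et_eigen Tx (T_iterM j Tx)); apply: contra jk => /eqP E.
have la0 : la != 0.
  by apply: contra_eq_neq E => ->; rewrite mul0r eq_sym oner_eq0.
have : om ^+ j == om ^+ k.
  rewrite -(inj_eq (mulfI (mulf_neq0 la0 la0))) lak -[X in _ == X]E.
  by rewrite mulrAC mulrA.
by rewrite (eq_prim_root_expr om_prim) (modn_small kN).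
Qed.

Lemma pairing_neq0 x : x != 0 -> T x = la *: x -> et x (iter k M x) != 0.
Proof.
move=> x0 Tx; apply: contra_neq x0 => E; apply: et_nd => b.
have [x0|x0] := eqVneq x 0; first by rewrite x0 et0l.
have [c ->] := iter_expand x0 Tx b.
rewrite etC (et_suml etlin) big1// => j _; rewrite etC.
have [jk|jk] := eqVneq (j : nat) k; first by rewrite jk E mulr0.
by rewrite (pairing_eq0 Tx) ?mulr0// modn_small.
Qed.

Section AdaptedVector.
Variables (x : V) (h : C).
Hypotheses (h0 : h != 0) (ad : adapted x h).

Lemma adapted_neq0 : x != 0.
Proof.
case: ad => _ _ E; apply: contraTneq (expf_neq0 k h0) => z0.
by rewrite -E z0 et0l eqxx.
Qed.

Lemma aframe_basis : basis_of fullv [tuple aframe x h j | j < N].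
Proof.
have [Tx _ _] := ad.
have := iter_basis adapted_neq0 Tx (c := fun j => (h ^+ j)^-1).
by apply=> j; rewrite invr_eq0 expf_neq0.
Qed.

Lemma aframe_M j : M (aframe x h j) = h *: aframe x h j.+1.
Proof.
rewrite /aframe (lin_funZ Mlin) iterS scalerA; congr (_ *: _).
by rewrite exprS invfM mulrA mulfV// mul1r.
Qed.

Lemma aframe_N : aframe x h N = aframe x h 0.
Proof.
have [_ MN _] := ad.
by rewrite /aframe MN scalerA mulVf ?expf_neq0// expr0 invr1.
Qed.

Lemma aframe_et i j : (i < N)%N -> (j < N)%N ->
  et (aframe x h i) (aframe x h j) = ((i + j) %% N == k)%N%:R.
Proof.
move=> iN jN; have [Tx MN E] := ad.
rewrite /aframe etZl etZr etM_iter mulrA -invfM -exprD.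
case: eqP => [ijk|/eqP ijk]; last by rewrite (pairing_eq0 Tx ijk) mulr0.
have [lt|ge] := ltnP (i + j) N.
  by rewrite modn_small// in ijk; rewrite ijk E mulVf// expf_neq0.
have ijE : (i + j = k + N)%N.
  have lt2 : (i + j - N < N)%N by rewrite ltn_subLR// -addnS leq_add// ltnW.
  by move: ijk; rewrite -{1}(subnK ge) modnDr modn_small// => <-; rewrite subnK.
rewrite ijE [in iter _ _ _]addnC iterD MN etZr E exprD mulrC -mulrA [X in _ * X](_ : _ = (h ^+ N)^-1).
  by rewrite mulfV// expf_neq0.
by rewrite invfM mulrA mulfV ?mul1r// expf_neq0.
Qed.

Lemma aframe_g i j : (i < N)%N -> (j < N)%N -> i != j -> g (aframe x h i) (aframe x h j) = 0.
Proof.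
move=> iN jN ij; have [Tx _ _] := ad.
by rewrite /aframe gZl gZr (g_iter_neq adapted_neq0 Tx)// !mulr0.
Qed.

Lemma aframe_neq0 j : aframe x h j != 0.
Proof.
by rewrite scaler_eq0 invr_eq0 expf_eq0 (negPf h0) andbF /= iterM_neq0// adapted_neq0.
Qed.

Lemma aframe_expand y : exists c : 'I_N -> C, y = \sum_(j < N) c j *: aframe x h j.
Proof.
have [Tx _ _] := ad; have [c ->] := iter_expand adapted_neq0 Tx y.
exists (fun j => c j * h ^+ j); apply: eq_bigr => j _.
by rewrite /aframe scalerA mulfK// expf_neq0.
Qed.

Lemma aframe_real (kappa : V -> V) i j :
  (forall a b, g a b = et (kappa a) b) -> (forall a, kappa (kappa a) = a) ->
  (forall c a b, kappa (c *: a + b) = conjc c *: kappa a + kappa b) ->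
  (i < N)%N -> (j < N)%N -> ((i + j) %% N = k)%N ->
  g (aframe x h i) (aframe x h i) * g (aframe x h j) (aframe x h j) = 1.
Proof.
move=> gk kk klin iN jN ijk.
have k0 : kappa 0 = 0.
  have := klin 1 0 0; rewrite conjc1 !scale1r addr0 => /eqP.
  by rewrite -subr_eq0 opprD addrA subrr sub0r oppr_eq0 => /eqP.
have kZ c a : kappa (c *: a) = conjc c *: kappa a by have := klin c a 0; rewrite !addr0 k0 addr0.
have key p q : (p < N)%N -> (q < N)%N -> ((p + q) %% N = k)%N ->
    kappa (aframe x h p) = g (aframe x h p) (aframe x h p) *: aframe x h q.
  move=> pN qN pqk; apply/eqP; rewrite -subr_eq0; apply/eqP; apply: et_nd => b.
  have [c ->] := aframe_expand b; rewrite etC (et_suml etlin) big1// => m _.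
  rewrite etC (_ : et _ _ = 0) ?mulr0//.
  rewrite addrC -scaleN1r etlin -gk etZl aframe_et//.
  have [mp|mp] := eqVneq (m : nat) p.
    by rewrite mp addnC pqk eqxx mulr1 mulN1r addNr.
  have pm : p != m by rewrite eq_sym.
  rewrite (aframe_g pN (ltn_ord m) pm) addr0 (_ : _ == k = false) ?mulr0//.
  apply/negbTE; apply: contra mp => /eqP; rewrite -pqk (addnC p) => /eqP.
  by rewrite eqn_modDl !modn_small.
have gr a : conjc (g a a) = g a a by rewrite -gC.
have := kk (aframe x h i); rewrite (key i j)// kZ gr (key j i) 1?addnC// scalerA => /eqP.
rewrite -[X in _ == X]scale1r -subr_eq0 -scalerBl scaler_eq0 (negPf (aframe_neq0 i)) orbF.
by rewrite subr_eq0 => /eqP.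
Qed.

End AdaptedVector.

Lemma norm_expr_inj (a b : C) m : (0 < m)%N -> `|a| ^+ m = `|b| ^+ m -> `|a| = `|b|.
Proof. by move=> m0 /eqP; rewrite eqrXn2// => /eqP. Qed.

Lemma adapted_line x h x' h' : h != 0 -> adapted x h -> adapted x' h' ->
  exists c, x' = c *: x /\ c ^+ 2 * h ^+ k = h' ^+ k.
Proof.
move=> h0 ad [Tx' _ E']; have x0 := adapted_neq0 h0 ad; have [Tx _ E] := ad.
have [|c cE] := @eigenspace_line x la x0 Tx 0 x' (ltn0Sn _).
  by rewrite expr0 mul1r.
exists c; split=> //.
by rewrite -E' cE (lin_funZ (iter_lin Mlin k)) /= etZl etZr E mulrA expr2.
Qed.

Lemma adapted_sign x x' h : h != 0 -> adapted x h -> adapted x' h ->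
  exists b : bool, x' = (-1) ^+ b *: x.
Proof.
move=> h0 ad ad'; have [c [-> /eqP]] := adapted_line h0 ad ad'.
rewrite -subr_eq0 -{2}[h ^+ k]mul1r -mulrBl mulf_eq0 expf_eq0 (negPf h0) andbF orbF.
rewrite subr_sqr_1 mulf_eq0 subr_eq0 addr_eq0 => /orP[/eqP->|/eqP->].
  by exists false; rewrite expr0.
by exists true; rewrite expr1.
Qed.

Lemma adaptedN x h (b : bool) : adapted x h -> adapted ((-1) ^+ b *: x) h.
Proof.
move=> [Tx MN E]; split=> //; first by rewrite (lin_funZ Tlin) Tx !scalerA mulrC.
by rewrite (lin_funZ (iter_lin Mlin k)) etZl etZr E mulrA -expr2 sqrr_sign mul1r.
Qed.

(** The two scalars are roots of the same [M^(n+1)]: this makes [w] independent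
    of the sheet of the universal covering. *)
Lemma adapted_metric x h x' h' j : h != 0 -> h' != 0 -> adapted x h -> adapted x' h' ->
  g (aframe x' h' j) (aframe x' h' j) = g (aframe x h j) (aframe x h j).
Proof.
move=> h0 h0' ad ad'; have [c [-> cE]] := adapted_line h0 ad ad'.
have x0 := adapted_neq0 h0 ad.
have nh : `|h'| = `|h|.
  apply: (@norm_expr_inj _ _ N) => //; rewrite -!normrX.
  case: ad ad' => _ MN _ [_ MN' _].
  have := MN' x; rewrite MN => /eqP.
  by rewrite -subr_eq0 -scalerBl scaler_eq0 (negPf x0) orbF subr_eq0 => /eqP ->.
have nc : `|c| = 1.
  apply/eqP; rewrite -(@eqrXn2 _ 2)// ?normr_ge0// expr1n -normrX.
  have := congr1 Num.Def.normr cE; rewrite normrM !normrX nh => /eqP.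
  by rewrite -subr_eq0 -{2}[`|h| ^+ k]mul1r -mulrBl mulf_eq0 expf_eq0 normr_eq0 (negPf h0) andbF orbF subr_eq0.
have ng (a : C) y : g (a *: y) (a *: y) = `|a| ^+ 2 * g y y.
  by rewrite gZl gZr mulrA normCK [conjc a * a]mulrC.
rewrite /aframe (lin_funZ (iter_lin Mlin j)) scalerA !ng; congr (_ ^+ 2 * _).
by rewrite normrM nc mulr1 !normfV !normrX nh.
Qed.

End Adapted.

End Fibre.

(** * The tt*-equation in an adapted frame *)

Section MatrixCalculus.
Context {R : realType}.
Local Notation C := R[i].
Implicit Types (z w s : C) (U V : set C).

Lemma isW_sum (I : Type) (r : seq I) (P : pred I) (F : I -> C -> C) (a b : I -> C) z :
  (forall i, isW (F i) z (a i) (b i)) ->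
  isW (fun u => \sum_(i <- r | P i) F i u) z (\sum_(i <- r | P i) a i) (\sum_(i <- r | P i) b i).
Proof.
move=> H; elim: r => [|i r IH].
  rewrite !big_nil (_ : (fun u => _) = (fun=> 0)); first exact: isW_cst.
  by apply/funext => u; rewrite big_nil.
rewrite !big_cons; case Pi : (P i).
  rewrite (_ : (fun u => _) = (fun u => F i u + \sum_(j <- r | P j) F j u)); first exact: isW_D.
  by apply/funext => u; rewrite big_cons Pi.
rewrite (_ : (fun u => _) = (fun u => \sum_(j <- r | P j) F j u)) //.
by apply/funext => u; rewrite big_cons Pi.
Qed.

Variable r : nat.
Implicit Types (F G A B : C -> 'M[C]_r) (Fa Fb Ga Gb : 'M[C]_r).

Definition isWm F z Fa Fb := forall i j, isW (fun u => F u i j) z (Fa i j) (Fb i j).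

Lemma isWm_val F z Fa Fb : isWm F z Fa Fb -> dz_mx F z = Fa /\ dzbar_mx F z = Fb.
Proof. by move=> H; split; apply/matrixP => i j; rewrite mxE; have [] := isW_val (H i j). Qed.

Lemma isWm_D F G z Fa Fb Ga Gb : isWm F z Fa Fb -> isWm G z Ga Gb ->
  isWm (fun u => F u + G u) z (Fa + Ga) (Fb + Gb).
Proof.
move=> HF HG i j; rewrite !mxE; under eq_fun do rewrite mxE; exact: isW_D.
Qed.

Lemma isWm_M F G z Fa Fb Ga Gb : isWm F z Fa Fb -> isWm G z Ga Gb ->
  isWm (fun u => F u *m G u) z (Fa *m G z + F z *m Ga) (Fb *m G z + F z *m Gb).
Proof.
move=> HF HG i j; rewrite !mxE -!big_split /=; under eq_fun do rewrite mxE.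
by apply: isW_sum => k; exact: isW_M.
Qed.

Lemma isWm_scale (c : C -> C) F z a b Fa Fb : isW c z a b -> isWm F z Fa Fb ->
  isWm (fun u => c u *: F u) z (a *: F z + c z *: Fa) (b *: F z + c z *: Fb).
Proof.
move=> Hc HF i j; rewrite !mxE; under eq_fun do rewrite mxE; exact: isW_M.
Qed.

Definition adj (X : 'M[C]_r) : 'M[C]_r := (map_mx conjc X)^T.

Lemma adjM (X Y : 'M[C]_r) : adj (X *m Y) = adj Y *m adj X.
Proof. by rewrite /adj map_mxM trmx_mul. Qed.

Lemma adj0 : adj 0 = 0.
Proof. by apply/matrixP => i j; rewrite !mxE conjc0. Qed.

Lemma isWm_adj F z Fa Fb : isWm F z Fa Fb -> isWm (fun u => adj (F u)) z (adj Fb) (adj Fa).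
Proof.
move=> HF i j; rewrite !mxE; under eq_fun do rewrite !mxE; exact: isW_conj.
Qed.

Lemma isWm_near F G z Fa Fb : (\forall w \near (z : C^o), F w = G w) ->
  isWm F z Fa Fb -> isWm G z Fa Fb.
Proof. by move=> FG HF i j; apply: isW_near (HF i j); apply: filterS FG => w ->. Qed.

Definition smooth_mx U F := forall i j, smooth_on U (fun u => F u i j).

Definition holo_mx U F := forall i j, holomorphic_on U (fun u => F u i j).

Lemma smooth_isWm U F z : smooth_mx U F -> U z -> isWm F z (dz_mx F z) (dzbar_mx F z).
Proof. by move=> sF Uz i j; rewrite !mxE; exact: smooth_isW (sF i j) Uz. Qed.

Lemma holo_isWm U F z : holo_mx U F -> U z -> isWm F z (dz_mx F z) 0.
Proof. by move=> hF Uz i j; rewrite !mxE; exact: holo_isW (hF i j) Uz. Qed.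

Lemma isWm_comp U F z : open (U : set C^o) -> smooth_mx U F -> U (cexp z) ->
  isWm (fun u => F (cexp u)) z (cexp z *: dz_mx F (cexp z)) (conjc (cexp z) *: dzbar_mx F (cexp z)).
Proof.
move=> oU sF Uz i j; rewrite !mxE.
have := isW_comp oU (sF i j 1%N) Uz (isW_cexp z).
by rewrite conjc0 !mul0r addr0 add0r.
Qed.

Lemma smooth_mxM U F G : open (U : set C^o) -> smooth_mx U F -> smooth_mx U G ->
  smooth_mx U (fun u => F u *m G u).
Proof.
move=> oU sF sG i j; apply: (smooth_ext (f := fun u => \sum_k F u i k * G u k j)) => //.
  by move=> u _; rewrite mxE.
by apply: smooth_sum => // k; exact: smoothM oU (sF _ _) (sG _ _).
Qed.

Lemma smooth_dz_mx U F : open (U : set C^o) -> smooth_mx U F -> smooth_mx U (dz_mx F).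
Proof.
move=> oU sF i j; apply: (smooth_ext (f := dz (fun u => F u i j))) => //.
  by move=> u _; rewrite mxE.
exact: smooth_dz oU (sF i j).
Qed.

End MatrixCalculus.

Section Determinant.
Context {R : realType}.
Local Notation C := R[i].

Lemma smooth_det (U : set C) m (F : C -> 'M[C]_m) : open (U : set C^o) -> smooth_mx U F ->
  smooth_on U (fun u => \det (F u)).
Proof.
move=> oU sF; apply: smooth_sum => // s; apply: smoothM => //; first exact: smooth_cst.
by apply: smooth_prod => // i; exact: sF.
Qed.

Lemma smooth_invmx (U : set C) m (F : C -> 'M[C]_m) : open (U : set C^o) -> smooth_mx U F ->
  (forall z, U z -> F z \in unitmx) -> smooth_mx U (fun u => invmx (F u)).
Proof.
move=> oU sF uF i j.
apply: (smooth_ext (f := fun u => (\det (F u))^-1 * ((-1) ^+ (j + i) * \det (row' j (col' i (F u)))))) => //.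
  by move=> u Uu; rewrite /invmx uF// !mxE /cofactor.
apply: smoothM => //.
  have dn z : U z -> \det (F z) != 0 by move=> /uF; rewrite unitmxE unitfE.
  exact: smooth_inv oU dn (smooth_det oU sF).
apply: smoothM => //; first exact: smooth_cst.
apply: smooth_det => // k l.
apply: (smooth_ext (f := fun u => F u (lift j k) (lift i l))) => // u _.
by rewrite !mxE.
Qed.

End Determinant.

Section Flat.
Context {R : realType} (r : nat) (E : holBundle R r) (S : ttData E).
Hypothesis hS : tt_structure S.
Local Notation C := R[i].
Implicit Types (i : chart E) (z : C).

Lemma gram_unit i z : dom i z -> gram_mx S i z \in unitmx.
Proof.
move=> iz; have z0 := dom_neq0 iz; have bB := frame_basis iz.
rewrite -row_free_unit -kermx_eq0; apply/rowV0P => u /sub_kermxP uG.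
pose y := \sum_(a < r) conjc (u 0 a) *: (frame i z)`_a.
have gy b : metric S y (frame i z)`_b = 0 \/ (r <= b)%N.
  have [br|] := ltnP b r; [left|by right].
  have := congr1 (fun m : 'rV_r => m 0 (Ordinal br)) uG; rewrite !mxE => H.
  rewrite (metric_herm hS z0) /y (g_sumr (@metric_linear _ _ _ _ hS z z0)) rmorph_sum /=.
  rewrite -[RHS]H; apply: eq_bigr => a _.
  by rewrite rmorphM /= conjcK -(metric_herm hS z0) mxE.
have yy : metric S y y = 0.
  rewrite {2}/y (g_sumr (@metric_linear _ _ _ _ hS z z0)) big1// => a _.
  by have [->|] := gy a; [rewrite mulr0|rewrite leqNgt ltn_ord].
have y0 : y = 0.
  by apply/eqP/negPn/negP => /(metric_pos hS z0); rewrite yy ltxx.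
apply/rowP => a; rewrite mxE -[u 0 a]conjcK.
have /freeP/(_ (fun a => conjc (u 0 a))) := basis_free bB.
by move=> /(_ y0 a) ->; rewrite conjc0.
Qed.

Lemma chern_smooth i : smooth_mx (dom i) (chern_mx S i).
Proof.
have sG : smooth_mx (dom i) (gram_mx S i) by move=> a b; exact: metric_smooth hS i a b.
apply: smooth_mxM; first exact: dom_open.
  by apply: smooth_invmx => //; [exact: dom_open|move=> z; exact: gram_unit].
by apply: smooth_dz_mx => //; exact: dom_open.
Qed.

Lemma higgs_holo i : holo_mx (dom i) (higgs_mx S i).
Proof. by move=> a b; exact: higgs_holomorphic hS i a b. Qed.

Lemma higgs_adj_smooth i : smooth_mx (dom i) (higgs_adj_mx S i).
Proof.
have oU := @dom_open _ _ E i.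
have sG : smooth_mx (dom i) (gram_mx S i) by move=> a b; exact: metric_smooth hS i a b.
apply: smooth_mxM => //; apply: smooth_mxM => //.
  by apply: smooth_invmx => // z; exact: gram_unit.
move=> a b; apply: (smooth_ext (f := fun z => conjc (higgs_mx S i z b a))) => //.
  by move=> z _; rewrite !mxE.
by apply: smooth_conj => //; case: (higgs_holo i b a).
Qed.

Lemma chern_flat i z : dom i z -> dzbar_mx (chern_mx S i) z =
  higgs_mx S i z *m higgs_adj_mx S i z - higgs_adj_mx S i z *m higgs_mx S i z.
Proof.
move=> iz.
have WC := smooth_isWm (chern_smooth i) iz; have WM := holo_isWm (higgs_holo i) iz.
have WN := smooth_isWm (higgs_adj_smooth i) iz.
have key (l : C) : `|l| = 1 -> l * l = 1 ->
   l *: dz_mx (higgs_adj_mx S i) z - dzbar_mx (chern_mx S i) z +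
   ((chern_mx S i z + l *: higgs_mx S i z) *m (l *: higgs_adj_mx S i z) -
    (l *: higgs_adj_mx S i z) *m (chern_mx S i z + l *: higgs_mx S i z)) = 0.
  move=> l1 ll; have l0 : l != 0 by rewrite -normr_eq0 l1 oner_eq0.
  have lV : l^-1 = l by apply: (mulfI l0); rewrite ll divff.
  (* Only [lambda = 1] and [lambda = -1] are needed: their sum cancels the odd terms. *)
  rewrite -[RHS](connection_flat hS l1 iz) /curvature lV.
  have [-> _] := isWm_val (isWm_scale (isW_cst l z) WN).
  have [_ ->] := isWm_val (isWm_D WC (isWm_scale (isW_cst l z) WM)).
  by rewrite scale0r add0r scaler0 scale0r !addr0.
have k1 := key 1; have k2 := key (-1).
rewrite normr1 normrN1 !mulr1 in k1 k2.
have m1 : (-1 : C) * -1 = 1 by rewrite mulrNN mulr1.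
have {}k1 := k1 erefl erefl; have {}k2 := k2 erefl m1.
move: k1 k2; rewrite !scale1r !scaleN1r.
move: (chern_mx S i z) (higgs_mx S i z) (higgs_adj_mx S i z) (dz_mx _ _) (dzbar_mx _ _) => Cc Mm Nn X Y.
rewrite !(mulmxDl, mulmxDr, mulmxN, mulNmx, opprK) => k1 k2.
apply/eqP; rewrite eq_sym -subr_eq0; apply/eqP/matrixP => a b.
have := congr1 (fun m : 'M[C]_r => m a b) k1; have := congr1 (fun m : 'M[C]_r => m a b) k2.
rewrite !mxE; move: (\sum_j _) (\sum_j _) (\sum_j _) (\sum_j _) (X a b) (Y a b).
move=> p q s t u v E1 E2.
have two : (2%:R : C) != 0 by rewrite pnatr_eq0.
apply: (mulfI two); rewrite mulr0 -[RHS](addr0 0) -{1}E1 -E2.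
by ring.
Qed.

End Flat.

Section MatrixAlgebra.
Variables (K : fieldType) (m : nat).
Implicit Types (P G Q A X Y : 'M[K]_m).

Lemma mulmx_conj_gram P G Q A c : G \in unitmx ->
  P *m (G *m (c *: (invmx G *m Q *m G) *m A)) = P *m (c *: Q) *m (G *m A).
Proof.
move=> uG; rewrite -scalemxAl -!scalemxAr -scalemxAl; congr (_ *: _).
by rewrite -!mulmxA (mulKVmx uG).
Qed.

Lemma commutator_frame X Y P X' Y' a b : (a *: X) *m P = P *m X' -> (b *: Y) *m P = P *m Y' ->
  P *m (X' *m Y' - Y' *m X') = (a *: (b *: (X *m Y - Y *m X))) *m P.
Proof.
move=> eX eY; rewrite mulmxBr !mulmxA -eX -eY -!mulmxA -eX -eY.
rewrite scalerA -[RHS]scalemxAl mulmxBl scalerBr; congr (_ - _).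
  by rewrite -!scalemxAl -scalemxAr scalerA mulmxA.
by rewrite -!scalemxAl -scalemxAr scalerA mulmxA mulrC.
Qed.

End MatrixAlgebra.

Section TodaMatrix.
Context {R : realType} (n : nat) (E : holBundle R n.+1) (S : ttData E).
Hypothesis hS : tt_structure S.
Local Notation C := R[i].
Local Notation N := n.+1.
(** The columns of [A] are the coordinates of the new frame in the chart [i]. *)
Variables (i : chart E) (U : set C) (A : C -> 'M[C]_N) (om : 'I_N -> C -> C) (h : C -> C).
Hypothesis oU : open (U : set C^o).
Hypothesis Udom : forall s, U s -> dom i (cexp s).
Hypothesis Aholo : holo_mx U A.
Hypothesis Aunit : forall s, U s -> A s \in unitmx.
Hypothesis omsm : forall j, smooth_on U (om j).

Definition shift_mx : 'M[C]_N := \matrix_(a, b) (a == ordS b)%:R.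

Definition exp_mx (s : C) : 'M[C]_N := \matrix_(a, b) (if a == b then cexp (om b s) else 0).

Hypothesis Agram : forall s, U s -> adj (A s) *m gram_mx S i (cexp s) *m A s = exp_mx s.
Hypothesis Ahiggs : forall s, U s ->
  cexp s *: higgs_mx S i (cexp s) *m A s = A s *m (h s *: shift_mx).

Definition dom_mx (s : C) : 'M[C]_N := \matrix_(a, b) (if a == b then dz (om b) s else 0).

Lemma adj_unit s : U s -> adj (A s) \in unitmx.
Proof. by move=> Us; rewrite unitmx_tr map_unitmx; exact: Aunit. Qed.

Lemma gram_sm : smooth_mx (dom i) (gram_mx S i).
Proof. by move=> a b; exact: metric_smooth hS i a b. Qed.

Lemma exp_dom s (X : 'M[C]_N) (y : 'I_N -> C) : X = \matrix_(a, b) (if a == b then y b else 0) ->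
  exp_mx s *m X = \matrix_(a, b) (if a == b then y b * cexp (om b s) else 0).
Proof.
move=> ->; apply/matrixP => a b; rewrite !mxE (bigD1 a)//= big1 ?addr0; last first.
  by move=> c ca; rewrite !mxE eq_sym (negPf ca) mul0r.
by rewrite !mxE eqxx; case: eqP => [->|_]; rewrite ?mulr0// mulrC.
Qed.

(** The [dz]-part of the derivative of [Agram], where [A] is holomorphic. *)
Lemma gauge s : U s -> A s *m dom_mx s =
  cexp s *: chern_mx S i (cexp s) *m A s + dz_mx A s.
Proof.
move=> Us; have WA := holo_isWm Aholo Us.
have WG := isWm_comp (@dom_open _ _ E i) gram_sm (Udom Us).
have W1 := isWm_M (isWm_M (isWm_adj WA) WG) WA.
have W2 : isWm exp_mx s (exp_mx s *m dom_mx s) (\matrix_(a, b) (if a == b then dzbar (om b) s * cexp (om b s) else 0)).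
  rewrite (@exp_dom s (dom_mx s) (fun b => dz (om b) s)) // => a b.
  rewrite !mxE; under eq_fun do rewrite mxE.
  case: eqP => _; last exact: isW_cst.
  have := isW_comp openT ((holo_cexp openT).1 1%N) (I : setT (om b s)) (smooth_isW (omsm b) Us).
  have [-> ->] := isW_val (isW_cexp (om b s)).
  by rewrite !mulr0 !addr0.
have W1' : isWm exp_mx s _ _ := isWm_near (open_near oU Us Agram) W1.
have := (isWm_val W1').1; rewrite (isWm_val W2).1 adj0 mul0mx add0r -(Agram Us).
have uP := adj_unit Us; have uG := gram_unit hS (Udom Us).
rewrite /chern_mx; move: (adj (A s)) (gram_mx S i (cexp s)) (dz_mx (gram_mx S i) (cexp s)) uP uG => P G G1 uP uG.
move=> /(congr1 (fun X => invmx G *m (invmx P *m X))).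
rewrite -!mulmxA -mulmxDr !(mulKmx uP) mulmxDr !(mulKmx uG) => ->.
by rewrite -!scalemxAl -scalemxAr mulmxA.
Qed.

Definition hs_mx (s : C) : 'M[C]_N := h s *: shift_mx.

Definition hs_adj_mx (s : C) : 'M[C]_N :=
  \matrix_(a, b) (cexp (om b s - om a s) * conjc (hs_mx s b a)).

Lemma higgs_adj_frame s : U s ->
  conjc (cexp s) *: higgs_adj_mx S i (cexp s) *m A s = A s *m hs_adj_mx s.
Proof.
move=> Us; have uP := adj_unit Us; have uG := gram_unit hS (Udom Us).
have D : exp_mx s *m hs_adj_mx s = adj (hs_mx s) *m exp_mx s.
  apply/matrixP => a b; rewrite !mxE (bigD1 a)//= big1 ?addr0; last first.
    by move=> c ca; rewrite !mxE eq_sym (negPf ca) mul0r.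
  rewrite [RHS](bigD1 b)//= big1 ?addr0; last first.
    by move=> c cb; rewrite !mxE (negPf cb) mulr0.
  by rewrite !mxE !eqxx mulrA -cexpD [om a s + _]addrC subrK mulrC.
have eM : adj (A s) *m adj (cexp s *: higgs_mx S i (cexp s)) = adj (hs_mx s) *m adj (A s).
  by rewrite -!adjM Ahiggs.
have adjZ (c : C) (X : 'M[C]_N) : adj (c *: X) = conjc c *: adj X.
  by apply/matrixP => a b; rewrite !mxE rmorphM.
rewrite adjZ in eM; rewrite /higgs_adj_mx -/(adj _).
move: D; rewrite -(Agram Us) => D.
apply: (can_inj (mulKmx uG)); apply: (can_inj (mulKmx uP)).
transitivity (adj (hs_mx s) *m (adj (A s) *m gram_mx S i (cexp s) *m A s)).
  rewrite (mulmx_conj_gram (adj (A s)) (adj (higgs_mx S i (cexp s))) (A s) (conjc (cexp s)) uG).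
  by rewrite eM !mulmxA.
by rewrite -D !mulmxA.
Qed.

Lemma toda_matrix s j : U s -> dzbar (dz (om j)) s =
  h s * conjc (h s) * (cexp (om j s - om (ord_pred j) s) - cexp (om (ordS j) s - om j s)).
Proof.
move=> Us; have WA := holo_isWm Aholo Us.
have WO : isWm dom_mx s (\matrix_(a, b) (if a == b then dz (dz (om b)) s else 0))
    (\matrix_(a, b) (if a == b then dzbar (dz (om b)) s else 0)).
  move=> a b; rewrite !mxE; under eq_fun do rewrite mxE.
  case: eqP => _; last exact: isW_cst.
  exact: smooth_isW (smooth_dz oU (omsm b)) Us.
have WC := isWm_comp (@dom_open _ _ E i) (@chern_smooth _ _ _ _ hS i) (Udom Us).
have hA1 : holo_mx U (dz_mx A).
  move=> a b; apply: (holo_ext (f := dz (fun u => A u a b))) => //.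
    by move=> u _; rewrite mxE.
  exact: holo_dz oU (Aholo a b).
have W1 := isWm_M WA WO.
have W2 := isWm_D (isWm_M (isWm_scale (isW_cexp s) WC) WA) (holo_isWm hA1 Us).
have W2' := isWm_near (open_near oU Us (fun w Uw => esym (gauge Uw))) W2.
have := (isWm_val W1).2; rewrite (isWm_val W2').2 scale0r add0r mulmx0 addr0 addr0 mul0mx add0r.
rewrite (chern_flat hS (Udom Us)) => H.
have eM := Ahiggs Us; have eN := higgs_adj_frame Us.
have key : A s *m (hs_mx s *m hs_adj_mx s - hs_adj_mx s *m hs_mx s) =
    A s *m (\matrix_(a, b) (if a == b then dzbar (dz (om b)) s else 0)).
  rewrite -H; exact: commutator_frame eM eN.
have /(congr1 (fun X : 'M[C]_N => X j j)) := can_inj (mulKmx (Aunit Us)) key.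
rewrite !mxE eqxx => <-.
rewrite (bigD1 (ord_pred j))//= big1 ?addr0; last first.
  move=> c cj; rewrite !mxE (_ : (j == ordS c) = false) ?mulr0 ?mul0r//.
  by apply: contraNF cj => /eqP ->; rewrite ordSK.
rewrite (bigD1 (ordS j))//= big1 ?addr0; last first.
  by move=> c cj; rewrite !mxE (negPf cj) !mulr0.
rewrite !mxE ord_predK !eqxx !mulr1 mulrBr; congr (_ - _).
  by rewrite mulrA mulrAC.
by rewrite mulrC [X in _ * X]mulrC mulrA.
Qed.

End TodaMatrix.

(** * Sections over the universal covering *)

Section Sections.
Context {R : realType} (N : nat) (E : holBundle R N).
Local Notation C := R[i].
Implicit Types (i j : chart E) (s : C) (U V : set C) (f : C -> C).
Local Notation sect := (forall s : C, E (cexp s)).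
Implicit Types (sg ta : sect).

Definition pdom i : set C := [set s | dom i (cexp s)].

Lemma open_pdom i : open (pdom i : set C^o).
Proof.
rewrite openE => s si; rewrite /interior.
have cf := Ck0 (Ck_cexp 0 (@openT C^o)) (I : setT s); apply: (cf (dom i)).
exact: (open_nbhs_nbhs (conj (@dom_open _ _ E i) si)).
Qed.

Lemma pdom_cover s : exists i, pdom i s.
Proof. exact: dom_cover (cexp_neq0 s). Qed.

Lemma smooth_pull i f : smooth_on (dom i) f -> smooth_on (pdom i) (f \o @cexp R).
Proof.
move=> sf; have oU := (@open_pdom i).
exact: smooth_comp oU (@dom_open _ _ E i) (fun s si => si) sf (holo_cexp oU).1.
Qed.

Lemma holo_pull i f : holomorphic_on (dom i) f -> holomorphic_on (pdom i) (f \o @cexp R).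
Proof.
move=> hf; have oU := (@open_pdom i).
exact: holo_comp oU (@dom_open _ _ E i) (fun s si => si) hf (holo_cexp oU).
Qed.

Definition holo_sect i U sg := forall a : 'I_N,
  holomorphic_on U (fun s => coord (frame i (cexp s)) a (sg s)).

Lemma sect_expand i s (v : E (cexp s)) : pdom i s ->
  v = \sum_(a < N) coord (frame i (cexp s)) a v *: (frame i (cexp s))`_a.
Proof. by move=> si; exact: coord_basis (frame_basis si) (memvf v). Qed.

Lemma holo_sect_sub i U V sg : V `<=` U -> holo_sect i U sg -> holo_sect i V sg.
Proof. by move=> VU H a; exact: holo_sub VU (H a). Qed.

Lemma holo_sect_ext i U sg ta : open (U : set C^o) -> (forall s, U s -> sg s = ta s) ->
  holo_sect i U sg -> holo_sect i U ta.
Proof. by move=> oU st H a; apply: holo_ext (H a) => // s Us; rewrite st. Qed.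

Lemma holo_sect_local i U sg : open (U : set C^o) ->
  (forall s, U s -> exists V, [/\ open (V : set C^o), V s & holo_sect i V sg]) ->
  holo_sect i U sg.
Proof.
move=> oU H a; apply: holo_local => // s /H[V [oV Vs HV]]; exists V; split=> //.
Qed.

Lemma holo_sect_scale i U sg f : open (U : set C^o) -> holomorphic_on U f ->
  holo_sect i U sg -> holo_sect i U (fun s => f s *: sg s).
Proof.
move=> oU hf H a; apply: (holo_ext (f := fun s => f s * coord (frame i (cexp s)) a (sg s))) => //.
  by move=> s _; rewrite linearZ.
exact: holoM oU hf (H a).
Qed.

Lemma holo_sect_sum i U m (F : 'I_m -> sect) : open (U : set C^o) ->
  (forall k, holo_sect i U (F k)) -> holo_sect i U (fun s => \sum_(k < m) F k s).
Proof.
move=> oU H a; apply: (holo_ext (f := fun s => \sum_(k < m) coord (frame i (cexp s)) a (F k s))) => //.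
  by move=> s _; rewrite linear_sum.
by apply: holo_sum => // k; exact: H.
Qed.

Lemma coord_frame i s (a b : 'I_N) : pdom i s ->
  coord (frame i (cexp s)) a (frame i (cexp s))`_b = (a == b)%:R.
Proof. by move=> si; rewrite (coord_free _ _ (basis_free (frame_basis si))) eq_sym. Qed.

Lemma holo_sect_frame i (b : 'I_N) : holo_sect i (pdom i) (fun s => (frame i (cexp s))`_b).
Proof.
move=> a; apply: (holo_ext (f := fun=> (a == b)%:R)); first exact: open_pdom.
  by move=> s si; rewrite coord_frame.
by apply: holo_cst; exact: open_pdom.
Qed.

Lemma holo_sect_lin i U (f : forall s : C, E (cexp s) -> E (cexp s)) sg :
  open (U : set C^o) -> U `<=` pdom i ->
  (forall s c a b, f s (c *: a + b) = c *: f s a + f s b) ->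
  (forall a b : 'I_N, holomorphic_on U (fun s => coord (frame i (cexp s)) a (f s (frame i (cexp s))`_b))) ->
  holo_sect i U sg -> holo_sect i U (fun s => f s (sg s)).
Proof.
move=> oU Ui flin fh H a.
apply: (holo_ext (f := fun s => \sum_(b < N) coord (frame i (cexp s)) b (sg s) *
   coord (frame i (cexp s)) a (f s (frame i (cexp s))`_b))) => //.
  move=> s Us; rewrite [in RHS](sect_expand (sg s) (Ui s Us)).
  rewrite (lin_fun_sum (flin s)) linear_sum; apply: eq_bigr => b _.
  by rewrite linearZ.
by apply: holo_sum => // b; exact: holoM oU (H b) (fh a b).
Qed.

Lemma holo_sect_chart i j U sg : open (U : set C^o) -> U `<=` pdom i -> U `<=` pdom j ->
  holo_sect i U sg -> holo_sect j U sg.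
Proof.
move=> oU Ui Uj H a.
apply: (holo_ext (f := fun s => \sum_(b < N) coord (frame i (cexp s)) b (sg s) *
   coord (frame j (cexp s)) a (frame i (cexp s))`_b)) => //.
  move=> s Us; rewrite [in RHS](sect_expand (sg s) (Ui s Us)) linear_sum.
  by apply: eq_bigr => b _; rewrite linearZ.
apply: holo_sum => // b; apply: (holoM oU (H b)).
have oI : open (dom j `&` dom i : set C^o) by apply: openI; exact: dom_open.
exact: holo_comp oU oI (fun s Us => conj (Uj s Us) (Ui s Us)) (@frame_holomorphic _ _ E j i a b) (holo_cexp oU).
Qed.

Definition holo_at s sg := exists i U,
  [/\ open (U : set C^o), U s, U `<=` pdom i & holo_sect i U sg].

Lemma near_open s (P : C -> Prop) : (\forall w \near (s : C^o), P w) ->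
  exists U : set C, [/\ open (U : set C^o), U s & forall w, U w -> P w].
Proof.
move=> H; exists (interior (P : set C^o)); split; [exact: open_interior|exact: H|].
by move=> w; exact: interior_subset.
Qed.

Lemma holo_at_near s sg ta : (\forall w \near (s : C^o), sg w = ta w) -> holo_at s sg -> holo_at s ta.
Proof.
move=> /near_open[V [oV Vs VP]] [i [U [oU Us Ui H]]]; exists i, (U `&` V).
have oI : open (U `&` V : set C^o) by exact: openI.
split=> //; first by move=> w [/Ui].
apply: (holo_sect_ext (sg := sg)) => //; first by move=> w [_ /VP].
by apply: holo_sect_sub H => w [].
Qed.

Lemma holo_at_scale s sg c : holo_at s sg -> holo_at s (fun w => c *: sg w).
Proof.
move=> [i [U [oU Us Ui H]]]; exists i, U; split=> //.
exact: holo_sect_scale oU (holo_cst c oU) H.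
Qed.

Lemma holo_at_sect i sg : (forall s, holo_at s sg) -> holo_sect i (pdom i) sg.
Proof.
move=> H; apply: holo_sect_local; first exact: open_pdom.
move=> s si; have [j [U [oU Us Uj HU]]] := H s.
have oI : open (U `&` pdom i : set C^o) by apply: openI => //; exact: open_pdom.
exists (U `&` pdom i); split=> //.
apply: (holo_sect_chart oI _ _ (holo_sect_sub _ HU)); try by move=> w [].
by move=> w [/Uj].
Qed.

Lemma sign_loc_cst (f g : C -> C) (c : C -> bool) s :
  {for s, continuous (f : C^o -> C^o)} -> {for s, continuous (g : C^o -> C^o)} -> f s != 0 ->
  (\forall w \near (s : C^o), g w = (-1) ^+ c w * f w) -> \forall w \near (s : C^o), c w = c s.
Proof.
move=> /cvgrPdist_lt cf /cvgrPdist_lt cg fs H; have fs0 : 0 < `|f s| by rewrite normr_gt0.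
have gs := nbhs_singleton H.
apply: filterS3 (cf _ fs0) (cg _ fs0) H => w hf hg gw.
have [->//|cc] := eqVneq (c w) (c s).
have : `|f s + f w| < `|f s|.
  move: hg; rewrite gs gw (_ : c w = ~~ c s); last by case: (c w) (c s) cc => [] [].
  by case: (c s); rewrite ?expr1 ?expr0 !mul1r ?mulN1r ?opprK// -opprD normrN.
move=> hfg; have : `|f s + f s| < `|f s| + `|f s|.
  rewrite -[X in X + _](subrK (f w)) -addrA [f w + _]addrC.
  exact: le_lt_trans (ler_normD _ _) (ltrD hf hfg).
by rewrite -mulr2n normrMn mulr2n ltxx.
Qed.

Section Structure.
Variable S : ttData E.
Hypothesis hS : tt_structure S.

Lemma eta_expand i s (u v : E (cexp s)) : pdom i s ->
  Defs.eta S u v = \sum_(a < N) \sum_(b < N) coord (frame i (cexp s)) a u *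
    (coord (frame i (cexp s)) b v * eta_mx S i (cexp s) a b).
Proof.
move=> si; have z0 := dom_neq0 si.
rewrite {1}(sect_expand u si) (et_suml (@eta_linear _ _ _ _ hS _ z0)); apply: eq_bigr => a _.
rewrite -mulr_sumr; congr (_ * _).
rewrite {1}(sect_expand v si) (eta_sym hS z0) (et_suml (@eta_linear _ _ _ _ hS _ z0)).
by apply: eq_bigr => b _; rewrite (eta_sym hS z0) mxE.
Qed.

Lemma metric_expand i s (u v : E (cexp s)) : pdom i s ->
  metric S u v = \sum_(a < N) \sum_(b < N) conjc (coord (frame i (cexp s)) a u) *
    (coord (frame i (cexp s)) b v * gram_mx S i (cexp s) a b).
Proof.
move=> si; have z0 := dom_neq0 si.
have L := @metric_linear _ _ _ _ hS _ z0.
rewrite {1}(sect_expand u si) (metric_herm hS z0) (g_sumr L) rmorph_sum; apply: eq_bigr => a _.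
rewrite rmorphM /= -(metric_herm hS z0) -mulr_sumr; congr (_ * _).
by rewrite {1}(sect_expand v si) (g_sumr L); apply: eq_bigr => b _; rewrite mxE.
Qed.

Lemma holo_eta i U sg ta : open (U : set C^o) -> U `<=` pdom i ->
  holo_sect i U sg -> holo_sect i U ta -> holomorphic_on U (fun s => Defs.eta S (sg s) (ta s)).
Proof.
move=> oU Ui Hs Ht.
apply: (holo_ext (f := fun s => \sum_(a < N) \sum_(b < N) coord (frame i (cexp s)) a (sg s) *
    (coord (frame i (cexp s)) b (ta s) * (fun z => eta_mx S i z a b) (cexp s)))) => //.
  by move=> s /Ui si; rewrite (eta_expand _ _ si).
apply: holo_sum => // a; apply: holo_sum => // b; apply: (holoM oU (Hs a)); apply: (holoM oU (Ht b)).
exact: holo_sub Ui (holo_pull (eta_holomorphic hS i a b)).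
Qed.

Lemma smooth_metric i U sg ta : open (U : set C^o) -> U `<=` pdom i ->
  holo_sect i U sg -> holo_sect i U ta -> smooth_on U (fun s => metric S (sg s) (ta s)).
Proof.
move=> oU Ui Hs Ht.
apply: (smooth_ext (f := fun s => \sum_(a < N) \sum_(b < N) conjc (coord (frame i (cexp s)) a (sg s)) *
    (coord (frame i (cexp s)) b (ta s) * (fun z => gram_mx S i z a b) (cexp s)))) => //.
  by move=> s /Ui si; rewrite (metric_expand _ _ si).
apply: smooth_sum => // a; apply: smooth_sum => // b; apply: smoothM => //.
  by apply: smooth_conj => //; case: (Hs a).
apply: smoothM => //; first by case: (Ht b).
exact: smooth_sub Ui (smooth_pull (metric_smooth hS i a b)).
Qed.

Lemma higgs0 z (z0 : z != 0) (a : E z) : higgs S 0 a = 0.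
Proof.
have := higgs_form hS z0 1 0 0 a; rewrite mulr0 addr0 scale1r => /eqP.
by rewrite -subr_eq0 opprD addrA subrr sub0r oppr_eq0 => /eqP.
Qed.

Lemma higgsZ z (z0 : z != 0) c X (a : E z) : higgs S (c * X) a = c *: higgs S X a.
Proof. by have := higgs_form hS z0 c X 0 a; rewrite higgs0// !addr0. Qed.

(** [Phi] on [z d/dz], which is [d/ds] for [z = cexp s]. *)
Definition eulerM z (a : E z) : E z := higgs S z a.

Lemma eulerME z (z0 : z != 0) (a : E z) : eulerM a = z *: higgs S 1 a.
Proof. by rewrite -higgsZ// mulr1. Qed.

Lemma holo_sect_M i U sg : open (U : set C^o) -> U `<=` pdom i ->
  holo_sect i U sg -> holo_sect i U (fun s => eulerM (sg s)).
Proof.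
move=> oU Ui; apply: (holo_sect_lin (f := fun s => @eulerM (cexp s))) => //.
  by move=> s c a b; exact: (@higgs_linear _ _ _ _ hS _ (cexp_neq0 s)).
move=> a b; apply: (holo_ext (f := fun s => cexp s * (fun z => higgs_mx S i z a b) (cexp s))) => //.
  by move=> s _; rewrite mxE (eulerME (cexp_neq0 s)) linearZ.
apply: holoM => //; first exact: holo_cexp.
exact: holo_sub Ui (holo_pull (higgs_holomorphic hS i a b)).
Qed.

Lemma holo_sect_iterM i U k sg : open (U : set C^o) -> U `<=` pdom i ->
  holo_sect i U sg -> holo_sect i U (fun s => iter k (@eulerM _) (sg s)).
Proof.
by move=> oU Ui H; elim: k => [//|k IH]; exact: holo_sect_M oU Ui IH.
Qed.

Variables (c : C) (T : forall z, E z -> E z).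
Hypothesis hT : tt_iso S (scale_higgs c S) T.

Lemma holo_sect_T i U sg : open (U : set C^o) -> U `<=` pdom i ->
  holo_sect i U sg -> holo_sect i U (fun s => T (sg s)).
Proof.
move=> oU Ui; apply: (holo_sect_lin (f := fun s => @T (cexp s))) => //.
  by move=> s d a b; exact: (@iso_linear _ _ _ _ _ _ _ hT _ (cexp_neq0 s)).
move=> a b; have := iso_holomorphic hT i i a b; rewrite setIid => H.
exact: holo_sub Ui (holo_pull H).
Qed.

Lemma holo_sect_iterT i U k sg : open (U : set C^o) -> U `<=` pdom i ->
  holo_sect i U sg -> holo_sect i U (fun s => iter k (@T _) (sg s)).
Proof.
by move=> oU Ui H; elim: k => [//|k IH]; exact: holo_sect_T oU Ui IH.
Qed.

End Structure.
End Sections.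

Section Omega.
Context {R : realType}.
Local Notation C := R[i].

Lemma cexp_real (x : R) : cexp x%:C = (expR x)%:C.
Proof. by rewrite /cexp /= cos0 sin0 mulr1. Qed.

Lemma cexp_imag (x : R) : cexp (0 +i* x) = cos x +i* sin x.
Proof. by rewrite /cexp /= expR0 mul1r. Qed.

Lemma cexp_imagX (x : R) k : cexp (0 +i* x) ^+ k = cexp (0 +i* (k%:R * x)).
Proof.
rewrite -cexpMn; congr cexp; elim: k => [|k IH]; first by rewrite mulr0n mul0r.
by rewrite mulrS IH -natr1 mulrDl mul1r addrC; apply/eqP; rewrite eq_complex /= addr0 !eqxx.
Qed.

Lemma cos_neq1 (x : R) : 0 < x -> x < 2%:R * pi -> cos x != 1.
Proof.
move=> x0 x2; have [h0 hpi] : 0 < x / 2 /\ x / 2 < pi by split; lra.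
have s0 : 0 < sin (x / 2) by rewrite sin_gt0_pi// h0.
have := cos2Dsin2 (x / 2); have : cos x = cos (x / 2) ^+ 2 - sin (x / 2) ^+ 2.
  by rewrite {1}[x]splitr cosD !expr2.
move=> -> E; apply/eqP => E'; nra.
Qed.

Lemma omega_prim n : n.+1.-primitive_root (omega R n).
Proof.
have om1 k : (0 < k)%N -> (k < n.+1)%N -> omega R n ^+ k != 1.
  move=> k0 kn; rewrite /omega cexp_imagX cexp_imag; apply/negP => /eqP[c1 _].
  have nR : (0 : R) < n.+1%:R by rewrite ltr0n.
  move/eqP: c1; apply/negP; apply: cos_neq1.
    by rewrite mulr_gt0 ?ltr0n// divr_gt0// mulr_gt0// pi_gt0.
  rewrite mulrA ltr_pdivrMr// mulrC ltr_pM2l ?ltr_nat//.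
  by rewrite mulr_gt0// pi_gt0.
have omN : omega R n ^+ n.+1 = 1.
  rewrite /omega cexp_imagX cexp_imag mulrCA mulfV ?pnatr_eq0// mulr1.
  by rewrite mulr_natl cos2pi sin2pi.
apply/andP; split=> //; apply/forallP => i; rewrite unity_rootE.
have [->|ni] := eqVneq i.+1 n.+1; first by rewrite omN eqxx.
by apply/eqP/negbTE/om1 => //; rewrite ltn_neqAle ni ltn_ord.
Qed.

End Omega.

Section AdaptedFrame.
Context {R : realType} (n : nat) (E : holBundle R n.+1) (S : ttData E).
Hypothesis hS : tt_structure S.
Hypothesis hPhi : higgs_nonvanishing S.
Variable T : forall z, E z -> E z.
Hypothesis hT : tt_iso S (scale_higgs (omega R n) S) T.
Local Notation C := R[i].
Local Notation N := n.+1.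
Local Notation M := (@eulerM R n.+1 E S _).
Local Notation sect := (forall s : C, E (cexp s)).

Lemma tt_spec z : z != 0 -> fibre_spec n (omega R n) (@T z) (@eulerM R n.+1 E S z)
  (@Defs.eta _ _ _ S z) (@metric _ _ _ S z).
Proof.
move=> z0; constructor.
- exact: omega_prim.
- have [i iz] := dom_cover E z0; have := size_basis (frame_basis iz).
  by [].
- exact: iso_linear hT z z0.
- exact: (@higgs_linear _ _ _ _ hS z z0 z).
- exact: (@eta_linear _ _ _ _ hS z z0).
- exact: (@eta_sym _ _ _ _ hS z z0).
- exact: (@eta_nondegenerate _ _ _ _ hS z z0).
- exact: (@metric_linear _ _ _ _ hS z z0).
- exact: (@metric_herm _ _ _ _ hS z z0).
- exact: (@metric_pos _ _ _ _ hS z z0).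
- by move=> v v0; exact: hPhi.
- by move=> a; exact: (iso_higgs hT z0 z a).
- by move=> a b; exact: (iso_eta hT z0 a b).
- by move=> a b; exact: (iso_metric hT z0 a b).
- by move=> a b; exact: (higgs_selfadjoint hS z0 z a b).
Qed.

Lemma global_scalar : exists pp : C -> C, [/\ holomorphic_on setT pp, forall s, pp s != 0 &
  forall s (x : E (cexp s)), iter N M x = pp s *: x].
Proof.
have ex s : exists p : C, p != 0 /\ forall x : E (cexp s), iter N M x = p *: x.
  by have [p p0 pE] := scalar_exists (tt_spec (cexp_neq0 s)); exists p.
have [pp ppE] := choice ex.
exists pp; split=> [|s|s]; [|exact: (ppE s).1|exact: (ppE s).2].
apply: holo_local => [|s _]; first exact: openT.
have [i si] := pdom_cover E s; exists (pdom i); split=> //; first exact: open_pdom.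
have H := holo_sect_iterM hS N (@open_pdom _ _ _ i) (@subset_refl _ _) (@holo_sect_frame _ _ _ i ord0) ord0.
apply: (holo_ext _ _ H); first exact: open_pdom.
move=> u ui; rewrite (ppE u).2 linearZ /=.
by have /= -> := @coord_frame _ _ E i u ord0 ord0 ui; rewrite mulr1.
Qed.

Lemma global_sign : exists b : bool, forall s (x : E (cexp s)), iter N (@T _) x = (-1) ^+ b *: x.
Proof.
have [c cE] := choice (fun s => sign_exists (tt_spec (cexp_neq0 s))).
exists (c 0) => s x; rewrite cE; congr ((-1) ^+ nat_of_bool _ *: _).
apply: loc_cst_cst => {s x} s.
have [i si] := pdom_cover E s.
have H := holo_sect_iterT hT N (@open_pdom _ _ _ i) (@subset_refl _ _) (@holo_sect_frame _ _ _ i ord0) ord0.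
apply: (@sign_loc_cst _ (fun=> 1) _ c s _ (Ck0 (H.1 0%N) si)).
- exact: cst_continuous.
- exact: oner_neq0.
- apply: (open_near (@open_pdom _ _ _ i) si) => u ui.
  rewrite cE linearZ /=.
  by have /= -> := @coord_frame _ _ E i u ord0 ord0 ui.
Qed.

Section AdaptedSection.
Variables (la : C) (k : nat) (h : C -> C).
Hypotheses (kN : (k < N)%N) (lak : la * la * omega R n ^+ k = 1).
Hypothesis laN : forall s (x : E (cexp s)), iter N (@T _) x = la ^+ N *: x.
Hypothesis hh : holomorphic_on setT h.
Hypothesis h0 : forall s, h s != 0.
Hypothesis hN : forall s (x : E (cexp s)), iter N M x = h s ^+ N *: x.

Definition adapted_at z (x : E z) (c : C) :=
  adapted n (@T z) (@eulerM R n.+1 E S z) (@Defs.eta _ _ _ S z) la k x c.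

Lemma adapted_at_scale s (x : E (cexp s)) (c : C) : T x = la *: x ->
  c ^+ 2 * Defs.eta S x (iter k M x) = h s ^+ k -> adapted_at (c *: x) (h s).
Proof.
move=> Tx cE; have sp := tt_spec (cexp_neq0 s); split.
- by rewrite (lin_funZ (fs_Tlin sp)) Tx !scalerA mulrC.
- exact: hN.
- by rewrite (lin_funZ (iter_lin (fs_Mlin sp) k)) (etZl (fs_etlin sp))
    (etZr (fs_etlin sp) (fs_etC sp)) mulrA -expr2.
Qed.

Lemma la_neq0 : la != 0.
Proof. by apply: contra_eq_neq lak => ->; rewrite mul0r mul0r eq_sym oner_eq0. Qed.

Lemma adapted_at_exists s : exists x : E (cexp s), adapted_at x (h s).
Proof.
have sp := tt_spec (cexp_neq0 s).
have [x x0 Tx] := eigen_lambda sp (@laN s).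
have q0 := pairing_neq0 sp kN lak x0 Tx.
exists (sqrtc (h s ^+ k / Defs.eta S x (iter k M x)) *: x).
by apply: adapted_at_scale => //; rewrite sqr_sqrtc divfK.
Qed.

Definition proj z (x : E z) : E z := \sum_(j < N) (la ^+ j)^-1 *: iter j (@T z) x.

Lemma proj_eigen s (x : E (cexp s)) : T (proj x) = la *: proj x.
Proof.
have sp := tt_spec (cexp_neq0 s).
rewrite /proj (lin_fun_sum (fs_Tlin sp)) scaler_sumr big_ord_recr [RHS]big_ord_recl /=.
rewrite -iterS laN addrC; congr (_ + _).
  by rewrite scalerA expr0 invr1 scale1r exprSr mulKf// expf_neq0 // la_neq0.
apply: eq_bigr => j _; rewrite scalerA /= exprS invfM mulrA mulfV ?mul1r//.
exact: la_neq0.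
Qed.

Lemma proj_lin s c (a b : E (cexp s)) : proj (c *: a + b) = c *: proj a + proj b.
Proof.
have sp := tt_spec (cexp_neq0 s).
rewrite /proj scaler_sumr -big_split; apply: eq_bigr => j _.
by rewrite (iter_lin (fs_Tlin sp)) scalerDr !scalerA mulrC.
Qed.

Lemma proj_fix s (x : E (cexp s)) : T x = la *: x -> proj x = N%:R *: x.
Proof.
move=> Tx; have sp := tt_spec (cexp_neq0 s).
have H j : iter j (@T _) x = la ^+ j *: x.
  elim: j => [|j IH]; first by rewrite expr0 scale1r.
  by rewrite iterS IH (lin_funZ (fs_Tlin sp)) Tx scalerA exprSr.
rewrite /proj (eq_bigr (fun=> x)); first by rewrite sumr_const card_ord scaler_nat.
by move=> j _; rewrite H scalerA mulVf ?scale1r// expf_neq0// la_neq0.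
Qed.

Lemma local_section s : exists i (V : set C) (ta : sect),
  [/\ open (V : set C^o), V s, V `<=` pdom i, holo_sect i V ta &
      forall w, V w -> adapted_at (ta w) (h w)].
Proof.
have [i si] := pdom_cover E s; have oi := @open_pdom _ _ _ i.
have sp := tt_spec (cexp_neq0 s).
have [b b0] : exists b : 'I_N, proj (frame i (cexp s))`_b != 0.
  apply/not_existsP => H; have [x ad] := adapted_at_exists s.
  have x0 := adapted_neq0 sp (h0 s) ad; case: ad => Tx _ _.
  move/eqP: x0; apply; apply/eqP; have /eqP := proj_fix Tx.
  rewrite [in proj x](sect_expand x si) (lin_fun_sum (@proj_lin s)) big1.
    by rewrite eq_sym scaler_eq0 pnatr_eq0.
  by move=> a _; have /negP/negPn/eqP -> := H a; rewrite scaler0.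
pose f (w : C) : E (cexp w) := proj (frame i (cexp w))`_b.
have hf : holo_sect i (pdom i) f.
  apply: holo_sect_sum => // j; apply: holo_sect_scale => //; first exact: holo_cst.
  have Hj := holo_sect_iterT hT j oi (@subset_refl _ _) (@holo_sect_frame _ _ _ i b).
  exact: Hj.
have hk : holomorphic_on (pdom i) (fun w => h w ^+ k).
  by apply: holo_exp => //; exact: holo_sub hh.
have hk0 w : pdom i w -> h w ^+ k != 0 by move=> _; rewrite expf_neq0.
pose q w := Defs.eta S (f w) (iter k M (f w)) * (h w ^+ k)^-1.
have hq : holomorphic_on (pdom i) q.
  apply: holoM => //; last exact: holo_inv.
  have hMf := holo_sect_iterM hS k oi (@subset_refl _ _) hf.
  have hE := holo_eta hS oi (@subset_refl _ _) hf hMf.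
  exact: hE.
have q0 : q s != 0.
  by rewrite mulf_neq0 ?invr_eq0 ?hk0// (pairing_neq0 sp kN lak b0)// proj_eigen.
have [V [L [oV Vs Vi hL EL]]] := holo_log_local oi si hq q0.
exists i, V, (fun w => cexp ((- 2^-1) * L w) *: f w); split=> //.
  apply: holo_sect_scale => //; last exact: holo_sect_sub hf.
  exact: (holo_comp oV openT (fun _ _ => I) (holo_cexp openT) (holoM oV (holo_cst _ oV) hL)).
move=> w Vw; apply: adapted_at_scale; first exact: proj_eigen.
have : cexp (- 2^-1 * L w) ^+ 2 * q w = 1.
  rewrite -(EL w Vw) -cexpMn -cexpD -mulrnAl mulr2n -opprD -mulr2n -[2^-1 *+ 2]mulr_natr.
  by rewrite mulVf ?pnatr_eq0// mulN1r addNr cexp0.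
by move=> /(congr1 (fun x => x * h w ^+ k)); rewrite /q mul1r -!mulrA mulVf ?mulr1// expf_neq0.
Qed.

Lemma global_section : exists e0 : sect,
  (forall s, adapted_at (e0 s) (h s)) /\ forall s, holo_at s e0.
Proof.
have [s0 s0P] : {s0 : sect & forall s, adapted_at (s0 s) (h s)}.
  exists (fun s => projT1 (cid (adapted_at_exists s))) => s.
  exact: (projT2 (cid (adapted_at_exists s))).
pose P s (e : C -> bool) := holo_at s (fun w => (-1) ^+ e w *: s0 w).
have [|||e eP] := @sign_monodromy R P.
- move=> s; have [i [V [ta [oV Vs Vi hV aV]]]] := local_section s.
  have ex w : exists b : bool, V w -> ta w = (-1) ^+ b *: s0 w.
    have [Vw|nV] := pselect (V w); last by exists false.
    have [b bE] := adapted_sign (tt_spec (cexp_neq0 w)) (h0 w) (s0P w) (aV w Vw).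
    by exists b.
  have [e eE] := choice ex; exists e; apply: (open_near oV Vs) => w Vw.
  exists i, V; split=> //; apply: holo_sect_ext hV => // u Vu; exact: eE.
- move=> s e e' b ee' /(holo_at_scale ((-1) ^+ b)); apply: holo_at_near.
  by apply: filterS ee' => w /= ->; rewrite scalerA signr_addb.
- move=> s e e' [i [U [oU Us Ui HU]]] [j [V [oV Vs Vj HV]]].
  have oW : open (U `&` V : set C^o) by exact: openI.
  have HV' : holo_sect i (U `&` V) (fun w => (-1) ^+ e' w *: s0 w).
    by apply: (holo_sect_chart oW _ _ (holo_sect_sub _ HV)); move=> w [Uw Vw] //; [exact: Vj|exact: Ui].
  have x0 := adapted_neq0 (tt_spec (cexp_neq0 s)) (h0 s) (s0P s).
  have [a a0] : exists a : 'I_N, coord (frame i (cexp s)) a (s0 s) != 0.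
    apply/not_existsP => H; move/eqP: x0; apply.
    rewrite (sect_expand (s0 s) (Ui s Us)) big1// => a _.
    by have /negP/negPn/eqP -> := H a; rewrite scale0r.
  have cf := Ck0 ((HU a).1 0%N) Us; have cg := Ck0 ((HV' a).1 0%N) (conj Us Vs).
  have fs : coord (frame i (cexp s)) a ((-1) ^+ e s *: s0 s) != 0.
    by rewrite linearZ /= mulf_neq0// signr_eq0.
  have := @sign_loc_cst _ _ _ (fun w => e' w (+) e w) s cf cg fs.
  move=> H; exists (e' s (+) e s).
  have {}H := H _; apply: filterS (H _) => [w E'|].
    by rewrite -E' -addbA addbb addbF.
  apply: filterE => w; rewrite !linearZ /= mulrA -signr_addb.
  by rewrite -addbA addbb addbF.
exists (fun w => (-1) ^+ e w *: s0 w); split=> [s|s]; last exact: eP.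
exact: (adaptedN (tt_spec (cexp_neq0 s)) (e s) (s0P s)).
Qed.

End AdaptedSection.
End AdaptedFrame.

(** * The Toda frame *)

Section CyclicIndex.
Variable n : nat.
Local Notation N := n.+1.

Definition idx (j : int) : 'I_N := inord `|(j %% N%:Z)%Z|%N.

Lemma idxE j : (idx j : nat)%:Z = (j %% N%:Z)%Z.
Proof.
have m0 : (0 <= j %% N%:Z)%Z by rewrite modz_ge0.
have mN : (`|(j %% N%:Z)%Z| < N)%N by rewrite -ltz_nat gez0_abs// ltz_pmod.
by rewrite /idx inordK// gez0_abs.
Qed.

Lemma idx_eq (a b : int) : (a = b %[mod N%:Z])%Z -> idx a = idx b.
Proof. by rewrite /idx => ->. Qed.

Lemma idx_nat (i : 'I_N) : idx (i : nat)%:Z = i.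
Proof.
apply/val_inj/eqP; rewrite -eqz_nat; apply/eqP; rewrite [LHS]idxE modz_small//.
by rewrite ltz_nat ltn_ord.
Qed.

Lemma idxS (j : int) : idx (j + 1) = ordS (idx j).
Proof.
apply/val_inj/eqP; rewrite -eqz_nat; apply/eqP; rewrite [LHS]idxE /= -modz_nat (intS (idx j)) idxE addrC.
by rewrite modzDmr.
Qed.

Lemma idx_pred (j : int) : idx (j - 1) = ord_pred (idx j).
Proof. by rewrite -[in RHS](subrK 1 j) idxS ordSK. Qed.

Lemma idx_sum (l : 'I_N) j : ((idx j + idx ((l : nat)%:Z - j - 1)) %% N = (l + n) %% N)%N.
Proof.
apply/eqP; rewrite -eqz_nat -!modz_nat !PoszD !idxE modzDm.
apply/eqP; rewrite (_ : l%:Z + n%:Z = (j + (l%:Z - j - 1)) + N%:Z) ?modzDr//.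
by rewrite intS; ring.
Qed.

Lemma eta_index (l i j : 'I_N) :
  (if (i < l)%N then i + j + 1 == l else i + j == n + l)%N = ((i + j) %% N == (l + n) %% N)%N.
Proof.
have lE : ((l + n) %% N = if l == 0 :> nat then n else l.-1)%N.
  case: (nat_of_ord l) (ltn_ord l) => [|m] mN; first by rewrite add0n modn_small.
  by rewrite addSn -addnS modnDr modn_small//= ltnW.
have ijE : ((i + j) %% N = if (i + j < N)%N then i + j else i + j - N)%N.
  case: ltnP => [lt|ge]; first by rewrite modn_small.
  by rewrite -{1}(subnK ge) modnDr modn_small// ltn_subLR// -addnS leq_add// ltnW.
rewrite lE ijE; have := ltn_ord i; have := ltn_ord j; have := ltn_ord l.
move: (nat_of_ord i) (nat_of_ord j) (nat_of_ord l) => a b c.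
move=> cN bN aN; case: (ltnP a c) => ac; case: (ltnP (a + b) N) => abN; case: (eqVneq c 0)%N => c00;
  apply/eqP/eqP; lia.
Qed.

End CyclicIndex.

Section TodaFrame.
Context {R : realType} (n : nat) (E : holBundle R n.+1) (S : ttData E).
Hypothesis hS : tt_structure S.
Hypothesis hPhi : higgs_nonvanishing S.
Variable T : forall z, E z -> E z.
Hypothesis hT : tt_iso S (scale_higgs (omega R n) S) T.
Local Notation C := R[i].
Local Notation N := n.+1.
Local Notation M := (@eulerM R n.+1 E S _).
Local Notation sect := (forall s : C, E (cexp s)).
Variables (la : C) (l : 'I_N) (h : C -> C) (e0 : sect).
Local Notation k := ((l + n) %% N)%N.
Hypothesis lak : la * la * omega R n ^+ k = 1.
Hypothesis hh : holomorphic_on setT h.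
Hypothesis h0 : forall s, h s != 0.
Hypothesis e0P : forall s, adapted_at S T la k (e0 s) (h s).
Hypothesis e0h : forall s, holo_at s e0.

Let kN : (k < N)%N. Proof. by rewrite ltn_mod. Qed.
Let spec s := tt_spec hS hPhi hT (cexp_neq0 s).

Definition toda_vec (j : nat) s : E (cexp s) := aframe (@eulerM R n.+1 E S (cexp s)) (e0 s) (h s) j.

Lemma toda_vec_holo i (j : nat) : holo_sect i (pdom i) (toda_vec j).
Proof.
have oi := @open_pdom _ _ _ i.
have H := holo_sect_iterM hS j oi (@subset_refl _ _) (holo_at_sect i e0h).
apply: holo_sect_scale => //; apply: holo_inv => //; first by move=> s _; rewrite expf_neq0.
by apply: holo_exp => //; exact: holo_sub hh.
Qed.

Lemma toda_vec_gt0 s j : 0 < metric S (toda_vec j s) (toda_vec j s).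
Proof. exact: (fs_gpos (spec s) (aframe_neq0 (spec s) (h0 s) (e0P s) j)). Qed.

Lemma adapted_at_metric_eq z z' (x : E z) c (x' : E z') c' j : z = z' -> z != 0 -> c != 0 -> c' != 0 ->
  adapted_at S T la k x c -> adapted_at S T la k x' c' ->
  metric S (aframe (@eulerM R n.+1 E S z') x' c' j) (aframe (@eulerM R n.+1 E S z') x' c' j) =
  metric S (aframe (@eulerM R n.+1 E S z) x c j) (aframe (@eulerM R n.+1 E S z) x c j).
Proof.
move=> zz; move: x' ; rewrite -zz => x' z0 c0 c'0 ad ad'.
have H := @adapted_metric _ _ _ _ _ _ _ _ (tt_spec hS hPhi hT z0) la k x c x' c' j c0 c'0 ad ad'.
exact: H.
Qed.

Lemma norm_exists : exists G : C -> nat -> R, forall s j,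
  metric S (toda_vec j s) (toda_vec j s) = (G (cexp s) j)%:C.
Proof.
have ex z : exists r : nat -> R, forall s, cexp s = z -> forall j,
    metric S (toda_vec j s) (toda_vec j s) = (r j)%:C.
  have [[s0 s0z]|nex] := pselect (exists s, cexp s = z); last first.
    by exists (fun=> 0) => s sz; case: nex; exists s.
  exists (fun j => complex.Re (metric S (toda_vec j s0) (toda_vec j s0))) => s sz j.
  rewrite (adapted_at_metric_eq j _ (cexp_neq0 s0) (h0 s0) (h0 s) (e0P s0) (e0P s)) ?sz//.
  by rewrite RRe_real// ger0_real// ltW// toda_vec_gt0.
have [G GE] := choice ex.
by exists G => s j; exact: GE.
Qed.

Variable G : C -> nat -> R.
Hypothesis GE : forall s j, metric S (toda_vec j s) (toda_vec j s) = (G (cexp s) j)%:C.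

Definition toda_fun (j : int) (z : C) : R := ln (G z (idx n j)).

Lemma G_gt0 s j : 0 < G (cexp s) j.
Proof. by have := toda_vec_gt0 s j; rewrite GE -(ltcR (0 : R)). Qed.

Lemma expR_toda_fun j s : expR (toda_fun j (cexp s)) = G (cexp s) (idx n j).
Proof. by rewrite /toda_fun lnK// posrE G_gt0. Qed.

Lemma toda_fun_pull_smooth j : smooth_on setT (fun s => (toda_fun j (cexp s))%:C).
Proof.
apply: smooth_local => [|s _]; first exact: openT.
have [i si] := pdom_cover E s; have oi := @open_pdom _ _ _ i.
exists (pdom i); split=> //.
have sm := smooth_metric hS oi (@subset_refl _ _) (toda_vec_holo i (idx n j)) (toda_vec_holo i (idx n j)).
have gt u : pdom i u -> (fun z : C => 0 < complex.Re z) (metric S (toda_vec (idx n j) u) (toda_vec (idx n j) u)).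
  by move=> _ /=; rewrite GE /= G_gt0.
have H := smooth_comp oi (@open_Re_gt0 R) gt (fun m => Ck_lift_ln m) sm.
apply: (@smooth_ext R _ _ _ oi _ H) => u _.
by rewrite /= /re_lift GE.
Qed.

Lemma toda_fun_smooth j : smooth_on [set z : C | z != 0] (fun z => (toda_fun j z)%:C).
Proof.
apply: smooth_local => [|z z0]; first exact: open_neq0.
have [V [L [oV Vz _ hL EL]]] := holo_log_local (@open_neq0 R) z0 (holo_id (@open_neq0 R)) z0.
exists V; split=> //.
have [sL _] := hL.
have H := smooth_comp oV openT (fun u _ => I) (toda_fun_pull_smooth j) sL.
by apply: (@smooth_ext R _ _ _ oV _ H) => u Vu; rewrite /= EL.
Qed.

Lemma toda_vec_basis s : basis_of fullv [tuple toda_vec j s | j < N].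
Proof. have H := aframe_basis (spec s) (h0 s) (e0P s); exact: H. Qed.

Lemma toda_vec_metric (i j : 'I_N) s :
  metric S (toda_vec i s) (toda_vec j s) = (if i == j then expR (toda_fun (i : nat)%:Z (cexp s)) else 0)%:C.
Proof.
case: eqP => [<-|/eqP ij]; first by rewrite expR_toda_fun idx_nat GE.
exact: (aframe_g (spec s) (h0 s) (e0P s) (ltn_ord i) (ltn_ord j) ij).
Qed.

Lemma toda_vec_M (j : 'I_N) s : M (toda_vec j s) = h s *: toda_vec (ordS j) s.
Proof.
rewrite (aframe_M (spec s) (e0 s) (h0 s)); congr (_ *: _); rewrite /toda_vec /=.
have [jn|jn] := eqVneq (j : nat) n; first by rewrite jn modnn (aframe_N (h0 s) (e0P s)).
by rewrite modn_small// ltnS ltn_neqAle jn -ltnS ltn_ord.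
Qed.

Lemma toda_vec_eta (i j : 'I_N) s : Defs.eta S (toda_vec i s) (toda_vec j s) =
  (if (i < l)%N then i + j + 1 == l else i + j == n + l)%N%:R.
Proof.
by rewrite eta_index; apply: (aframe_et (spec s) kN lak (h0 s) (e0P s)); exact: ltn_ord.
Qed.

Lemma toda_fun_antisym j z : z != 0 -> toda_fun j z + toda_fun ((l : nat)%:Z - j - 1) z = 0.
Proof.
move=> z0; have [s <-] := cexp_surj z0; have [kappa kP] := real_structure hS.
have [k1 k2 k3] := kP _ (cexp_neq0 s).
have := aframe_real (spec s) kN lak (h0 s) (e0P s) k1 k2 k3 (ltn_ord (idx n j))
  (ltn_ord (idx n ((l : nat)%:Z - j - 1))) (idx_sum l j).
rewrite -!/(toda_vec _ _) !GE -rmorphM => /complexI E1.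
by rewrite /toda_fun -lnM ?posrE ?G_gt0// E1 ln1.
Qed.

Lemma dzbar_dz_toda_fun (i : chart E) s j : pdom i s ->
  dzbar (dz (fun u => (toda_fun j (cexp u))%:C)) s = h s * conjc (h s) *
  (expR (toda_fun j (cexp s) - toda_fun (j - 1) (cexp s)) - expR (toda_fun (j + 1) (cexp s) - toda_fun j (cexp s)))%:C.
Proof.
move=> si; have oi := @open_pdom _ _ _ i.
pose A u : 'M[C]_N := \matrix_(a, b) coord (frame i (cexp u)) a (toda_vec b u).
pose om (b : 'I_N) u : C := (toda_fun (b : nat)%:Z (cexp u))%:C.
have twE m z : toda_fun m z = toda_fun ((idx n m : 'I_N) : nat)%:Z z by rewrite /toda_fun idx_nat.
have colA (b : 'I_N) u : pdom i u -> toda_vec b u = \sum_(a < N) A u a b *: (frame i (cexp u))`_a.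
  move=> ui; rewrite {1}(sect_expand (toda_vec b u) ui).
  by apply: eq_bigr => a _; rewrite mxE.
have Agram u : pdom i u -> adj (A u) *m gram_mx S i (cexp u) *m A u = exp_mx om u.
  move=> ui; apply/matrixP => a b; rewrite !mxE.
  transitivity (metric S (toda_vec a u) (toda_vec b u)); last first.
    by rewrite toda_vec_metric /om; case: eqP => [->|//]; rewrite cexp_real.
  rewrite (metric_expand hS _ _ ui) exchange_big; apply: eq_bigr => d _.
  rewrite mxE mulr_suml; apply: eq_bigr => c _.
  by rewrite !mxE -mulrA; congr (_ * _); rewrite mulrC.
have Aunit u : pdom i u -> A u \in unitmx.
  move=> ui; pose D : 'M[C]_N := \matrix_(a, b) (if a == b then cexp (- om b u) else 0).
  have : (D *m (adj (A u) *m gram_mx S i (cexp u))) *m A u = 1%:M.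
    rewrite -mulmxA Agram//; apply/matrixP => a b; rewrite !mxE (bigD1 a)//= big1 ?addr0.
      by rewrite !mxE eqxx; case: eqP => [->|_]; rewrite ?mulr0// -cexpD addNr cexp0.
    by move=> c ca; rewrite !mxE eq_sym (negPf ca) mul0r.
  by move=> /mulmx1_unit[].
have Ahiggs u : pdom i u ->
    cexp u *: higgs_mx S i (cexp u) *m A u = A u *m (h u *: shift_mx n).
  move=> ui; have sp := spec u; apply/matrixP => a b.
  transitivity (coord (frame i (cexp u)) a (M (toda_vec b u))).
    rewrite (colA b u ui) (lin_fun_sum (fs_Mlin sp)) linear_sum mxE; apply: eq_bigr => d _.
    by rewrite linearZ /= (eulerME hS (cexp_neq0 u)) linearZ /= !mxE mulrC.
  rewrite toda_vec_M linearZ /= mxE (bigD1 (ordS b))//= big1 ?addr0.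
    by rewrite !mxE eqxx mulr1 mulrC.
  by move=> c cb; rewrite !mxE (negPf cb) !mulr0.
have hA : holo_mx (pdom i) A.
  move=> a b; apply: (holo_ext _ _ (toda_vec_holo i b a)) => // u _; by rewrite mxE.
have omS b : smooth_on (pdom i) (om b) by apply: smooth_sub (toda_fun_pull_smooth _).
have H := toda_matrix hS oi (fun s ui => ui) hA Aunit omS Agram Ahiggs (idx n j) si.
have -> : (fun u => (toda_fun j (cexp u))%:C) = om (idx n j).
  by apply/funext => u; rewrite /om twE.
rewrite H -idx_pred -idxS /om -!twE -!rmorphB /= !cexp_real.
by rewrite rmorphB.
Qed.

Lemma tt_toda t : holomorphic_on setT t -> (forall s, dz t s = h s) ->
  tt_toda_solution n (l : nat)%:Z t toda_fun.
Proof.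
move=> ht dt; split.
- exact: toda_fun_smooth.
- move=> j s; have [i si] := pdom_cover E s.
  pose f u := (toda_fun j (cexp u))%:C : C.
  have sf : smooth_on setT f by exact: toda_fun_pull_smooth.
  have H : isW (fun u => dzbar f u * (conjc (h u))^-1) s (dz (dzbar f) s * (conjc (h s))^-1)
      (dzbar (dzbar f) s * (conjc (h s))^-1 + dzbar f s * (conjc (dz h s) * (- (conjc (h s))^-1 * (conjc (h s))^-1))).
    have Wh := isW_conj (holo_isW hh (I : setT s)).
    have c0 : conjc (h s) != 0 by rewrite conjc_eq0.
    have WV := isW_comp (f := fun w => w^-1) (phi := fun w => conjc (h w)) (@open_neq0 R) (@Ck_inv R 1) c0 Wh.
    have [e1 e2] := isW_val (isW_inv c0).
    have Wf := smooth_isW (smooth_dzbar openT sf) (I : setT s).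
    apply: isW_eq (isW_M Wf WV) _ _; rewrite e1 e2 conjc0.
      by rewrite mul0r mulr0 addr0 mulr0 addr0.
    by rewrite mulr0 addr0.
  rewrite /d_coord /dbar_coord (_ : (fun _ => _) = (fun u => dzbar f u * (conjc (h u))^-1)); last first.
    by apply/funext => u; rewrite dt.
  rewrite (isW_val H).1 dt (dz_dzbarC openT sf I) (dzbar_dz_toda_fun j si) -!mulrA.
  rewrite mulrC -!mulrA [X in _ * X]mulrC.
  have c0 : conjc (h s) != 0 by rewrite conjc_eq0.
  have hs0 := h0 s.
  move: (_%:C) (h s) (conjc (h s)) hs0 c0 => X p q p0 q0.
  by field; rewrite p0.
- by move=> j z _; rewrite /toda_fun; congr (ln (G z _)); congr nat_of_ord; apply: idx_eq; rewrite modzDr.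
- by move=> j z; exact: toda_fun_antisym.
Qed.

End TodaFrame.

Lemma sign_parameters (R : realType) (n : nat) (b : bool) : (1 <= n)%N -> exists (la : R[i]) (l : 'I_n.+1),
  [/\ la * la * omega R n ^+ ((l + n) %% n.+1)%N = 1, la ^+ n.+1 = (-1) ^+ b & l = ~~ b :> nat].
Proof.
move=> hn; case: b.
  exists (cexp (0 +i* (pi / n.+1%:R))), ord0; split=> //.
    rewrite modn_small // add0n -expr2 cexp_imagX.
    rewrite (_ : cexp (0 +i* (2%:R * (pi / n.+1%:R))) = omega R n); last by rewrite /omega mulrA.
    by rewrite -exprS (prim_expr_order (omega_prim n)).
  rewrite cexp_imagX mulrCA mulfV ?pnatr_eq0// mulr1 cexp_imag cospi sinpi.
  by apply/eqP; rewrite eq_complex /= oppr0 !eqxx.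
exists 1, (Ordinal (hn : (1 < n.+1)%N)); split=> //=; last by rewrite expr1n.
by rewrite add1n modnn expr0 !mul1r.
Qed.

Theorem theorem3p2 (R : realType) (n : nat) (hn : (1 <= n)%N)
    (E : holBundle R n.+1) (S : ttData E)
    (hS : tt_structure S) (hPhi : higgs_nonvanishing S)
    (T : forall z, E z -> E z)
    (hT : tt_iso S (scale_higgs (omega R n) S) T) :
  exists (t : R[i] -> R[i]) (e : 'I_n.+1 -> forall s, E (cexp s))
         (w : int -> R[i] -> R),
    [/\ toda_frame S t e w,
        (forall z : R[i], z != 0 -> forall v : E z, iter n.+1 (T z) v = - v) ->
        forall (j : nat) (z : R[i]), (j <= n)%N -> z != 0 ->
          w j%:Z z + w (n%:Z - j%:Z) z = 0 &
        (forall z : R[i], z != 0 -> forall v : E z, iter n.+1 (T z) v = v) ->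
        forall (j : nat) (z : R[i]), (j <= n)%N -> z != 0 ->
          w j%:Z z + w (n.+1%:Z - j%:Z) z = 0].
Proof.
have [pp [hpp pp0 ppE]] := global_scalar hS hPhi hT.
have [h [hh h0 hN]] := holo_rootT n hpp pp0.
have [t ht dt] := primitiveT hh.
have [b bE] := global_sign hS hPhi hT.
have [la [l [lak laN lE]]] := sign_parameters R b hn.
have kN : ((l + n) %% n.+1 < n.+1)%N by rewrite ltn_mod.
have MN s (x : E (cexp s)) : iter n.+1 (@eulerM R n.+1 E S (cexp s)) x = h s ^+ n.+1 *: x.
  by rewrite ppE hN.
have TN s (x : E (cexp s)) : iter n.+1 (T (cexp s)) x = la ^+ n.+1 *: x by rewrite bE laN.
have [e0 [e0P e0h]] := global_section hS hPhi hT kN lak TN hh h0 MN.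
have [G GE] := norm_exists hS hPhi hT h0 e0P.
have toda := tt_toda hS hPhi hT lak hh h0 e0P e0h GE ht dt.
have [_ _ per anti] := toda.
have te0 s : toda_vec S h e0 0 s != 0.
  have H := aframe_neq0 (tt_spec hS hPhi hT (cexp_neq0 s)) (h0 s) (e0P s) 0; exact: H.
exists t, (fun j s => toda_vec S h e0 j s), (toda_fun n G); split.
- split.
  + by split=> // s; rewrite dt.
  + by move=> s; have H := toda_vec_basis hS hPhi hT h0 e0P s; exact: H.
  + move=> i a j; have H := toda_vec_holo hS hh h0 e0h i j a; exact: H.
  + exists l; split.
    * by move=> i j s; have H := toda_vec_eta hS hPhi hT lak h0 e0P i j s; exact: H.
    * move=> j s X; rewrite mulrC (higgsZ hS (cexp_neq0 s)) dt mulrC -scalerA.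
      by have := toda_vec_M hS hPhi hT h0 e0P j s; rewrite /eulerM => ->.
    * by move=> i j s; have H := toda_vec_metric hS hPhi hT h0 e0P GE i j s; exact: H.
    * exact: toda.
- move=> TNeg j z jn z0; case: b bE laN lE => bE laN lE; last first.
    have := te0 0; have := TNeg _ (cexp_neq0 0) (toda_vec S h e0 0 0); rewrite bE expr0 scale1r.
    move=> /eqP; rewrite -subr_eq0 opprK -mulr2n -scaler_nat scaler_eq0 pnatr_eq0 /=.
    by move=> /eqP ->; rewrite eqxx.
  have := anti j%:Z z z0; rewrite lE /= -(per (_ - 1))// => <-; congr (_ + toda_fun _ _ _ _).
  by rewrite intS; ring.
- move=> TPos j z jn z0; case: b bE laN lE => bE laN lE.
    have := te0 0; have := TPos _ (cexp_neq0 0) (toda_vec S h e0 0 0); rewrite bE expr1 scaleN1r.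
    move=> /esym/eqP; rewrite -subr_eq0 opprK -mulr2n -scaler_nat scaler_eq0 pnatr_eq0 /=.
    by move=> /eqP ->; rewrite eqxx.
  have := anti j%:Z z z0; rewrite lE /= -(per (_ - 1))// => <-; congr (_ + toda_fun _ _ _ _).
  by rewrite intS; ring.
Qed.
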